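(* Let $(\ell_n)_{n\ge 1}$ be a sequence of real numbers in $(0,1)$ decreasing to zero, such that $\sum_{n=1}^\infty \ell_n=\infty$ and $\sum_{n=1}^{\infty}(\ell_n-\ell_{n+1})\exp\left(\sum_{k=1}^n \ell_k\right)<\infty$. Suppose that there exists an integer $d\ge 1$ such that $$\int_{\mathbb{T}^d}K(t_1)\cdots K(t_d)\,K\Big(-\sum_{i=1}^d t_i\Big)\,\mathrm{d}t_1\cdots \mathrm{d}t_d<\infty .$$ Then, almost surely, the Dvoretzky measure $\mu_D$ is a Rajchman measure and the non-covered set $E$ is an $M_0$-set.
   Context: $\mathbb{T}=\mathbb{R}/\mathbb{Z}$ is identified with $[0,1)$ and carries Lebesgue (Haar probability) measure; $\|t\|=\inf_{n\in\mathbb{Z}}|t-n|$ for $t\in\mathbb T$. $(\omega_n)_{n\ge1}$ is a sequence of independent random variables on a probability space $(\Omega,\mathcal B,\mathbb P)$, each uniformly distributed on $\mathbb{T}$. The random intervals are $I_n=(\omega_n,\omega_n+\ell_n)\bmod 1$, and the non-covered set is $E=\mathbb{T}\setminus\bigcup_{n=1}^\infty I_n$, a closed subset of $\mathbb T$. The function $K:\mathbb{T}\to[1,\infty]$ is $K(t)=\exp\left(\sum_{n=1}^\infty(\ell_n-\|t\|)_+\right)$, where $x_+=\max(x,0)$. For $t\in\mathbb{T}$ and $n\ge 1$ put $P_n(t)=\dfrac{1-\mathbf 1_{(0,\ell_n)}(t-\omega_n)}{1-\ell_n}$ (with $t-\omega_n$ taken modulo $1$ in $[0,1)$), $M_n(t)=\prod_{k=1}^n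 P_k(t)$, and $\mu_n(\mathrm{d}t)=M_n(t)\,\mathrm{d}t$. Almost surely, $\mu_n$ converges weakly to a random finite measure on $\mathbb T$, denoted $\mu_D$ and called the Dvoretzky measure. A finite measure on $\mathbb{T}$ is called a Rajchman measure if its Fourier coefficients tend to $0$ as $|n|\to\infty$. A closed set $S\subset\mathbb{T}$ is called an $M_0$-set if there exists a non-zero measure supported on $S$ whose Fourier coefficients tend to $0$ as $|n|\to\infty$.
   Formalization: The non-covered set E is claimed to be an M_0-set almost surely only when it is non-empty, because E is empty with positive probability (finitely many intervals can cover the circle) and the empty set supports no non-zero measure. *)

(* Defs.v *)
From HB Require Import structures.
From mathcomp Require Import all_boot all_order all_algebra.
From mathcomp Require Import finmap complex.
From mathcomp Require Import all_classical all_reals all_analysis.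

Set Implicit Arguments.
Unset Strict Implicit.
Unset Printing Implicit Defensive.

Import Order.TTheory GRing.Theory Num.Theory.
Import numFieldNormedType.Exports.

Local Open Scope classical_set_scope.
Local Open Scope ring_scope.

(** The circle T = R/Z is the set [0, 1[ of real numbers: a function on T is a
    1-periodic function on R, and a measure on T is a measure on R that gives
    mass 0 to the complement of [0, 1[.  Sequences indexed by n >= 1 are
    shifted to start at 0: [l n] stands for ell_(n+1), [w n] for omega_(n+1). *)

Section circle.
Variable R : realType.
Local Notation mR := (measurableTypeR R).

Definition circle : set mR := `[0, 1[%classic.

Definition mod1 (t : R) : R := t - (Num.floor t)%:~R.

Definition circle_norm (t : R) : R :=
  inf [set `|t - n%:~R| | n in [set: int]].

(** The topology of T is the quotient topology of R, not that of [0, 1[. *)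
Definition circle_closed (S : set R) : Prop :=
  S `<=` circle /\ closed [set t : R | S (mod1 t)].

Lemma measurable_circle : measurable circle.
Proof. exact: measurable_itv. Qed.

Definition circle_lebesgue : set mR -> \bar R :=
  mrestr lebesgue_measure measurable_circle.

HB.instance Definition _ := Measure.on circle_lebesgue.

Let circle_lebesgue_setT : circle_lebesgue [set: mR] = 1%E.
Proof.
rewrite /circle_lebesgue /mrestr setTI /circle lebesgue_measure_itv/=.
by rewrite lte_fin ltr01 oppr0 adde0.
Qed.

HB.instance Definition _ :=
  @Measure_isProbability.Build _ _ R circle_lebesgue circle_lebesgue_setT.

Definition tuple_cons (n : nat) (x : mR * n.-tuple mR) : n.+1.-tuple mR :=
  [tuple of x.1 :: x.2].

Lemma measurable_tuple_cons n : measurable_fun [set: _] (@tuple_cons n).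
Proof. exact: measurable_cons. Qed.

HB.instance Definition _ n := @isMeasurableFun.Build _ _ _ _ (@tuple_cons n)
  (@measurable_tuple_cons n).

(** Lebesgue measure on T^d, as a measure on d-tuples of real numbers. *)
Fixpoint torus_lebesgue (d : nat) : probability (d.-tuple mR) R :=
  match d with
  | 0 => \d_([tuple] : 0.-tuple mR)
  | d'.+1 =>
      distribution (circle_lebesgue \x torus_lebesgue d')%E (@tuple_cons d')
  end.

End circle.

Section fourier.
Variable R : realType.
Implicit Types (mu : {finite_measure set (measurableTypeR R) -> \bar R}) (S : set R).

Definition fourier_coef mu (n : int) : R[i] :=
  Complex (\int[mu]_t cos (2 * pi * n%:~R * t))
          (- \int[mu]_t sin (2 * pi * n%:~R * t)).

Definition rajchman mu : Prop :=
  (ComplexField.Normc.normc (fourier_coef mu n%:Z) @[n --> \oo] --> (0 : R)) /\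
  (ComplexField.Normc.normc (fourier_coef mu (- n%:Z)) @[n --> \oo] --> (0 : R)).

(** "Supported on the closed set [S]": the complement of [S] is negligible. *)
Definition M0_set S : Prop :=
  circle_closed S /\
  exists mu, [/\ mu [set: R] != 0%E, mu.-negligible (~` S) & rajchman mu].

End fourier.

Section probability.
Context (R : realType) (d : measure_display) (Om : measurableType d).
Variable P : probability Om R.

Definition mutually_independent (X : nat -> {RV P >-> R}) : Prop :=
  forall (J : {fset nat}) (A : nat -> set R), (forall j, measurable (A j)) ->
    P (\bigcap_(j in [set` J]) (X j @^-1` A j)) =
    (\prod_(j <- J) P (X j @^-1` A j))%E.

Definition circle_uniform (X : {RV P >-> R}) : Prop :=
  forall A : set R, measurable A -> distribution P X A = circle_lebesgue A.

End probability.

Section covering.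
Context (R : realType) (l : nat -> R).

Definition covering_kernel (t : R) : \bar R :=
  expeR (\sum_(0 <= n <oo) (Num.max (l n - circle_norm t) 0)%:E)%E.

Variable w : nat -> R.

Definition random_arc (n : nat) : set R :=
  @mod1 R @` `]w n, (w n + l n)[%classic.

(** When the lengths have sum > 1 this set is empty with positive probability,
    so that it can be an M0-set almost surely only up to the event that it is
    empty: the empty set carries no non-zero measure. *)
Definition noncovered : set R := @circle R `\` \bigcup_n random_arc n.

Definition dvoretzky_factor (n : nat) (t : R) : R :=
  (1 - \1_(`]0, l n[%classic) (mod1 (t - w n))) / (1 - l n).

(** The product of the first [n] factors. *)
Definition dvoretzky_density (n : nat) (t : R) : R :=
  \prod_(k < n) dvoretzky_factor k t.

(** [mu] is a measure on T and the weak limit of the measures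
    [dvoretzky_density n t dt] on T. *)
Definition is_dvoretzky_measure (mu : {finite_measure set (measurableTypeR R) -> \bar R}) :=
  mu (~` @circle R) = 0%E /\
  forall f : R -> R, continuous f -> (forall t, f (t + 1) = f t) ->
    \int[@circle_lebesgue R]_t (f t * dvoretzky_density n t) @[n --> \oo]
      --> \int[mu]_t f t.

End covering.

(* Main.v *)
Require Import Defs.
From HB Require Import structures.
From mathcomp Require Import all_boot all_order all_algebra.
From mathcomp Require Import fingroup perm finmap complex.
From mathcomp Require Import all_classical all_reals all_analysis.
From mathcomp Require Import measurable_realfun.
From mathcomp Require Import ring lra.

(** Write M_n for the density of the first n factors, lam for Lebesgue measure,
    and N_m for the total mass of M_m.

    Decay of the Fourier coefficients.  It suffices to bound, uniformly in n, the
    mean of the sum over k of |H_k|^p, where p = 2 (d + 1) and H_k is the integral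
    of cos(2 pi k t - phi) M_n(t) over one of the two half circles, for the phases
    phi = 0 and pi / 2: by Fatou's lemma the p-th powers of the coefficients of
    muD are then almost surely summable ([ae_cvg0_of_mean]).  Every k < N is the
    difference i - j of at least N pairs i, j < 2N, so the sum over k < N is
    bounded once the double sum of |H_(i-j)|^p has a mean of order N ([moment_le]).
    Expanding the power, this double sum is an integral over p points t_s of the
    product of the M_n(t_s) against the double sum of the products of the
    cos(2 pi (i - j) t_s - phi).  The latter is at most the sum over signs of
    a Fejer kernel taken at +- t_1 ... +- t_p ([cos_prod_le]).  On sorted points of
    a half circle the mean of the product of the M_n(t_s) is at most a constant
    times the product of the K(t_(s+1) - t_s) ([correlation_le]).  The integral
    that is left is that of a chain, in which every second point can be used to
    convolve the Fejer kernel with K, while the others only cost a constant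
    ([chain_le]).  There are d + 1 convolutions, and the supremum of the
    convolution power K^(d+1) is its value at 0, because symmetric decreasing
    functions are stable under convolution ([sym_dec_conv]); this value is the
    integral that is assumed to be finite ([Kpow_torus]).

    Non-degeneracy.  It remains to see that muD does not vanish when the
    noncovered set is nonempty.  Let n be such that the arcs of index at least n
    are short.  If a point of a window [a, a + 1/8] is never covered, then for m
    large the first m arcs leave a leftmost gap in the window, which starts at the
    right end c of one of them ([gap_event_eventually]).  The position of this gap
    carries no information on the late arcs that start in the half circle to the
    right of c: they can be resampled there ([first_gap_inert]).  A second moment
    estimate then shows that with probability at least 1/4 the points just beyond
    c survive in the expected quantity ([paley_zygmund]), which bounds N_m from
    below by a multiple of a gain whose inverse has a bounded mean over all
    possible gaps ([integral_inv_gain_le]).  Hence, for an event G that depends on the first n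
    arcs only, the probability of G and of a gap is at most four times that of G
    and of N_m being at least some constant, up to an arbitrarily small error
    ([gap_event_bound]).  Let G be the event that N_n is small, which for n
    large is close to the extinction of the mass.  On G it becomes improbable that
    N_m is large again as m grows, and so does the occurrence of a gap
    ([gap_extinction_negligible]).

    Support.  An arc is the set where a cosine exceeds a constant.  This makes the
    noncovered set closed, and provides a test function that shows that muD gives
    no mass to the arc ([arc_negligible]). *)

Set Implicit Arguments.
Unset Strict Implicit.
Unset Printing Implicit Defensive.

Import Order.TTheory GRing.Theory Num.Theory.
Import numFieldNormedType.Exports.

Local Open Scope classical_set_scope.
Local Open Scope ring_scope.

(** * Rotations and reflections of the circle *)

Section circle_facts.
Variable R : realType.
Local Notation mR := (measurableTypeR R).
Local Notation lam := (@circle_lebesgue R).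
Implicit Types (t x y c a : R) (n : nat).

Lemma mod1_ge0 t : 0 <= mod1 t.
Proof. by rewrite subr_ge0 Num.Theory.floor_le_tmp. Qed.

Lemma mod1_lt1 t : mod1 t < 1.
Proof.
by rewrite ltrBlDr addrC -[X in _ < _ + X]/(1%:~R) -intrD floorD1_gt.
Qed.

Lemma mod1_id t : 0 <= t < 1 -> mod1 t = t.
Proof.
move=> t01; have -> : mod1 t = t - (Num.floor t)%:~R by [].
by rewrite (@floor_def _ t 0) ?subr0// add0r.
Qed.

Lemma mod1Dz t (k : int) : mod1 (t + k%:~R) = mod1 t.
Proof. by rewrite /mod1 floorDrz ?intr_int// intrKfloor intrD opprD addrACA subrr addr0. Qed.

Lemma mod1_shift t (k : int) : 0 <= t - k%:~R < 1 -> mod1 t = t - k%:~R.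
Proof. by move=> /mod1_id <-; rewrite -mulrNz mod1Dz. Qed.

Lemma mod1D1 t : mod1 (t + 1) = mod1 t.
Proof. exact: (mod1Dz t 1). Qed.

Lemma mod1B1 t : mod1 (t - 1) = mod1 t.
Proof. exact: (mod1Dz t (-1)). Qed.

Lemma mod1E t : exists k : int, t = mod1 t + k%:~R.
Proof. by exists (Num.floor t); rewrite subrK. Qed.

Lemma mod1_shift1 t : 1 <= t < 2 -> mod1 t = t - 1.
Proof. by move=> h; apply: (@mod1_shift _ 1); rewrite -[1%:~R]/(1 : R); lra. Qed.

Lemma mod1_shiftN1 t : - 1 <= t < 0 -> mod1 t = t + 1.
Proof. by move=> h; rewrite -mod1D1 mod1_id//; lra. Qed.

Lemma mod1Dl t x : mod1 (mod1 t + x) = mod1 (t + x).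
Proof.
by have [k tE] := mod1E t; rewrite [in RHS]tE [in RHS]addrAC mod1Dz.
Qed.

Lemma mod1Dr t x : mod1 (x + mod1 t) = mod1 (x + t).
Proof. by rewrite addrC mod1Dl addrC. Qed.

Lemma mod1Br t x : mod1 (x - mod1 t) = mod1 (x - t).
Proof.
have [k tE] := mod1E t.
rewrite [X in _ = mod1 (_ - X)]tE.
by rewrite (_ : x - (mod1 t + k%:~R) = x - mod1 t + (- k)%:~R) ?mod1Dz// mulrNz; ring.
Qed.

Lemma mod1N t : 0 < mod1 t -> mod1 (- t) = 1 - mod1 t.
Proof.
move=> t0; have [k {1}->] := mod1E t.
rewrite opprD -mulrNz mod1Dz -mod1D1 addrC mod1_id//.
by rewrite subr_ge0 (ltW (mod1_lt1 t))/= gtrBl.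
Qed.

Definition periodic1 (T : Type) (f : R -> T) := forall t, f (t + 1) = f t.

Lemma periodicE (T : Type) (f : R -> T) : periodic1 f -> forall t, f (mod1 t) = f t.
Proof.
move=> pf.
have pz (n : nat) t : f (t + n%:R) = f t.
  by elim: n t => [|n IH] t; rewrite ?addr0// -natr1 addrA pf IH.
move=> t; have [k tE] := mod1E t; rewrite [in RHS]tE; case: k {tE} => n.
  by rewrite -[n%:~R]/(n%:R) pz.
by rewrite NegzE mulrNz -[RHS](pz n.+1) subrK.
Qed.

Lemma measurable_mod1 : measurable_fun [set: mR] (@mod1 R : mR -> mR).
Proof.
apply: measurable_funB => //.
have mf : measurable_fun [set: R] (fun t : R => (Num.floor t)%:~R : R).
  apply: nondecreasing_measurable => //.
  by move=> x y xy; rewrite ler_int; exact: le_floor.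
exact: mf.
Qed.

Lemma lebesgue_translate c (A : set mR) : measurable A ->
  lebesgue_measure ((fun t : mR => t + c : mR) @^-1` A) = lebesgue_measure A.
Proof.
move=> mA; have mt : measurable_fun [set: mR] (fun t : mR => t + c : mR).
  exact: measurable_funD.
pose m' := pushforward lebesgue_measure (fun t : mR => t + c : mR).
apply/esym/(@lebesgue_measure_unique _ m') => // _ [[u v]] _ <-.
have E : (fun t : mR => t + c : mR) @^-1` `]u, v]%classic = `]u - c, v - c]%classic.
  by apply/seteqP; split => t /=; rewrite !in_itv/= ltrBlDr lerBrDr.
transitivity (lebesgue_measure (`]u - c, v - c]%classic : set mR)); last by rewrite -E.
rewrite !lebesgue_measure_itv/= !lte_fin ltrD2r.
by case: ifP => // _; congr EFin; ring.
Qed.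

Lemma lamE (A : set mR) : lam A = lebesgue_measure (A `&` @circle R).
Proof. by []. Qed.

Lemma measurable_circle_map (c : R) :
  measurable_fun [set: mR] (fun t : mR => mod1 (t + c) : mR).
Proof. apply: (measurableT_comp measurable_mod1); exact: measurable_funD. Qed.

(** On the circle a translation by e in [0, 1[ exchanges the intervals [0, 1 - e[ and
    [1 - e, 1[, and acts on each of them as a translation of the line. *)
Lemma lam_shift c (A : set mR) : measurable A ->
  lam ((fun t : mR => mod1 (t + c) : mR) @^-1` A) = lam A.
Proof.
move=> mA.
have [e [fE e0 e1]] : exists e,
    [/\ forall t, mod1 (t + c) = mod1 (t + e), 0 <= e & e < 1].
  by exists (mod1 c); split => [t||]; rewrite ?mod1Dr ?mod1_ge0 ?mod1_lt1.
rewrite !lamE.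
have mI b (u v : R) : measurable (A `&` [set` Interval (BSide b u) (BSide true v)]).
  by apply: measurableI => //; exact: measurable_itv.
have mS u (B : set mR) : measurable B ->
    measurable ((fun t : mR => t + u : mR) @^-1` B).
  move=> mB; rewrite -[X in measurable X]setTI.
  by apply: (measurable_funD (f := id)) => //.
have -> : (fun t => mod1 (t + c)) @^-1` A `&` @circle R =
   ((fun t => t + e) @^-1` (A `&` `[e, 1[%classic)) `|`
   ((fun t => t + (e - 1)) @^-1` (A `&` `[0, e[%classic)).
  apply/seteqP; split => t; rewrite /circle /= !in_itv/= fE.
    move=> [At /andP[t0 t1]].
    have [te|te] := ltP (t + e) 1.
      left; split; last by lra.
      by rewrite -(@mod1_id (t + e)) //; lra.
    right; have E : mod1 (t + e) = t + (e - 1).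
      by rewrite addrA mod1_shift1 //; lra.
    by rewrite -{1}E; split => //; lra.
  move=> [[At H]|[At H]].
    by rewrite mod1_id; [split => //; lra|lra].
  have E : mod1 (t + e) = t + (e - 1).
    by rewrite addrA mod1_shift1 //; lra.
  by rewrite E; split => //; lra.
rewrite measureU; [|exact: mS|exact: mS|]; last first.
  apply/seteqP; split => t //=; rewrite !in_itv/=; lra.
have -> : A `&` @circle R = (A `&` `[e, 1[%classic) `|` (A `&` `[0, e[%classic).
  rewrite -setIUr; congr (_ `&` _).
  apply/seteqP; split => t; rewrite /circle /= !in_itv/=; first by lra.
  by lra.
rewrite measureU; [|exact: mI|exact: mI|]; last first.
  by apply/seteqP; split => t //=; rewrite !in_itv/=; lra.
by congr (_ + _)%E; apply: lebesgue_translate; apply: mI.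
Qed.

(** On ]0, 1[ the reflection is t |-> 1 - t, and the point 0 is null. *)
Lemma lam_opp (A : set mR) : measurable A ->
  lam ((fun t : mR => mod1 (- t) : mR) @^-1` A) = lam A.
Proof.
move=> mA; rewrite !lamE.
have mo : measurable_fun [set: mR] (-%R : mR -> mR).
  by apply: (@measurable_funN _ mR R setT id); exact: measurable_id.
have mN := measurableT_comp measurable_mod1 mo.
have mI : measurable (A `&` `]0, 1[%classic).
  by apply: measurableI => //; exact: measurable_itv.
have m0 B : measurable B -> measurable (B `&` [set 0 : mR]).
  by move=> mB; exact: measurableI.
have E (B : set mR) : measurable B ->
    lebesgue_measure (B `&` @circle R) = lebesgue_measure (B `&` `]0, 1[%classic).
  move=> mB.
  have -> : B `&` @circle R = (B `&` `]0, 1[%classic) `|` (B `&` [set 0]).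
    rewrite -setIUr; congr (_ `&` _); rewrite /circle.
    apply/seteqP; split => t; rewrite /= !in_itv/=; last first.
      by case=> [|->]; lra.
    by move=> /andP[]; rewrite le_eqVlt => /predU1P[->|->] ->; [right|left].
  rewrite measureU0//.
  - by apply: measurableI => //; exact: measurable_itv.
  - exact: m0.
  - apply/eqP; rewrite eq_le measure_ge0 andbT -(lebesgue_measure_set1 (0:R)).
    by rewrite le_measure ?inE//; exact: m0.
rewrite E; last first.
  by rewrite -[X in measurable X]setTI; exact: mN.
rewrite E//.
rewrite -(lebesgue_measureN mI) /pushforward.
rewrite -(@lebesgue_translate 1); last first.
  by apply: measurableI => //; rewrite -[X in measurable X]setTI; exact: mN.
congr lebesgue_measure.
have E1 t : - 1 < t < 0 -> mod1 (- (t + 1)) = - t.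
  by move=> t01; rewrite opprD mod1B1 mod1_id//; lra.
apply/seteqP; split => t; rewrite /= !in_itv/=.
  by move=> [At t01]; rewrite E1 in At; [split => //; lra|lra].
by move=> [At t01]; rewrite E1; [split => //; lra|lra].
Qed.

Lemma integral_lam_map (g : mR -> mR) (f : R -> \bar R) :
  measurable_fun setT g ->
  (forall A : set mR, measurable A -> lam (g @^-1` A) = lam A) ->
  measurable_fun setT f -> (forall x, 0 <= f x)%E ->
  (\int[lam]_t f (g t) = \int[lam]_t f t)%E.
Proof.
move=> mg gE mf f0.
rewrite -[LHS](@ge0_integral_pushforward _ _ _ _ _ g mg lam setT f)//.
by apply: eq_measure_integral => A mA _; exact: gE.
Qed.

Lemma integral_lam_shift c (f : R -> \bar R) : periodic1 f ->
  measurable_fun setT f -> (forall x, 0 <= f x)%E ->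
  (\int[lam]_t f (t + c)%R = \int[lam]_t f t)%E.
Proof.
move=> pf mf f0.
rewrite -(integral_lam_map (measurable_circle_map c) (@lam_shift c) mf f0).
by apply: eq_integral => t _; rewrite periodicE.
Qed.

Lemma integral_lam_opp c (f : R -> \bar R) : periodic1 f ->
  measurable_fun setT f -> (forall x, 0 <= f x)%E ->
  (\int[lam]_t f (c - t)%R = \int[lam]_t f t)%E.
Proof.
move=> pf mf f0.
have mN : measurable_fun setT (fun t : mR => mod1 (- t) : mR).
  by apply: (measurableT_comp measurable_mod1) => //; exact: (@measurable_funN _ mR R setT id).
rewrite -(integral_lam_shift c pf mf f0).
rewrite -[RHS](integral_lam_map mN lam_opp).
- apply: eq_integral => t _; rewrite -[LHS]periodicE// -[RHS]periodicE//.
  by rewrite mod1Dl addrC.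
- by apply: measurableT_comp => //; exact: measurable_funD.
- by move=> x.
Qed.

End circle_facts.

(** * Lebesgue measure on the torus *)

Section torus_facts.
Variable R : realType.
Local Notation mR := (measurableTypeR R).
Local Notation lam := (@circle_lebesgue R).
Local Notation torus n := (torus_lebesgue R n).

Definition box n (A : 'I_n -> set mR) : set (n.-tuple mR) :=
  [set w | forall i, A i (tnth w i)].

Lemma measurable_box n (A : 'I_n -> set mR) : (forall i, measurable (A i)) ->
  measurable (box A).
Proof.
move=> mA; have -> : box A = \bigcap_(i in [set: 'I_n]) ((@tnth n mR)^~ i @^-1` A i).
  by apply/seteqP; split => w /= wA i; [move=> _; exact: wA|exact: wA].
apply: fin_bigcap_measurable => // i _.
by rewrite -[X in measurable X]setTI; exact: measurable_tnth.
Qed.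

Lemma box_setI n (A B : 'I_n -> set mR) : box A `&` box B = box (fun i => A i `&` B i).
Proof.
apply/seteqP; split => w /=; first by move=> [wA wB] i; split.
by move=> wAB; split => i; have [] := wAB i.
Qed.

(** Boxes generate the product sigma-algebra and are stable under intersection, so that
    measures on tuples can be compared on boxes. *)
Lemma measurable_tupleE n :
  measurable = <<s [set box A | A in [set A : 'I_n -> set mR | forall i, measurable (A i)]] >>
  :> set (set (n.-tuple mR)).
Proof.
apply/seteqP; split.
  apply: smallest_sub; first exact: smallest_sigma_algebra.
  move=> X; rewrite /= -bigcup_seq => -[i _ [Y mY <-]].
  apply: sub_sigma_algebra; exists (fun j => if j == i then Y else setT).
    by move=> j /=; case: ifP.
  apply/seteqP; split => w /=; rewrite ?setTI/=.
    by move/(_ i); rewrite eqxx.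
  by move=> [_ wY] j; case: eqP => // ->.
apply: smallest_sub; first exact: sigma_algebra_measurable.
by move=> _ [A mA <-]; exact: measurable_box.
Qed.

Lemma tuple_measure_unique n (m1 m2 : {measure set (n.-tuple mR) -> \bar R}) :
  (m1 setT < +oo)%E ->
  (forall A : 'I_n -> set mR, (forall i, measurable (A i)) -> m1 (box A) = m2 (box A)) ->
  forall X, measurable X -> m1 X = m2 X.
Proof.
move=> m1T m12 X mX.
have boxT : box (fun _ : 'I_n => setT) = setT by apply/seteqP; split.
apply: (measure_unique _ (fun _ => setT) (@measurable_tupleE n)) => //.
- move=> _ _ [A mA <-] [B mB <-]; rewrite box_setI.
  by eexists; last reflexivity; move=> i /=; exact: measurableI.
- by move=> _; exists (fun _ => setT).
- by rewrite bigcup_const//; exists 0%N.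
- by move=> _ [A mA <-]; exact: m12.
Qed.

Lemma torus_consE n (X : set (n.+1.-tuple mR)) :
  torus n.+1 X = (lam \x torus n)%E ((@tuple_cons R n) @^-1` X).
Proof. by []. Qed.

Lemma torus_box n (A : 'I_n -> set mR) : (forall i, measurable (A i)) ->
  torus n (box A) = (\prod_(i < n) lam (A i))%E.
Proof.
elim: n A => [|n IH] A mA.
  rewrite big_ord0 /= diracE mem_set//= => -[] //.
rewrite torus_consE big_ord_recl -IH; last by move=> i; exact: mA.
have -> : (@tuple_cons R n) @^-1` box A =
    A ord0 `*` box (fun i => A (lift ord0 i)).
  apply/seteqP; split => -[t s] /=.
    by move=> H; split=> [|i]; [exact: (H ord0)|have := H (lift ord0 i); rewrite tnthS].
  move=> [H0 H] i; case: (unliftP ord0 i) => [j ->|->//]; by rewrite tnthS.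
by rewrite product_measure1E//; exact: measurable_box.
Qed.

Lemma integral_torus_cons n (F : n.+1.-tuple mR -> \bar R) :
  measurable_fun setT F -> (forall w, 0 <= F w)%E ->
  (\int[torus n.+1]_w F w =
   \int[lam]_t \int[torus n]_s F (tuple_cons (t, s)))%E.
Proof.
move=> mF F0.
have mFc : measurable_fun setT (F \o (@tuple_cons R n)).
  by apply: measurableT_comp => //; exact: measurable_tuple_cons.
rewrite -(fubini_tonelli1 (m1 := lam) (m2 := torus n) _ mFc)//; last by move=> x /=.
rewrite -[RHS](@ge0_integral_pushforward _ _ _ _ _ (@tuple_cons R n) (@measurable_tuple_cons R n) _ setT F)//.
Qed.

Lemma integral_torus_map n (g : n.-tuple mR -> n.-tuple mR) (F : n.-tuple mR -> \bar R) :
  measurable_fun setT g ->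
  (forall A, (forall i, measurable (A i)) -> torus n (g @^-1` box A) = torus n (box A)) ->
  measurable_fun setT F -> (forall w, 0 <= F w)%E ->
  (\int[torus n]_w F (g w) = \int[torus n]_w F w)%E.
Proof.
move=> mg gE mF F0.
rewrite -[LHS](@ge0_integral_pushforward _ _ _ _ _ g mg (torus n) setT F)//.
apply: eq_measure_integral => A mA _.
pose m1 := pushforward (torus n) g.
apply: (@tuple_measure_unique n m1 (torus n)) => //.
by rewrite /m1/= /pushforward preimage_setT probability_setT ltry.
Qed.

Definition perm_tuple n (s : {perm 'I_n}) (w : n.-tuple mR) : n.-tuple mR :=
  [tuple tnth w (s i) | i < n].

Lemma measurable_perm_tuple n (s : {perm 'I_n}) :
  measurable_fun setT (perm_tuple s).
Proof.
apply/measurable_fun_tnthP => i /=.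
rewrite (_ : _ \o _ = (@tnth n mR)^~ (s i)); first exact: measurable_tnth.
by apply/funext => w /=; rewrite tnth_mktuple.
Qed.

Lemma integral_torus_perm n (s : {perm 'I_n}) (F : n.-tuple mR -> \bar R) :
  measurable_fun setT F -> (forall w, 0 <= F w)%E ->
  (\int[torus n]_w F (perm_tuple s w) = \int[torus n]_w F w)%E.
Proof.
move=> mF F0; apply: integral_torus_map => //; first exact: measurable_perm_tuple.
move=> A mA.
have -> : perm_tuple s @^-1` box A = box (fun i => A ((s^-1)%g i)).
  apply/seteqP; split => w /= H i.
    by have := H ((s^-1)%g i); rewrite tnth_mktuple permKV.
  by have := H (s i); rewrite permK tnth_mktuple.
rewrite !torus_box//.
by rewrite (reindex_inj (@perm_inj _ s)) /=; apply: eq_bigr => i _; rewrite permK.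
Qed.

Definition upd n (w : n.-tuple mR) (j : 'I_n) (y : mR) : n.-tuple mR :=
  [tuple if i == j then y else tnth w i | i < n].

Lemma measurable_upd n (j : 'I_n) :
  measurable_fun setT (fun wy : n.-tuple mR * mR => upd wy.1 j wy.2).
Proof.
apply/measurable_fun_tnthP => i /=.
rewrite (_ : _ \o _ = fun wy : n.-tuple mR * mR => if i == j then wy.2 else tnth wy.1 i); last first.
  by apply/funext => w /=; rewrite tnth_mktuple.
case: eqP => _; first exact: measurable_snd.
exact: (measurableT_comp (measurable_tnth i) measurable_fst).
Qed.

(** The law of a tuple is preserved when one coordinate is drawn again, as can be seen on
    boxes.  All the conditioning on the other arcs is expressed in this way. *)
Lemma integral_resample n (j : 'I_n) (F : n.-tuple mR -> \bar R) :
  measurable_fun setT F -> (forall w, 0 <= F w)%E ->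
  (\int[torus n]_w \int[lam]_y F (upd w j y) = \int[torus n]_w F w)%E.
Proof.
move=> mF F0; pose g (wy : n.-tuple mR * mR) := upd wy.1 j wy.2.
have mg : measurable_fun setT g by exact: measurable_upd.
have mFg : measurable_fun setT (F \o g) by exact: measurableT_comp.
rewrite -(fubini_tonelli1 (m1 := torus n) (m2 := lam) _ mFg)//; last by move=> x /=.
rewrite -[LHS](@ge0_integral_pushforward _ _ _ _ _ g mg (torus n \x lam)%E setT F)//.
apply: eq_measure_integral => A mA _.
pose m1 := pushforward (torus n \x lam)%E g.
apply: (@tuple_measure_unique n m1 (torus n)) => //.
  by rewrite /m1/= /pushforward preimage_setT probability_setT ltry.
move=> {A mA} A mA; change ((torus n \x lam)%E (g @^-1` box A) = torus n (box A)).
have -> : g @^-1` box A = box (fun i => if i == j then setT else A i) `*` A j.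
  apply/seteqP; split => -[w y] /=.
    move=> H; split=> [i|].
      by have := H i; rewrite tnth_mktuple; case: eqP.
    by have := H j; rewrite tnth_mktuple eqxx.
  by move=> [H Hy] i; rewrite tnth_mktuple; have := H i; case: eqP => // ->.
have mB i : measurable (if i == j then setT else A i) by case: ifP.
rewrite product_measure1E//; last exact: measurable_box.
rewrite (torus_box mA) [in RHS](bigD1 j)//= muleC; congr (_ * _)%E.
rewrite (_ : torus n _ = \prod_(i < n) lam (if i == j then setT else A i))%E; last exact: torus_box.
rewrite (bigD1 j)//= eqxx [X in (X * _)%E](_ : _ = 1%E) ?mul1e.
  by apply: eq_bigr => i /negbTE ->.
exact: (@probability_setT _ _ _ lam).
Qed.

End torus_facts.

(** * The law of the starts and the covering kernel *)

Section law.
Context (R : realType) (d : measure_display) (Om : measurableType d).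
Local Notation mR := (measurableTypeR R).
Local Notation lam := (@circle_lebesgue R).
Local Notation torus n := (torus_lebesgue R n).
Variables (P : probability Om R) (omega : nat -> {RV P >-> R}).
Hypothesis indep : mutually_independent omega.
Hypothesis unif : forall n, circle_uniform (omega n).

Definition starts n (x : Om) : n.-tuple mR := [tuple omega i x | i < n].

Lemma measurable_starts n : measurable_fun setT (@starts n).
Proof.
apply/measurable_fun_tnthP => i /=.
rewrite (_ : _ \o _ = omega i :> (Om -> mR)); first exact: (measurable_funPT (omega i)).
by apply/funext => w /=; rewrite tnth_mktuple.
Qed.

Lemma indep_prod n (A : nat -> set R) : (forall i, measurable (A i)) ->
  P [set x | forall i, (i < n)%N -> A i (omega i x)] = (\prod_(i < n) lam (A i))%E.
Proof.
move=> mA; pose J : {fset nat} := [fset i in iota 0 n]%fset.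
have JE : perm_eq J (iota 0 n).
  apply: uniq_perm; [exact: fset_uniq|exact: iota_uniq|].
  by move=> i; rewrite inE.
transitivity (\prod_(i <- J) P (omega i @^-1` A i))%E; last first.
  rewrite (perm_big _ JE) -(big_mkord xpredT (fun i => lam (A i))) /=.
  by rewrite /index_iota subn0; apply: eq_bigr => i _; rewrite -(unif i).
rewrite -indep//; congr (P _); apply/seteqP; split => x /=.
  by move=> H i /=; rewrite inE mem_iota add0n => /H.
by move=> H i ni; apply: H; rewrite /= inE mem_iota add0n.
Qed.

(** Independence gives the measure of boxes, which determines the law. *)
Lemma law_starts n (X : set (n.-tuple mR)) : measurable X ->
  P (@starts n @^-1` X) = torus n X.
Proof.
move=> mX; have ms := @measurable_starts n; pose m1 := pushforward P (@starts n).
apply: (@tuple_measure_unique R n m1 (torus n)) => //.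
  by rewrite /m1/= /pushforward preimage_setT probability_setT ltry.
move=> A mA; change (P (@starts n @^-1` box A) = torus n (box A)).
rewrite (torus_box mA).
pose A' i := if insub i is Some j then A j else setT.
have mA' i : measurable (A' i) by rewrite /A'; case: insubP.
have A'E (i : 'I_n) : A' i = A i by rewrite /A' valK.
rewrite -(eq_bigr _ (fun i _ => congr1 lam (A'E i))) -indep_prod//; congr (P _).
apply/seteqP; split => x /= H i.
  by move=> ni; have := H (Ordinal ni); rewrite tnth_mktuple -A'E.
by rewrite tnth_mktuple -A'E; exact: H.
Qed.

Lemma integral_starts n (F : n.-tuple mR -> \bar R) :
  measurable_fun setT F -> (forall w, 0 <= F w)%E ->
  (\int[P]_x F (starts n x) = \int[torus n]_w F w)%E.
Proof.
move=> mF F0; have ms := @measurable_starts n.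
rewrite -[LHS](@ge0_integral_pushforward _ _ _ _ _ (@starts n) ms P setT F)//.
by apply: eq_measure_integral => A mA _; exact: law_starts.
Qed.

End law.

Section kernel_facts.
Variable R : realType.
Local Notation mR := (measurableTypeR R).
Local Notation lam := (@circle_lebesgue R).
Implicit Types (t x y c a : R) (n : nat).

(** The distance to the integers is attained at the floor of t or at the next integer. *)
Lemma circle_normE t : circle_norm t = Num.min (mod1 t) (1 - mod1 t).
Proof.
have t0 := mod1_ge0 t; have t1 := mod1_lt1 t.
have tE : t = mod1 t + (Num.floor t)%:~R by rewrite subrK.
set k := Num.floor t in tE.
have lb (n : int) : Num.min (mod1 t) (1 - mod1 t) <= `|t - n%:~R|.
  have [nk|nk] := lerP n k.
    have : (n%:~R : R) <= k%:~R by rewrite ler_int.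
    rewrite ge_min => h; rewrite ger0_norm; last lra.
    by apply/orP; left; lra.
  have : ((k + 1)%:~R : R) <= n%:~R by rewrite ler_int lezD1.
  rewrite intrD -[1%:~R]/(1:R) ge_min => h; rewrite ler0_norm; last lra.
  by apply/orP; right; lra.
apply/eqP; rewrite eq_le; apply/andP; split; last first.
  apply: lb_le_inf; first by exists `|t - 0%:~R|, 0.
  by move=> _ [n _ <-]; exact: lb.
have hlb : has_lbound [set `|t - n%:~R| | n in [set: int]].
  by exists 0 => _ [n _ <-].
rewrite le_min; apply/andP; split; apply: ge_inf => //.
  by exists k => //; rewrite ger0_norm; lra.
exists (k + 1) => //; rewrite intrD -[1%:~R]/(1:R) ler0_norm; lra.
Qed.

Lemma circle_norm_periodic : periodic1 (@circle_norm R).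
Proof. by move=> t; rewrite !circle_normE mod1D1. Qed.

Lemma circle_normN t : circle_norm (- t) = circle_norm t.
Proof.
rewrite !circle_normE; have := mod1_ge0 t; rewrite le_eqVlt => /predU1P[t0|t0].
  have [k tE] := mod1E t; rewrite -t0 add0r in tE.
  have -> : mod1 (- t) = 0; last by rewrite -t0.
  by rewrite tE -mulrNz -[_%:~R]add0r mod1Dz mod1_id// lexx ltr01.
by rewrite mod1N// subKr minC.
Qed.

Lemma circle_norm_small t : `|t| <= 1/2 -> circle_norm t = `|t|.
Proof.
wlog t0 : t / 0 <= t => [H|].
  have [t0|t0] := leP 0 t; first exact: H.
  by rewrite -normrN -circle_normN; apply: H; lra.
rewrite ger0_norm// => t1; rewrite circle_normE mod1_id; last lra.
by apply/min_idPl; lra.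
Qed.

Lemma circle_norm_ge0 t : 0 <= circle_norm t.
Proof.
rewrite circle_normE le_min mod1_ge0/=; have := mod1_lt1 t; lra.
Qed.

Lemma measurable_circle_norm : measurable_fun [set: mR] (@circle_norm R : mR -> mR).
Proof.
have -> : (@circle_norm R : mR -> mR) = (fun t => Num.min (mod1 t) (1 - mod1 t)).
  by apply/funext => t; exact: circle_normE.
apply: measurable_minr; first exact: measurable_mod1.
by apply: measurable_funB => //; exact: measurable_mod1.
Qed.

Variable l : nat -> R.
Local Notation K := (covering_kernel l).

Let lp n t := Num.max (l n - circle_norm t) 0.
Let lp0 n t : 0 <= lp n t. Proof. by rewrite le_max lexx orbT. Qed.

Lemma K_ge1 t : (1 <= K t)%E.
Proof.
rewrite -expeR0 lee_expeR; apply: nneseries_ge0 => n _ _; exact: lp0.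
Qed.

Lemma K_ge0 t : (0 <= K t)%E.
Proof. exact: expeR_ge0. Qed.

Lemma K_anti x y : circle_norm x <= circle_norm y -> (K y <= K x)%E.
Proof.
move=> xy; rewrite lee_expeR; apply: lee_nneseries => n _ *; first exact: lp0.
rewrite lee_fin ge_max !le_max lexx orbT andbT; apply/orP; left; lra.
Qed.

Lemma K_periodic : periodic1 K.
Proof. by move=> t; rewrite /covering_kernel circle_norm_periodic. Qed.

Lemma K_even t : K (- t) = K t.
Proof. by rewrite /covering_kernel circle_normN. Qed.

Lemma measurable_K : measurable_fun [set: mR] (K : mR -> \bar R).
Proof.
pose S : mR -> \bar R := fun t => (\sum_(0 <= n <oo) (lp n t)%:E)%E.
have -> : (K : mR -> \bar R) = er_map expR \o S.
  apply/funext => t; rewrite /= /covering_kernel -/(S t).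
  have : (0 <= S t)%E by apply: nneseries_ge0 => n _ _; exact: lp0.
  by case: (S t).
have me : measurable_fun [set: \bar R] (er_map (@expR R)) by exact: (@measurable_er_map _ mR R _ (@measurable_expR R)).
apply: (measurableT_comp me).
apply: (@ge0_emeasurable_sum _ mR R setT (fun n t => (lp n t)%:E) xpredT).
  by move=> n t _ _; exact: lp0.
move=> n _; apply/measurable_EFinP; apply: measurable_maxr => //.
by apply: measurable_funB => //; exact: measurable_circle_norm.
Qed.

Lemma K_partial n t : ((expR (\sum_(k < n) Num.max (l k - circle_norm t) 0))%:E <= K t)%E.
Proof.
rewrite -[X in (X <= _)%E]/(expeR (_)%:E) lee_expeR.
rewrite -sumEFin -(big_mkord xpredT (fun k => (lp k t)%:E)).
by apply: nneseries_lim_ge => k _ _; exact: lp0.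
Qed.

End kernel_facts.

(** * Convolution of symmetric decreasing functions *)

Section convolution.
Variable R : realType.
Local Notation mR := (measurableTypeR R).
Local Notation lam := (@circle_lebesgue R).
Local Notation torus n := (torus_lebesgue R n).
Implicit Types (f g h : R -> \bar R) (x y u : R).

Definition circle_fun f :=
  [/\ periodic1 f, measurable_fun setT f & forall x, (0 <= f x)%E].

Definition conv f g x := (\int[lam]_y (f y * g (x - y)%R))%E.

Lemma measurable_sub2 : measurable_fun [set: mR * mR] (fun z => z.1 - z.2 : mR).
Proof. exact: (measurable_funB measurable_fst measurable_snd). Qed.

Lemma measurable_conv2 f g : measurable_fun setT f -> measurable_fun setT g ->
  measurable_fun [set: mR * mR] (fun z => (f z.2 * g (z.1 - z.2)%R)%E).
Proof.
move=> mf mg; apply: emeasurable_funM.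
  exact: (measurableT_comp mf measurable_snd).
exact: (measurableT_comp mg measurable_sub2).
Qed.

Lemma circle_fun_conv f g : circle_fun f -> circle_fun g -> circle_fun (conv f g).
Proof.
move=> [pf mf f0] [pg mg g0]; split.
- by move=> t; apply: eq_integral => y _; rewrite addrAC pg.
- by apply: (measurable_fun_fubini_tonelli_F (m2 := lam) _ (measurable_conv2 mf mg)) => z /=; rewrite mule_ge0.
- by move=> x; apply: integral_ge0 => y _; rewrite mule_ge0.
Qed.

Lemma convA f g h : circle_fun f -> circle_fun g -> circle_fun h ->
  forall x, conv f (conv g h) x = conv (conv f g) h x.
Proof.
move=> [pf mf f0] [pg mg g0] [ph mh h0] x.
have m1 : measurable_fun [set: mR * mR]
    (fun z => (f z.2 * g (z.1 - z.2)%R * h (x - z.1)%R)%E).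
  apply: emeasurable_funM; first exact: measurable_conv2.
  apply: (measurableT_comp mh); apply: measurable_funB => //.
rewrite /conv; transitivity (\int[lam]_u \int[lam]_y (f y * g (u - y)%R * h (x - u)%R))%E; last first.
  apply: eq_integral => u _; rewrite ge0_integralZr//.
  - apply: emeasurable_funM => //; apply: (measurableT_comp mg).
    by apply: measurable_funB => //.
  - by move=> y _; rewrite mule_ge0.
rewrite (fubini_tonelli (m1 := lam) (m2 := lam) _ m1)/=; last by move=> z; rewrite !mule_ge0.
apply: eq_integral => y _.
have mgh : measurable_fun setT (fun z : mR => (g (z - y)%R * h (x - z)%R)%E).
  apply: emeasurable_funM.
    by apply: (measurableT_comp mg); apply: measurable_funB.
  by apply: (measurableT_comp mh); apply: measurable_funB.
rewrite -(integral_lam_shift (- y) (f := fun z => (g z * h (x - y - z)%R)%E))//.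
- rewrite -ge0_integralZl//.
  + by apply: eq_integral => z _; rewrite muleA; congr (_ * h _)%E; ring.
  + apply: emeasurable_funM; first by apply: (measurableT_comp mg); apply: measurable_funD.
    apply: (measurableT_comp mh); apply: measurable_funB => //; exact: measurable_funD.
  + by move=> z _; rewrite mule_ge0.
- by move=> z; rewrite pg; congr (_ * _)%E; rewrite -[LHS]ph; congr h; ring.
- apply: emeasurable_funM => //.
  by apply: (measurableT_comp mh); apply: measurable_funB.
- by move=> z; rewrite mule_ge0.
Qed.

Lemma conv_le f g (B : \bar R) : circle_fun f -> circle_fun g ->
  (forall x, f x <= B)%E -> forall x, (conv f g x <= B * \int[lam]_y g y)%E.
Proof.
move=> [pf mf f0] [pg mg g0] fB x.
have B0 : (0 <= B)%E by exact: le_trans (f0 0) (fB 0).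
have mgx : measurable_fun setT (fun y : mR => g (x - y)).
  by apply: (measurableT_comp mg); apply: measurable_funB.
rewrite -(integral_lam_opp x pg mg g0) -ge0_integralZl//.
apply: ge0_le_integral => //.
- by move=> y _; rewrite mule_ge0.
- exact: emeasurable_funM.
- exact: measurable_funeM.
- by move=> y _; apply: lee_wpmul2r.
Qed.

Definition sym_dec f := forall x y, circle_norm x <= circle_norm y -> (f y <= f x)%E.

Lemma sym_dec_norm f x y : sym_dec f -> circle_norm x = circle_norm y -> f x = f y.
Proof. by move=> sf xy; apply/eqP; rewrite eq_le !sf ?xy. Qed.

Lemma sym_decN f x : sym_dec f -> f (- x) = f x.
Proof. by move=> sf; apply: sym_dec_norm => //; exact: circle_normN. Qed.

Lemma circle_norm_itv01 (w : R) : 0 <= w <= 1 -> circle_norm w = Num.min w (1 - w).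
Proof.
move=> /andP[w0]; rewrite le_eqVlt => /predU1P[->|w1]; last first.
  by rewrite circle_normE mod1_id// w0.
have -> : 1 = 0 + 1 :> R by rewrite add0r.
rewrite circle_norm_periodic circle_normE mod1_id ?lexx ?ltr01// add0r subr0 subrr.
by rewrite minC.
Qed.

(** The reflection u |-> x + y - u exchanges x and y.  On the half circle that contains 0
    and x, a point is closer to 0 than its image, and closer to x than to y. *)
Lemma circle_norm_pair x y u : 0 <= x -> x <= y -> y <= 1/2 ->
  (x + y) / 2 - 1/2 <= u <= (x + y) / 2 ->
  circle_norm u <= circle_norm (x + y - u) /\
  circle_norm (x - u) <= circle_norm (y - u).
Proof.
move=> x0 xy y1 u1; split.
  rewrite circle_norm_small; last by rewrite ler_norml; lra.
  by rewrite circle_norm_itv01; [rewrite le_min !ler_norml; lra|lra].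
rewrite circle_norm_small; last by rewrite ler_norml; lra.
by rewrite circle_norm_itv01; [rewrite le_min !ler_norml; lra|lra].
Qed.

(** This is (a - b) (c - d) >= 0, expanded so as to make sense for infinite values. *)
Lemma rearrange2 (a b c d : \bar R) : (0 <= b -> b <= a -> 0 <= d -> d <= c ->
  a * d + b * c <= a * c + b * d)%E.
Proof.
move=> b0 ba d0 dc.
have a0 : (0 <= a)%E by exact: le_trans ba.
have c0 : (0 <= c)%E by exact: le_trans dc.
have [aoo|afin] := eqVneq a +oo%E.
  have := c0; rewrite le_eqVlt => /predU1P[c00|cp].
    have -> : d = 0%E by apply/eqP; rewrite eq_le d0 andbT c00.
    by rewrite -c00 !mule0.
  by rewrite aoo [X in (_ <= X + _)%E]gt0_mulye// addye ?leey// gt_eqF// (lt_le_trans ltNy0)// mule_ge0.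
have [coo|cfin] := eqVneq c +oo%E.
  have := a0; rewrite le_eqVlt => /predU1P[a00|ap].
    have -> : b = 0%E by apply/eqP; rewrite eq_le b0 andbT a00.
    by rewrite -a00 !mul0e.
  by rewrite coo [X in (_ <= X + _)%E]gt0_muley// addye ?leey// gt_eqF// (lt_le_trans ltNy0)// mule_ge0.
have fa : a \is a fin_num by rewrite ge0_fin_numE// lt_neqAle afin leey.
have fc : c \is a fin_num by rewrite ge0_fin_numE// lt_neqAle cfin leey.
have fb : b \is a fin_num by rewrite ge0_fin_numE// (le_lt_trans ba)// -ge0_fin_numE.
have fd : d \is a fin_num by rewrite ge0_fin_numE// (le_lt_trans dc)// -ge0_fin_numE.
move: ba dc; rewrite -(fineK fa) -(fineK fb) -(fineK fc) -(fineK fd).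
rewrite -!EFinM -!EFinD !lee_fin => ba dc; nra.
Qed.

Lemma lee_double (a b : \bar R) : (0 <= b -> a + a <= b + b -> a <= b)%E.
Proof.
move=> b0; rewrite -!mule2n -!mule_natl => H.
by move: H; rewrite lee_pmul2l.
Qed.

(** Each u is paired with its reflection x + y - u in the integrals that define the
    convolution at x and at y; the comparison then holds for each pair, by [circle_norm_pair]
    and [rearrange2]. *)
Lemma sym_dec_conv f g : circle_fun f -> circle_fun g -> sym_dec f -> sym_dec g ->
  sym_dec (conv f g).
Proof.
move=> cf cg sf sg; have [pc mc c0] := circle_fun_conv cf cg.
move: cf cg => [pf mf f0] [pg mg g0].
have mfg z : measurable_fun setT (fun u => (f u * g (z - u)%R)%E : \bar R).
  by apply: emeasurable_funM => //; apply: (measurableT_comp mg); apply: measurable_funB.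
have cN x : conv f g (- x) = conv f g x.
  rewrite /conv -[RHS](integral_lam_opp 0 (f := fun y => (f y * g (x - y)%R)%E)) //.
  - by apply: eq_integral => y _; rewrite sub0r sym_decN//; congr (_ * _)%E; rewrite -[LHS]sym_decN//; congr g; ring.
  - move=> t; rewrite pf; congr (_ * _)%E; rewrite -[LHS]pg; congr g; ring.
  - by move=> t; rewrite mule_ge0.
have cE x : conv f g x = conv f g (circle_norm x).
  rewrite circle_normE -(periodicE pc).
  have [//|_] := leP (mod1 x) (1 - mod1 x).
  by rewrite addrC pc cN.
have half x : conv f g x = conv f g (circle_norm x) /\ 0 <= circle_norm x <= 1/2.
  split=> //; rewrite circle_norm_ge0/= circle_normE ge_min.
  have [h|h] := leP (mod1 x) (1/2) => //=; lra.
move=> x y; move: (half x) (half y) => [-> + ] [-> +].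
move: (circle_norm x) (circle_norm y) => {}x {}y /andP[x0 x1] /andP[y0 y1] xy.
have dbl a b : conv f g a + conv f g a =
   (\int[lam]_u (f u * g (a - u)%R + f (a + b - u)%R * g (b - u)%R))%E :> \bar R.
  have mfb : measurable_fun setT (fun u : mR => (f (a + b - u)%R * g (b - u)%R)%E).
    apply: emeasurable_funM; first by apply: (measurableT_comp mf); apply: measurable_funB.
    by apply: (measurableT_comp mg); apply: measurable_funB.
  rewrite ge0_integralD//; try exact: mfg; try exact: mfb;
    try by move=> u _; rewrite mule_ge0.
  congr (_ + _)%E.
  rewrite /conv -[LHS](integral_lam_opp (a + b) (f := fun u => (f u * g (a - u)%R)%E))//.
  - by apply: eq_integral => u _; congr (_ * _)%E; rewrite -[LHS]sym_decN//; congr g; ring.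
  - by move=> t; rewrite pf; congr (_ * _)%E; rewrite -[LHS]pg; congr g; ring.
  - by move=> u; rewrite mule_ge0.
apply: lee_double => //; rewrite (dbl x y) (dbl y x).
have mfg2 a b : measurable_fun setT (fun u : mR => (f u * g (a - u)%R + f (a + b - u)%R * g (b - u)%R)%E).
  apply: emeasurable_funD; [exact: mfg|apply: emeasurable_funM].
    by apply: (measurableT_comp mf); apply: measurable_funB.
  by apply: (measurableT_comp mg); apply: measurable_funB.
apply: ge0_le_integral => //.
- by move=> u _; rewrite adde_ge0 ?mule_ge0.
move=> u _; rewrite [y + x]addrC.
have key v : (x + y) / 2 - 1/2 <= v <= (x + y) / 2 ->
   (f v * g (y - v)%R + f (x + y - v)%R * g (x - v)%R <=
    f v * g (x - v)%R + f (x + y - v)%R * g (y - v)%R)%E.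
  move=> hv; have [n1 n2] := circle_norm_pair x0 xy y1 hv.
  by apply: rearrange2 => //; [exact: sf|exact: sg].
pose v := (x + y) / 2 - 1/2 + mod1 (u - ((x + y) / 2 - 1/2)).
have vE h : periodic1 h -> h v = h u.
  move=> ph; rewrite -[LHS](periodicE ph) /v mod1Dr subrKC periodicE//.
have vf : f v = f u by exact: vE.
have vfm : f (x + y - v) = f (x + y - u).
  by apply: (vE (fun u => f (x + y - u))) => t; rewrite -[LHS]pf; congr f; ring.
have vg z : g (z - v) = g (z - u).
  by apply: (vE (fun u => g (z - u))) => t; rewrite -[LHS]pg; congr g; ring.
rewrite -vf -vfm -!vg.
have := mod1_ge0 (u - ((x + y) / 2 - 1/2)); have := mod1_lt1 (u - ((x + y) / 2 - 1/2)).
rewrite -/v => m1 m0.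
have [vh|vh] := leP v ((x + y) / 2).
  by apply: key; rewrite vh andbT /v lerDl.
have hv' : (x + y) / 2 - 1/2 <= x + y - v <= (x + y) / 2 by rewrite /v in vh *; lra.
have := key _ hv'.
have -> : x + y - (x + y - v) = v by ring.
have gs z w : z + w = x + y -> g (z - (x + y - v)) = g (w - v).
  by move=> zw; rewrite -sym_decN//; congr g; rewrite -zw; ring.
rewrite (gs y x) 1?addrC// (gs x y)// => H.
by rewrite [leRHS]addeC; exact: H.
Qed.

End convolution.

(** * Convolution powers of the kernel *)

Section kernel_powers.
Variable R : realType.
Local Notation mR := (measurableTypeR R).
Local Notation lam := (@circle_lebesgue R).
Local Notation torus n := (torus_lebesgue R n).
Variable l : nat -> R.
Local Notation K := (covering_kernel l).

Lemma circle_fun_K : circle_fun K.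
Proof. by split; [exact: K_periodic|exact: measurable_K|exact: K_ge0]. Qed.

Definition Kpow d := iter d (conv K) K.

Lemma circle_fun_iter f d : circle_fun f -> circle_fun (iter d (conv K) f).
Proof. by move=> cf; elim: d => [//|d IH] /=; apply: circle_fun_conv => //; exact: circle_fun_K. Qed.

Lemma circle_fun_Kpow d : circle_fun (Kpow d).
Proof. exact/circle_fun_iter/circle_fun_K. Qed.

Lemma sym_dec_Kpow d : sym_dec (Kpow d).
Proof.
elim: d => [|d IH] /=; first by move=> x y; exact: K_anti.
by apply: sym_dec_conv => //; [exact: circle_fun_K|exact: circle_fun_Kpow|move=> x y; exact: K_anti].
Qed.

Lemma circle_norm0 : circle_norm (0 : R) = 0.
Proof. by rewrite circle_norm_small normr0//; lra. Qed.

(** A bound at the single point 0, such as [Kpow_torus] provides, is thus a uniform bound. *)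
Lemma Kpow_max d x : (Kpow d x <= Kpow d 0)%E.
Proof. by apply: sym_dec_Kpow; rewrite circle_norm0 circle_norm_ge0. Qed.

Lemma Kpow_ge1 d x : (1 <= Kpow d x)%E.
Proof.
elim: d x => [|d IH] x /=; first exact: K_ge1.
have [pK mK K0] := circle_fun_K.
have [pk mk k0] := circle_fun_Kpow d.
rewrite /conv -[X in (X <= _)%E](_ : \int[lam]_y 1 = 1)%E.
  apply: ge0_le_integral => //.
    apply: emeasurable_funM => //.
    by apply: (measurableT_comp mk); apply: measurable_funB.
  move=> y _; rewrite -[X in (X <= _)%E]mule1; apply: lee_pmul => //; exact: K_ge1.
by rewrite integral_cst// mul1e; exact: (@probability_setT _ _ _ lam).
Qed.

Lemma Kpow_integral d : (\int[lam]_t K t <= Kpow d.+1 0)%E.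
Proof.
have [pK mK K0] := circle_fun_K.
have [pk mk k0] := circle_fun_Kpow d.
apply: ge0_le_integral => //.
  apply: emeasurable_funM => //.
  by apply: (measurableT_comp mk); apply: measurable_funB.
by move=> y _; rewrite -[X in (X <= _)%E]mule1; apply: lee_pmul => //; exact: Kpow_ge1.
Qed.

Lemma iter_conv_Kpow d f : circle_fun f -> forall x, iter d.+1 (conv K) f x = conv (Kpow d) f x.
Proof.
move=> cf; elim: d => [//|d IH] x.
transitivity (conv K (conv (Kpow d) f) x).
  by apply: eq_integral => y _; congr (_ * _)%E; exact: IH.
by apply: convA => //; [exact: circle_fun_K|exact: circle_fun_Kpow].
Qed.

Lemma iter_conv_le d f : circle_fun f -> forall x,
  (iter d.+1 (conv K) f x <= Kpow d 0 * \int[lam]_y f y)%E.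
Proof.
move=> cf x; rewrite iter_conv_Kpow//.
by apply: conv_le => //; [exact: circle_fun_Kpow|exact: Kpow_max].
Qed.

Lemma emeasurable_prod dd (T : measurableType dd) (I : Type) (s : seq I)
    (F : I -> T -> \bar R) : (forall i, measurable_fun setT (F i)) ->
  measurable_fun setT (fun x => \prod_(i <- s) F i x)%E.
Proof.
move=> mF; elim: s => [|i s IH].
  by under eq_fun do rewrite big_nil; exact: measurable_cst.
by under eq_fun do rewrite big_cons; exact: emeasurable_funM.
Qed.

Lemma eprod_ge0 (I : Type) (s : seq I) (F : I -> \bar R) :
  (forall i, 0 <= F i)%E -> (0 <= \prod_(i <- s) F i)%E.
Proof. by move=> F0; elim/big_ind : _ => // x y; exact: mule_ge0. Qed.

(** At x = 0 this identifies the integral whose finiteness is assumed with the value of a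
    convolution power. *)
Lemma Kpow_torus d x :
  (\int[torus d]_t ((\prod_(i < d) K (tnth t i)) * K (x - \sum_(i < d) tnth t i)%R) = Kpow d x)%E.
Proof.
have [pK mK K0] := circle_fun_K.
have mF n y : measurable_fun setT (fun t : n.-tuple mR =>
   (\prod_(i < n) K (tnth t i)) * K (y - \sum_(i < n) tnth t i)%R)%E.
  apply: emeasurable_funM.
    by apply: emeasurable_prod => i; apply: (measurableT_comp mK); exact: measurable_tnth.
  apply: (measurableT_comp mK); apply: measurable_funB => //.
  by apply: measurable_sum => i; exact: measurable_tnth.
have F0 n y (t : n.-tuple mR) : (0 <= (\prod_(i < n) K (tnth t i)) * K (y - \sum_(i < n) tnth t i)%R)%E.
  by rewrite mule_ge0// eprod_ge0.
elim: d x => [|d IH] x.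
  rewrite [LHS](integral_dirac _ _ (mF 0%N x))//= diracE mem_set//=.
  by rewrite mul1e !big_ord0 mul1e subr0.
rewrite integral_torus_cons//.
transitivity (conv K (Kpow d) x) => //.
apply: eq_integral => t _; rewrite -IH -ge0_integralZl//; last exact: mF.
apply: eq_integral => s _.
rewrite !big_ord_recl /= -muleA; congr (_ * (_ * K _))%E.
  by apply: eq_bigr => i _; rewrite tnthS.
by rewrite opprD addrA; congr (_ - _); apply: eq_bigr => i _; rewrite tnthS.
Qed.

Lemma lebesgue_half (A : set mR) : measurable A ->
  lebesgue_measure ((fun t : mR => t / 2 : mR) @^-1` A) = (2%:E * lebesgue_measure A)%E.
Proof.
move=> mA.
have mh : measurable_fun [set: mR] (fun t : mR => t / 2 : mR) by exact: measurable_funM.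
have h0 : 0 <= (2^-1 : R) by rewrite invr_ge0.
pose m' := pushforward (mscale (NngNum h0) lebesgue_measure) (fun t : mR => t / 2 : mR).
have E : lebesgue_measure A = m' A.
  apply: (@lebesgue_measure_unique _ m') mA => // _ [[u v]] _ <-.
  have E : (fun t : mR => t / 2 : mR) @^-1` `]u, v]%classic = `]u * 2, v * 2]%classic.
    by apply/seteqP; split => t /=; rewrite !in_itv/= ltr_pdivlMr// ler_pdivrMr.
  rewrite /m' /pushforward /mscale /=.
  transitivity ((2^-1)%:E * lebesgue_measure (`](u * 2)%R, (v * 2)%R]%classic : set mR))%E; last by rewrite -E.
  rewrite !lebesgue_measure_itv/= !lte_fin ltr_pM2r//.
  case: ifP => // _; last by rewrite mule0.
  by rewrite -!EFinD -EFinM; congr EFin; field.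
rewrite E /m' /pushforward /mscale /= muleA -EFinM divff// mul1e.
by [].
Qed.

(** The substitution of (t - x) / 2 for t costs a factor 2. *)
Lemma integral_K_half (x b : R) : 0 <= x -> b <= x + 1/2 ->
  (\int[lam]_t (if (x <= t < b)%R then K ((t - x) / 2)%R else 0) <= 2%:E * \int[lam]_t K t)%E.
Proof.
move=> x0 bx; have [pK mK K0] := circle_fun_K.
pose phi (t : mR) : mR := mod1 t / 2.
have mphi : measurable_fun setT phi by apply: measurable_funM => //; exact: measurable_mod1.
have mKphi : measurable_fun setT (K \o phi) by exact: measurableT_comp.
have pKphi : periodic1 (K \o phi) by move=> t; rewrite /phi/= mod1D1.
apply: (@le_trans _ _ (\int[lam]_t (K \o phi) (t - x)%R)%E).
  apply: ge0_le_integral => //.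
  - by move=> t _; case: ifP.
  - apply: measurable_fun_ifT => //.
      by apply: measurable_and; [exact: measurable_fun_ler|exact: measurable_fun_ltr].
    by apply: (measurableT_comp mK); apply: measurable_funM => //; exact: measurable_funB.
  - by apply: (measurableT_comp mKphi); exact: measurable_funB.
  - move=> t _; case: ifP => [tx|_]; last exact: K0.
    by rewrite /phi/= mod1_id//; lra.
rewrite integral_lam_shift//; last by move=> t; exact: K0.
have mD : measurable (`[0, 1/2[%classic : set mR) by exact: measurable_itv.
have phiD : phi @^-1` `[0, 1/2[%classic = setT.
  apply/seteqP; split => // t _; rewrite /phi /= in_itv/=.
  have := mod1_ge0 t; have := mod1_lt1 t; lra.
rewrite -{1}phiD.
rewrite -(@ge0_integral_pushforward _ _ _ _ _ phi mphi lam `[0, 1/2[%classic K)//; last exact: measurable_funTS.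
have h2 : 0 <= (2 : R) by [].
pose m2 := mscale (NngNum h2) lam.
rewrite (eq_measure_integral m2); last first.
  move=> A mA AD; change (lam (phi @^-1` A) = 2%:E * lam A)%E.
  rewrite !lamE.
  have -> : A `&` @circle R = A.
    apply/setIidl => t /AD; rewrite /circle /= !in_itv/=; lra.
  rewrite -lebesgue_half//; congr lebesgue_measure.
  apply/seteqP; split => t; rewrite /circle /= in_itv/= /phi.
    by move=> [+ t01]; rewrite mod1_id.
  move=> At; have := AD _ At; rewrite /= in_itv/= => t01.
  have t01' : 0 <= t < 1 by lra.
  by rewrite mod1_id.
rewrite ge0_integral_mscale//; last exact: measurable_funTS.
apply: lee_wpmul2l => //; apply: ge0_subset_integral => //.
Qed.

End kernel_powers.

(** * Integrals along ordered chains of points *)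

Section chain.
Variable R : realType.
Local Notation mR := (measurableTypeR R).
Local Notation lam := (@circle_lebesgue R).
Variable l : nat -> R.
Local Notation K := (covering_kernel l).
Variables (a b : R).
Hypotheses (a0 : 0 <= a) (ab : b = a + 1/2).

Let pK := K_periodic l.
Let mK := @measurable_K R l.
Let K0 := K_ge0 l.

(** Indicators with values in the extended reals can be multiplied by the kernel, which may
    be infinite. *)
Definition cst_if (c : bool) : \bar R := if c then 1%E else 0%E.

Lemma cst_if_ge0 c : (0 <= cst_if c)%E. Proof. by case: c. Qed.

Lemma measurable_cst_if d (T : measurableType d) (c : T -> bool) :
  measurable_fun setT c -> measurable_fun setT (fun x => cst_if (c x)).
Proof. by move=> mc; exact: measurable_fun_ifT. Qed.

(** The kernel is taken along the gaps of a chain x <= t_1 <= ... <= t_j < b, and psi is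
    summed over the 2^j points y +- t_1 ... +- t_j. *)
Fixpoint chain (psi : R -> \bar R) (j : nat) (y x : R) : \bar R :=
  if j is j'.+1 then
    (\int[lam]_t (cst_if (x <= t < b)%R * K (t - x)%R *
       (chain psi j' (y + t)%R t + chain psi j' (y - t)%R t)))%E
  else psi y.

Lemma chainS psi j y x : chain psi j.+1 y x =
  (\int[lam]_t (cst_if (x <= t < b)%R * K (t - x)%R *
       (chain psi j (y + t)%R t + chain psi j (y - t)%R t)))%E.
Proof. by []. Qed.

Lemma chain_ge0 psi j y x : (forall z, 0 <= psi z)%E -> (0 <= chain psi j y x)%E.
Proof.
move=> p0; elim: j y x => [|j IH] y x /=; first exact: p0.
by apply: integral_ge0 => t _; rewrite !mule_ge0 ?cst_if_ge0 ?adde_ge0.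
Qed.

Lemma chain_periodic psi j x : periodic1 psi -> periodic1 (chain psi j ^~ x).
Proof.
move=> pp; elim: j x => [//|j IH] x y /=.
by apply: eq_integral => t _; rewrite addrAC IH addrAC IH.
Qed.

Lemma measurable_link d (T : measurableType d) (f g : T -> mR) :
  measurable_fun setT f -> measurable_fun setT g ->
  measurable_fun setT (fun z => (cst_if (f z <= g z < b)%R * K (g z - f z)%R)%E).
Proof.
move=> mf mg; apply: emeasurable_funM.
  apply: measurable_cst_if; apply: measurable_and.
    exact: measurable_fun_ler.
  by apply: measurable_fun_ltr.
by apply: (measurableT_comp mK); exact: measurable_funB.
Qed.

Lemma measurable_chain psi j : measurable_fun setT psi -> (forall z, 0 <= psi z)%E ->
  measurable_fun [set: mR * mR] (fun z => chain psi j z.1 z.2).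
Proof.
move=> mp p0; elim: j => [|j IH] /=.
  exact: (measurableT_comp mp measurable_fst).
pose F (u : (mR * mR) * mR) : \bar R :=
  (cst_if (u.1.2 <= u.2 < b)%R * K (u.2 - u.1.2)%R *
    (chain psi j (u.1.1 + u.2)%R u.2 + chain psi j (u.1.1 - u.2)%R u.2))%E.
have m1 : measurable_fun setT (fun u : (mR * mR) * mR => u.1.1).
  exact: (measurableT_comp measurable_fst measurable_fst).
have m2 : measurable_fun setT (fun u : (mR * mR) * mR => u.1.2).
  exact: (measurableT_comp measurable_snd measurable_fst).
have m3 : measurable_fun setT (fun u : (mR * mR) * mR => u.2).
  exact: measurable_snd.
have mF : measurable_fun setT F.
  apply: emeasurable_funM; first exact: measurable_link.
  apply: emeasurable_funD.
    apply: (measurableT_comp IH (g := fun u : (mR * mR) * mR => (u.1.1 + u.2 : mR, u.2 : mR))).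
    by apply/measurable_fun_pair => //; exact: measurable_funD.
  apply: (measurableT_comp IH (g := fun u : (mR * mR) * mR => (u.1.1 - u.2 : mR, u.2 : mR))).
  by apply/measurable_fun_pair => //; exact: measurable_funB.
apply: (measurable_fun_fubini_tonelli_F (m2 := lam) F mF) => u.
by rewrite /F !mule_ge0 ?cst_if_ge0 ?adde_ge0 ?chain_ge0.
Qed.

Lemma measurable_chain_comp d (T : measurableType d) psi j (f g : T -> mR) :
  measurable_fun setT psi -> (forall z, 0 <= psi z)%E ->
  measurable_fun setT f -> measurable_fun setT g ->
  measurable_fun setT (fun z => chain psi j (f z) (g z)).
Proof.
move=> mp p0 mf mg.
apply: (measurableT_comp (measurable_chain j mp p0) (g := fun z => (f z, g z))).
exact/measurable_fun_pair.
Qed.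

Lemma circle_fun_chain psi j x : circle_fun psi -> circle_fun (chain psi j ^~ x).
Proof.
move=> [pp mp p0]; split.
- exact: chain_periodic.
- by apply: measurable_chain_comp => //; exact: measurable_cst.
- by move=> y; exact: chain_ge0.
Qed.

(** The variable y enters through psi only, and by translation. *)
Lemma chain_conv psi j y x : circle_fun psi ->
  conv K (chain psi j ^~ x) y = chain (conv K psi) j y x.
Proof.
move=> cp; have [pp mp p0] := cp.
elim: j y x => [//|j IH] y x /=.
pose F (z : mR * mR) : \bar R := (K z.1 * (cst_if (x <= z.2 < b)%R * K (z.2 - x)%R *
   (chain psi j (y - z.1 + z.2)%R z.2 + chain psi j (y - z.1 - z.2)%R z.2)))%E.
have m1 : measurable_fun [set: mR * mR] fst by exact: measurable_fst.
have m2 : measurable_fun [set: mR * mR] snd by exact: measurable_snd.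
have mF : measurable_fun setT F.
  apply: emeasurable_funM; first exact: (measurableT_comp mK).
  apply: emeasurable_funM; first by apply: measurable_link.
  apply: emeasurable_funD; apply: measurable_chain_comp => //.
    by apply: measurable_funD => //; apply: measurable_funB.
  by apply: measurable_funB => //; apply: measurable_funB.
have F0 z : (0 <= F z)%E.
  by rewrite /F !mule_ge0 ?cst_if_ge0 ?adde_ge0 ?chain_ge0.
transitivity (\int[lam]_v \int[lam]_t F (v, t))%E.
  apply: eq_integral => v _; rewrite -ge0_integralZl//.
  - apply: emeasurable_funM; first by apply: (measurable_link (f := cst x) (g := id)).
    by apply: emeasurable_funD; apply: measurable_chain_comp => //; [exact: measurable_funD|exact: measurable_funB].
  - by move=> t _; rewrite !mule_ge0 ?cst_if_ge0 ?adde_ge0 ?chain_ge0.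
rewrite (fubini_tonelli (m1 := lam) (m2 := lam) F)//.
apply: eq_integral => t _; rewrite -!IH /conv -ge0_integralD//; last 4 first.
- by move=> v _; rewrite mule_ge0 ?chain_ge0.
- apply: emeasurable_funM => //; apply: measurable_chain_comp => //; exact: measurable_funB.
- by move=> v _; rewrite mule_ge0 ?chain_ge0.
- apply: emeasurable_funM => //; apply: measurable_chain_comp => //; exact: measurable_funB.
rewrite -ge0_integralZl//; last 3 first.
- apply: emeasurable_funD; apply: emeasurable_funM => //;
    apply: measurable_chain_comp => //; exact: measurable_funB.
- by move=> v _; rewrite adde_ge0 ?mule_ge0 ?chain_ge0.
- by rewrite mule_ge0 ?cst_if_ge0.
apply: eq_integral => v _; rewrite /F /= muleCA; congr (_ * _)%E.
rewrite ge0_muleDr ?chain_ge0//; congr (_ * chain _ _ _ _ + _ * chain _ _ _ _)%E; ring.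
Qed.

Lemma conv_kernel_add g c y : circle_fun g ->
  (\int[lam]_s (K (s - c)%R * g (y + s)%R) = conv K g (y + c)%R)%E.
Proof.
move=> [pg mg g0].
rewrite -(integral_lam_opp c (f := fun s => (K (s - c)%R * g (y + s)%R)%E)).
- apply: eq_integral => v _; rewrite -[K v]K_even; congr (K _ * g _)%E; ring.
- by move=> t; rewrite addrAC pK addrA pg.
- apply: emeasurable_funM; first by apply: (measurableT_comp mK); apply: measurable_funB.
  by apply: (measurableT_comp mg); apply: measurable_funD.
- by move=> t; rewrite mule_ge0.
Qed.

Lemma conv_kernel_sub g c y : circle_fun g ->
  (\int[lam]_s (K (s - c)%R * g (y - s)%R) = conv K g (y - c)%R)%E.
Proof.
move=> [pg mg g0].
rewrite -(integral_lam_shift c (f := fun s => (K (s - c)%R * g (y - s)%R)%E)).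
- apply: eq_integral => v _; congr (K _ * g _)%E; ring.
- by move=> t; rewrite addrAC pK; congr (_ * _)%E; rewrite -[LHS]pg; congr g; ring.
- apply: emeasurable_funM; first by apply: (measurableT_comp mK); apply: measurable_funB.
  by apply: (measurableT_comp mg); apply: measurable_funB.
- by move=> t; rewrite mule_ge0.
Qed.

Lemma conv_kernel_both g c y (B : \bar R) : circle_fun g ->
  (forall z, conv K g z <= B)%E ->
  (\int[lam]_s (K (s - c)%R * (g (y + s)%R + g (y - s)%R)) <= B + B)%E.
Proof.
move=> cg gB; have [pg mg g0] := cg.
rewrite (eq_integral (fun s : mR => K (s - c)%R * g (y + s)%R + K (s - c)%R * g (y - s)%R)%E); last first.
  by move=> s _; rewrite ge0_muleDr.
rewrite ge0_integralD//.
- by rewrite conv_kernel_add// conv_kernel_sub//; apply: leeD.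
- by move=> s _; rewrite mule_ge0.
- apply: emeasurable_funM; first by apply: (measurableT_comp mK); apply: measurable_funB.
  by apply: (measurableT_comp mg); apply: measurable_funD.
- by move=> s _; rewrite mule_ge0.
- apply: emeasurable_funM; first by apply: (measurableT_comp mK); apply: measurable_funB.
  by apply: (measurableT_comp mg); apply: measurable_funB.
Qed.

Lemma circle_norm_mono u v : 0 <= u -> u <= v -> v <= 1/2 ->
  circle_norm u <= circle_norm v :> R.
Proof.
move=> u0 uv v1; have v0 : 0 <= v by lra.
by rewrite !circle_norm_small !ger0_norm//; lra.
Qed.

(** The larger of the gaps s - x and t - s is at least (t - x) / 2, and the kernel
    decreases with the distance. *)
Lemma link_split x s t : a <= x ->
  (cst_if (x <= s < b)%R * K (s - x)%R * (cst_if (s <= t < b)%R * K (t - s)%R) <=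
   (if (x <= t < b)%R then K ((t - x) / 2)%R else 0) * (K (s - x)%R + K (s - t)%R))%E.
Proof.
move=> ax; rewrite /cst_if; have R0 : (0 <= (if (x <= t < b)%R then K ((t - x) / 2)%R else 0) * (K (s - x)%R + K (s - t)%R))%E.
  by rewrite mule_ge0 ?adde_ge0//; case: ifP.
case: ifP => xs; last by rewrite !mul0e.
case: ifP => st; last by rewrite mul0e mule0.
have xt : (x <= t < b)%R by lra.
rewrite xt !mul1e -[K (s - t)]K_even opprB.
rewrite ge0_muleDr//.
have [h|h] := leP ((t - x) / 2) (t - s).
  apply: (@le_trans _ _ (K ((t - x) / 2)%R * K (s - x)%R)%E); last by rewrite leeDl// mule_ge0.
  rewrite muleC; apply: lee_wpmul2r => //; apply: K_anti.
  by apply: circle_norm_mono; rewrite ?ab in st xt *; lra.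
apply: (@le_trans _ _ (K ((t - x) / 2)%R * K (t - s)%R)%E); last by rewrite leeDr// mule_ge0.
apply: lee_wpmul2r => //; apply: K_anti.
by apply: circle_norm_mono; rewrite ?ab in st xt *; lra.
Qed.

Lemma mul8e (C : \bar R) : (0 <= C)%E ->
  (8%:E * C = C + C + (C + C) + (C + C + (C + C)))%E.
Proof.
case: C => [r r0|_|//]; first by rewrite -EFinM -!EFinD; congr EFin; ring.
by rewrite gt0_muley// lte_fin.
Qed.

Let IK := (\int[lam]_t K t)%E.

(** Two links are treated at a time.  After [link_split] the middle point s carries a single
    kernel, so that integrating over s amounts to one more convolution of psi with K.  The
    bound that results is uniform in t, and the factor K ((t - x) / 2) can be integrated by
    itself.  In this way a chain of 2j + 1 links only uses j + 1 convolutions. *)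
Lemma chain_le j psi (B : \bar R) : (0 <= B)%E -> circle_fun psi ->
  (forall z, iter j.+1 (conv K) psi z <= B)%E ->
  forall x y, a <= x ->
  (chain psi j.*2.+1 y x <= (16%:E * IK) ^+ j * (2%:E * B))%E.
Proof.
move=> B0.
have IK0 : (0 <= IK)%E by apply: integral_ge0 => t _.
have BB : (2%:E * B = B + B)%E by rewrite -mule2n -mule_natl.
elim: j psi => [|j IH] psi cp hB x y ax.
  have [pp mp p0] := cp.
  rewrite expe0 mul1e BB /=.
  apply: le_trans (conv_kernel_both x y cp hB).
  apply: ge0_le_integral => //.
  - by move=> t _; rewrite !mule_ge0 ?cst_if_ge0 ?adde_ge0.
  - apply: emeasurable_funM; first by apply: (measurable_link (f := cst x) (g := id)).
    by apply: emeasurable_funD; apply: (measurableT_comp mp); [exact: measurable_funD|exact: measurable_funB].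
  - apply: emeasurable_funM; first by apply: (measurableT_comp mK); apply: measurable_funB.
    by apply: emeasurable_funD; apply: (measurableT_comp mp); [exact: measurable_funD|exact: measurable_funB].
  - move=> t _; apply: lee_wpmul2r; first by rewrite adde_ge0.
    by rewrite /cst_if; case: ifP; rewrite ?mul1e ?mul0e.
have [pp mp p0] := cp.
have cKp : circle_fun (conv K psi) by apply: circle_fun_conv => //; exact: circle_fun_K.
have hB' z : (iter j.+1 (conv K) (conv K psi) z <= B)%E by rewrite -iterSr; exact: hB.
have {}IH := IH _ cKp hB'.
set C := ((16%:E * IK) ^+ j * (2%:E * B))%E in IH.
have C0 : (0 <= C)%E by rewrite mule_ge0 ?mule_ge0 ?expe_ge0 ?mule_ge0.
pose G z t := (chain psi j.*2.+1 (z + t)%R t + chain psi j.*2.+1 (z - t)%R t)%E.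
have G0 z t : (0 <= G z t)%E by rewrite adde_ge0 ?chain_ge0.
have cG t : circle_fun (G ^~ t).
  split; last by move=> z; exact: G0.
  - by move=> z; congr (_ + _)%E; rewrite addrAC; exact: chain_periodic.
  - apply: emeasurable_funD; apply: measurable_chain_comp => //.
      exact: measurable_funD.
    exact: measurable_funB.
have GC t z : a <= t -> (conv K (G ^~ t) z <= C + C)%E.
  move=> at_; have [p1 m1 n1] := circle_fun_chain j.*2.+1 t cp.
  rewrite /conv; under eq_integral do rewrite ge0_muleDr ?chain_ge0//.
  rewrite ge0_integralD//.
  - apply: leeD.
      rewrite (_ : integral _ _ _ = conv K (chain psi j.*2.+1 ^~ t) (z + t)).
        by rewrite chain_conv//; exact: IH.
      by apply: eq_integral => v _; rewrite addrAC.
    rewrite (_ : integral _ _ _ = conv K (chain psi j.*2.+1 ^~ t) (z - t)).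
      by rewrite chain_conv//; exact: IH.
    by apply: eq_integral => v _; rewrite addrAC.
  - by move=> v _; rewrite mule_ge0 ?chain_ge0.
  - apply: emeasurable_funM => //; apply: measurable_chain_comp => //.
    by apply: measurable_funD => //; exact: measurable_funB.
  - by move=> v _; rewrite mule_ge0 ?chain_ge0.
  - apply: emeasurable_funM => //; apply: measurable_chain_comp => //.
    by apply: measurable_funB => //; exact: measurable_funB.
pose F (u : mR * mR) : \bar R := (cst_if (x <= u.1 < b)%R * K (u.1 - x)%R *
  (cst_if (u.1 <= u.2 < b)%R * K (u.2 - u.1)%R) * (G (y + u.1)%R u.2 + G (y - u.1)%R u.2))%E.
have m1 : measurable_fun [set: mR * mR] fst by exact: measurable_fst.
have m2 : measurable_fun [set: mR * mR] snd by exact: measurable_snd.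
have mG d (T : measurableType d) (f g : T -> mR) : measurable_fun setT f -> measurable_fun setT g ->
    measurable_fun setT (fun z => G (f z) (g z)).
  move=> mf mg; apply: emeasurable_funD; apply: measurable_chain_comp => //.
    exact: measurable_funD.
  exact: measurable_funB.
have mF : measurable_fun setT F.
  apply: emeasurable_funM; last first.
    by apply: emeasurable_funD; apply: mG => //; [exact: measurable_funD|exact: measurable_funB].
  apply: emeasurable_funM; last by apply: measurable_link.
  by apply: (measurable_link (f := cst x) (g := fst)).
have lk c u : (0 <= cst_if c * K u)%E by rewrite mule_ge0 ?cst_if_ge0.
have GG0 z z' t : (0 <= G z t + G z' t)%E by apply: adde_ge0; exact: G0.
have KG0 c z z' t : (0 <= K c * (G z t + G z' t))%E by exact: mule_ge0.
have lG0 c u z t : (0 <= cst_if c * K u * G z t)%E by apply: mule_ge0 => //; exact: G0.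
have F0 z : (0 <= F z)%E.
  by apply: mule_ge0 => //; apply: mule_ge0.
have -> : chain psi j.+1.*2.+1 y x = (\int[lam]_s \int[lam]_t F (s, t))%E.
  rewrite doubleS chainS; apply: eq_integral => s _.
  rewrite !chainS.
  rewrite -ge0_integralD//; last 4 first.
  - by move=> t _; exact: lG0.
  - by apply: emeasurable_funM; [exact: (measurable_link (f := cst s) (g := id))|apply: mG].
  - by move=> t _; exact: lG0.
  - by apply: emeasurable_funM; [exact: (measurable_link (f := cst s) (g := id))|apply: mG].
  rewrite -ge0_integralZl//; last 2 first.
  - by apply: emeasurable_funD; apply: emeasurable_funM; try exact: (measurable_link (f := cst s) (g := id)); apply: mG.
  - by move=> t _; apply: adde_ge0; exact: lG0.
  apply: eq_integral => t _; rewrite -ge0_muleDr; [by rewrite muleA|exact: G0|exact: G0].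
rewrite (fubini_tonelli (m1 := lam) (m2 := lam) F)//.
have Ux t : x <= t -> a <= t by move=> xt; exact: le_trans xt.
apply: (@le_trans _ _ (\int[lam]_t ((if (x <= t < b)%R then K ((t - x) / 2)%R else 0) * (8%:E * C)))%E).
  apply: ge0_le_integral => //.
  - by move=> t _; apply: integral_ge0.
  - exact: (measurable_fun_fubini_tonelli_G (m1 := lam) F).
  - apply: emeasurable_funM => //; apply: measurable_fun_ifT => //.
      by apply: measurable_and; [exact: measurable_fun_ler|exact: measurable_fun_ltr].
    by apply: (measurableT_comp mK); apply: measurable_funM => //; exact: measurable_funB.
  - move=> t _.
    set k := (if _ then _ else _).
    have k0 : (0 <= k)%E by rewrite /k; case: ifP.
    have mGy : measurable_fun setT (fun s : mR => (G (y + s)%R t + G (y - s)%R t)%E).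
      by apply: emeasurable_funD; apply: mG => //; [exact: measurable_funD|exact: measurable_funB].
    have mKc c : measurable_fun setT (fun s : mR => (K (s - c)%R * (G (y + s)%R t + G (y - s)%R t))%E).
      by apply: emeasurable_funM => //; apply: (measurableT_comp mK); exact: measurable_funB.
    apply: (@le_trans _ _ (\int[lam]_s (k * (K (s - x)%R * (G (y + s)%R t + G (y - s)%R t) +
        K (s - t)%R * (G (y + s)%R t + G (y - s)%R t))))%E).
      apply: ge0_le_integral => //.
      + exact: (measurableT_comp mF (measurable_pair2 t)).
      + by apply: measurable_funeM; exact: emeasurable_funD.
      + move=> s _; rewrite -ge0_muleDl// muleA; apply: lee_wpmul2r => //.
        exact: link_split.
    have [xt|xt] := boolP (x <= t < b)%R; last first.
      rewrite /k (negbTE xt); under eq_integral do rewrite mul0e.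
      by rewrite integral0 mul0e.
    rewrite ge0_integralZl//; last 2 first.
    + exact: emeasurable_funD.
    + by move=> s _; apply: adde_ge0; exact: KG0.
    apply: lee_wpmul2l => //; rewrite ge0_integralD//.
    have at_ : a <= t by apply: Ux; case/andP: xt.
    have := conv_kernel_both x y (cG t) (fun z => GC t z at_).
    have := conv_kernel_both t y (cG t) (fun z => GC t z at_).
    move=> h1 h2; apply: le_trans (leeD h2 h1) _.
    by rewrite mul8e.
have mk : measurable_fun setT (fun t : mR => if (x <= t < b)%R then K ((t - x) / 2)%R else 0%E).
  apply: measurable_fun_ifT => //.
    by apply: measurable_and; [exact: measurable_fun_ler|exact: measurable_fun_ltr].
  by apply: (measurableT_comp mK); apply: measurable_funM => //; exact: measurable_funB.
have k0 t : (0 <= if (x <= t < b)%R then K ((t - x) / 2)%R else 0%R)%E by case: ifP.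
rewrite ge0_integralZr//; try by rewrite mule_ge0.
have bx : b <= x + 1/2 by rewrite ab lerD2r.
have x0 : 0 <= x by exact: le_trans ax.
apply: (@le_trans _ _ ((2%:E * IK) * (8%:E * C))%E).
  by apply: lee_wpmul2r; [rewrite mule_ge0|exact: integral_K_half].
rewrite /C expeS (_ : 16%:E = 2%:E * 8%:E)%E; last by rewrite -EFinM; congr EFin; ring.
rewrite le_eqVlt; apply/orP; left; apply/eqP.
by rewrite !muleA; congr (_ * _ * _ * _)%E; rewrite -!muleA; congr (_ * _)%E; exact: muleC.
Qed.

End chain.

(** * Correlations of the densities *)

Section correlation.
Variable R : realType.
Local Notation mR := (measurableTypeR R).
Local Notation lam := (@circle_lebesgue R).

Lemma lee_prod (I : Type) (s : seq I) (F G : I -> \bar R) :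
  (forall i, 0 <= F i <= G i)%E -> (\prod_(i <- s) F i <= \prod_(i <- s) G i)%E.
Proof.
move=> FG; suff /andP[] : (0 <= \prod_(i <- s) F i <= \prod_(i <- s) G i)%E by [].
elim/big_rec2 : _ => [|i x y _ /andP[x0 xy]]; first by rewrite lexx lee01.
have /andP[F0 FGi] := FG i; rewrite mule_ge0//=; exact: lee_pmul.
Qed.

Lemma lam_itvoo (c e : R) : 0 <= c -> c <= e -> e <= 1 ->
  lam (`]c, e[%classic : set mR) = (e - c)%:E.
Proof.
move=> c0 ce e1; rewrite lamE.
have -> : `]c, e[%classic `&` @circle R = `]c, e[%classic.
  by apply/setIidl => t; rewrite /circle /= !in_itv/=; lra.
rewrite lebesgue_measure_itv/= lte_fin; case: ltP => [_|ec]; first by rewrite EFinB.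
by congr EFin; lra.
Qed.

Lemma lam_sub_itv (t c e : R) : 0 <= c -> c <= e -> e <= 1 ->
  lam [set y : mR | c < mod1 (t - y) < e] = (e - c)%:E.
Proof.
move=> c0 ce e1; rewrite -(lam_itvoo c0 ce e1).
have mI : measurable (`]c, e[%classic : set mR) by exact: measurable_itv.
have mS : measurable ((fun z : mR => mod1 (z + t) : mR) @^-1` `]c, e[%classic).
  by rewrite -[X in measurable X]setTI; exact: measurable_circle_map.
rewrite -(@lam_shift _ t _ mI) -(lam_opp mS); congr (lam _).
by apply/seteqP; split => y; rewrite /= in_itv/= mod1Dl addrC.
Qed.

(** For c <= 1/2 and sorted points of a half circle, this is the length of the union of the
    arcs of length c that end at these points. *)
Fixpoint gapsum (c : R) (ts : seq R) : R :=
  if ts is t :: ts' then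
    (if ts' is t' :: _ then Num.min c (t' - t) else c) + gapsum c ts'
  else 0.

Definition hit_set (c : R) (ts : seq R) : set mR :=
  [set y | has (fun t => 0 < mod1 (t - y) < c) ts].

Lemma measurable_alive (d : measure_display) (T : measurableType d) (c : R) (f g : T -> mR) :
  measurable_fun setT f -> measurable_fun setT g ->
  measurable_fun setT (fun z => 0 < mod1 (f z - g z) < c).
Proof.
move=> mf mg; have mm : measurable_fun setT (fun z => mod1 (f z - g z) : mR).
  by apply: (measurableT_comp (@measurable_mod1 R)); exact: measurable_funB.
by apply: measurable_and; apply: measurable_fun_ltr.
Qed.

Lemma measurable_hit_set c ts : measurable (hit_set c ts).
Proof.
have m : measurable_fun setT (fun y : mR => has (fun t => 0 < mod1 (t - y) < c) ts).
  elim: ts => [|t ts IH] /=; first exact: measurable_cst.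
  by apply: measurable_or => //; apply: measurable_alive.
by have := m measurableT [set true] I; rewrite setTI.
Qed.

(** To the starts of the arcs that hit a later point, the point t adds at least those of the
    arcs that contain t and end before the next point. *)
Lemma hit_set_ge (a c : R) ts : 0 < c -> c <= 1/2 ->
  sorted <=%R ts -> all (fun t => a <= t < a + 1/2) ts ->
  ((gapsum c ts)%:E <= lam (hit_set c ts))%E.
Proof.
move=> c0 c1; elim: ts => [|t [|t' ts] IH] srt win; first exact: measure_ge0.
  rewrite /= addr0 -[X in (X%:E <= _)%E]subr0 -(@lam_sub_itv t 0 c)//; [|lra|lra].
  rewrite (_ : [set y | _] = hit_set c [:: t])//.
  by apply/seteqP; split => y; rewrite /hit_set /= orbF.
have {}IH : ((gapsum c (t' :: ts))%:E <= lam (hit_set c (t' :: ts)))%E.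
  by apply: IH; [case/andP: srt|case/andP: win].
have tt' : t <= t' by case/andP: srt.
set m := Num.min c (t' - t).
have m0 : 0 <= m by rewrite le_min; lra.
have mc : m <= c by rewrite ge_min lexx.
pose U := [set y : mR | c - m < mod1 (t - y) < c].
have mU : measurable U.
  rewrite (_ : U = ~` [set y | (fun y => mod1 (t - y) <= c - m) y] `&` hit_set c [:: t]); last first.
    apply/seteqP; split => y; rewrite /U /hit_set /= orbF.
      by move=> /andP[h1 h2]; split; [apply/negP; rewrite -ltNge|rewrite h2 andbT; lra].
    by move=> [/negP]; rewrite -ltNge => -> /andP[_ ->].
  apply: measurableI; last exact: measurable_hit_set.
  apply: measurableC.
  have mm : measurable_fun setT (fun y : mR => mod1 (t - y) : mR).
    by apply: (measurableT_comp (@measurable_mod1 R)); exact: measurable_funB.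
  by have := measurable_fun_ler mm (measurable_cst (c - m)) measurableT (Y := [set true]) I; rewrite setTI.
rewrite [gapsum _ _]/= -/(gapsum c (t' :: ts)) -/m EFinD.
have -> : m%:E = lam U by rewrite lam_sub_itv; [congr EFin; lra|lra|lra|lra].
apply: (le_trans (leeD2l _ IH)).
rewrite -measureU//; last 2 first.
- exact: measurable_hit_set.
- apply/seteqP; split => y //= -[/= /andP[u1 u2] /hasP[s sin /andP[s0 s1]]].
  have ws : a <= s < a + 1/2.
    have H : all (fun t => a <= t < a + 1/2) (t' :: ts) by case/andP: win.
    exact: (allP H).
  have wt : a <= t < a + 1/2 by case/andP: win.
  have t's : t' <= s.
    move: sin; rewrite inE => /predU1P[->//|sin].
    by move: srt => /= /andP[_] /(order_path_min le_trans) /allP; apply.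
  have E : mod1 (s - y) = mod1 (t - y) + (s - t).
    by rewrite -[RHS]mod1_id ?mod1Dl; [congr mod1; ring|lra].
  rewrite E in s1.
  have [h|h] := leP c (t' - t).
    by move: u1; rewrite /m (min_idPl h); lra.
  by move: u1; rewrite /m (min_idPr (ltW h)); lra.
apply: le_measure; rewrite ?inE; try exact: measurable_hit_set.
  by apply: measurableU => //; exact: measurable_hit_set.
move=> y [/= /andP[u1 u2]|yh].
  by rewrite /hit_set /= u2 andbT; apply/orP; left; lra.
by apply/orP; right.
Qed.

Variable l : nat -> R.
Hypothesis l01 : forall n, 0 < l n < 1.
Hypothesis lanti : {homo l : m n / (m <= n)%N >-> n <= m}.
Variable S2 : R.
Hypothesis lS2 : forall n, \sum_(k < n) l k ^+ 2 <= S2.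
Local Notation K := (covering_kernel l).

Let p0 n : 0 < l n. Proof. by have /andP[] := l01 n. Qed.
Let p1 n : l n < 1. Proof. by have /andP[] := l01 n. Qed.

(** The normalisation of a factor is exp (l n) up to an exponent that is summable in n. *)
Lemma inv1B_le n : (1 - l n)^-1 <= expR (l n + (1 - l 0)^-1 * l n ^+ 2).
Proof.
have := p0 n; have := p1 n; have := p0 0; have := p1 0; have := lanti (leq0n n).
move: (l n) (l 0%N) => x y yx y1 y0 x1 x0.
apply: (@le_trans _ _ (expR (x / (1 - x)))).
  apply: (@le_trans _ _ (1 + x / (1 - x))); last exact: expR_ge1Dx.
  by rewrite le_eqVlt; apply/orP; left; apply/eqP; field; lra.
rewrite ler_expR (_ : x / (1 - x) = x + (1 - x)^-1 * x ^+ 2); last by field; lra.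
by rewrite lerD2l ler_wpM2r ?sqr_ge0// lef_pV2 ?posrE; lra.
Qed.

(** On sorted points of a half circle, this is the logarithm of [link_prod] truncated to the
    first n arcs. *)
Fixpoint gap_excess n (ts : seq R) : R :=
  if ts is t :: ts' then
    (if ts' is t' :: _ then \sum_(k < n) Num.max (l k - (t' - t)) 0 else 0) + gap_excess n ts'
  else 0.

Fixpoint link_prod (ts : seq R) : \bar R :=
  if ts is t :: ts' then
    ((if ts' is t' :: _ then K (t' - t)%R else 1) * link_prod ts')%E
  else 1%E.

Lemma gap_excess_le n (a : R) ts : sorted <=%R ts -> all (fun t => a <= t < a + 1/2) ts ->
  ((expR (gap_excess n ts))%:E <= link_prod ts)%E.
Proof.
elim: ts => [|t [|t' ts] IH] srt win; rewrite ?expR0 ?addr0 ?expR0 ?mule1//=.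
  by rewrite addr0 expR0 mule1.
rewrite expRD EFinM; apply: lee_pmul; rewrite ?lee_fin ?expR_ge0//.
  apply: le_trans (K_partial l n _); rewrite lee_fin ler_expR.
  have ws : a <= t' < a + 1/2 by case/and3P: win.
  have wt : a <= t < a + 1/2 by case/andP: win.
  have tt' : t <= t' by case/andP: srt.
  rewrite circle_norm_small ?ger0_norm//; lra.
by apply: IH; [case/andP: srt|case/andP: win].
Qed.

(** In p * l k the starts that hit two consecutive points are counted twice; these overlaps
    are the terms of [gap_excess].  Arcs longer than 1/2 are truncated at the cost of the last
    sum. *)
Lemma gapsumE (a : R) n t ts : sorted <=%R (t :: ts) -> all (fun t => a <= t < a + 1/2) (t :: ts) ->
  \sum_(k < n) ((size (t :: ts))%:R * l k - gapsum (Num.min (l k) (1/2)) (t :: ts)) =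
  gap_excess n (t :: ts) + \sum_(k < n) (l k - Num.min (l k) (1/2)).
Proof.
elim: ts t => [|t' ts IH] t srt win.
  rewrite /= !add0r; apply: eq_bigr => k _.
  by rewrite addr0 mulr1n mul1r.
have {}IH := IH t'; rewrite [gap_excess _ _]/= -/(gap_excess n (t' :: ts)) -addrA -IH; last 2 first.
- by case/andP: srt.
- by case/andP: win.
rewrite -big_split/=; apply: eq_bigr => k _.
have ws : a <= t' < a + 1/2 by case/and3P: win.
have wt : a <= t < a + 1/2 by case/andP: win.
have -> : Num.min (Num.min (l k) (1/2)) (t' - t) = Num.min (l k) (t' - t).
  by rewrite -minA; congr Num.min; apply/min_idPr; lra.
have -> : Num.max (l k - (t' - t)) 0 = l k - Num.min (l k) (t' - t).
  have [h|h] := leP (l k) (t' - t).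
    by rewrite subrr; apply/max_idPr; lra.
  by apply/max_idPl; lra.
rewrite -[(size ts).+2%:R]natr1.
ring.
Qed.

Context (d : measure_display) (Om : measurableType d) (P : probability Om R).
Variable omega : nat -> {RV P >-> R}.
Hypothesis indep : mutually_independent omega.
Hypothesis unif : forall n, circle_uniform (omega n).

Lemma dvoretzky_factorE (w : nat -> R) k t : dvoretzky_factor l w k t =
  (if 0 < mod1 (t - w k) < l k then 0 else 1) / (1 - l k).
Proof.
rewrite /dvoretzky_factor indicE mem_setE in_itv/=.
by case: ifP => _; rewrite ?subrr ?subr0.
Qed.

Lemma density_prodE (w : nat -> R) n ts :
  \prod_(t <- ts) dvoretzky_density l w n t =
  (if [forall k : 'I_n, ~~ has (fun t => 0 < mod1 (t - w k) < l k) ts] then 1 else 0) *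
  \prod_(k < n) (1 - l k)^-1 ^+ size ts.
Proof.
rewrite /dvoretzky_density exchange_big/=.
have E (k : 'I_n) : \prod_(t <- ts) dvoretzky_factor l w k t =
    (if ~~ has (fun t => 0 < mod1 (t - w k) < l k) ts then 1 else 0) * (1 - l k)^-1 ^+ size ts.
  elim: ts => [|t ts IH]; first by rewrite big_nil mul1r.
  rewrite big_cons IH dvoretzky_factorE /= exprS.
  by case: ifP => _ /=; case: ifP => _; ring.
rewrite (eq_bigr _ (fun k _ => E k)) big_split/=; congr (_ * _).
case: ifP => [/forallP H|/negbT]; first by rewrite big1// => k _; rewrite H.
by rewrite negb_forall => /existsP[k /negbTE Hk]; rewrite (bigD1 k)//= Hk mul0r.
Qed.

(** By independence the mean is a product over k.  The k-th arc misses all the p points with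
    probability at most exp (- gapsum), while the p normalisations contribute exp (p * l k) up
    to a summable exponent; by [gapsumE] the sum of these exponents is the logarithm of the
    product of the kernels. *)
Lemma correlation_le (a : R) n t ts : sorted <=%R (t :: ts) ->
  all (fun t => a <= t < a + 1/2) (t :: ts) ->
  (\int[P]_x (\prod_(s <- t :: ts) dvoretzky_density l (fun k => omega k x) n s)%:E <=
   (expR (((size (t :: ts))%:R * (1 - l 0)^-1 + 1/2) * S2))%:E * link_prod (t :: ts))%E.
Proof.
move=> srt win; set L := t :: ts; set p := size L.
pose V k := ~` hit_set (l k) L.
have mV k : measurable (V k) by apply: measurableC; exact: measurable_hit_set.
pose Q := \prod_(k < n) (1 - l k)^-1 ^+ p.
have Q0 : 0 <= Q by apply: prodr_ge0 => k _; rewrite exprn_ge0// invr_ge0 subr_ge0 ltW.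
have mset : measurable [set x | forall i, (i < n)%N -> V i (omega i x)].
  rewrite (_ : [set _ | _] = \bigcap_(i in `I_n) (omega i @^-1` V i))//.
  apply: fin_bigcap_measurable => [|i _]; first exact: finite_II.
  by rewrite -[X in measurable X]setTI; exact: (measurable_funPT (omega i) measurableT _ (mV i)).
rewrite (eq_integral (fun x => (Q * \1_[set x | forall i, (i < n)%N -> V i (omega i x)] x)%:E)); last first.
  move=> x _; rewrite density_prodE mulrC; congr (_ * _)%:E.
  rewrite indicE; case: ifP => [/forallP H|/negbT].
    rewrite mem_set// => i ni /=; apply/negP; exact: (H (Ordinal ni)).
  rewrite negb_forall => /existsP[k Hk]; rewrite memNset//= => /(_ k (ltn_ord k)).
  by apply; move: Hk; rewrite negbK.
under eq_integral do rewrite EFinM.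
rewrite ge0_integralZl//; last first.
  by apply/measurable_EFinP; exact: measurable_indic.
rewrite (_ : integral _ _ _ = \prod_(k < n) lam (V k))%E; last first.
  by rewrite integral_indic// setIT; exact: indep_prod.
have VE k : (lam (V k) <= (expR (- gapsum (Num.min (l k) (1/2)) L))%:E)%E.
  have h1 : ((gapsum (Num.min (l k) (1/2)) L)%:E <= lam (hit_set (l k) L))%E.
    apply: (@le_trans _ _ (lam (hit_set (Num.min (l k) (1/2)) L))).
      by apply: (@hit_set_ge a) => //; rewrite ?lt_min ?ge_min ?lexx ?orbT// p0; lra.
    apply: le_measure; rewrite ?inE; try exact: measurable_hit_set.
    move=> y /= /hasP[s sL /andP[s0 s1]]; apply/hasP; exists s => //.
    by rewrite s0/= (lt_le_trans s1)// ge_min lexx.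
  rewrite [X in (X <= _)%E](@probability_setC _ _ _ lam)//; last exact: measurable_hit_set.
  apply: (@le_trans _ _ (1 - gapsum (Num.min (l k) (1/2)) L)%:E).
    by rewrite EFinB; apply: leeB.
  by rewrite lee_fin; apply: expR_ge1Dx.
apply: (@le_trans _ _ (Q * \prod_(k < n) expR (- gapsum (Num.min (l k) (1/2)) L))%:E).
  rewrite EFinM; apply: lee_wpmul2l; first by rewrite lee_fin.
  rewrite -prodEFin.
  by apply: lee_prod => k; rewrite VE andbT; exact: measure_ge0.
apply: (@le_trans _ _ (expR ((p%:R * (1 - l 0)^-1 + 1/2) * S2) * expR (gap_excess n L))%:E); last first.
  by rewrite EFinM; apply: lee_wpmul2l; [rewrite lee_fin expR_ge0|exact: gap_excess_le win].
rewrite lee_fin -expRD -expR_sum /Q.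
apply: (@le_trans _ _ (\prod_(k < n) expR (p%:R * (l k + (1 - l 0)^-1 * l k ^+ 2)) *
    expR (\sum_(k < n) - gapsum (Num.min (l k) (1/2)) L))).
  apply: ler_wpM2r; first exact: expR_ge0.
  apply: ler_prod => k _; rewrite exprn_ge0 ?invr_ge0 ?subr_ge0 ?(ltW (p1 k))//=.
  rewrite expRM_natl; apply: lerXn2r; rewrite ?nnegrE ?expR_ge0 ?invr_ge0 ?subr_ge0 ?(ltW (p1 k))//.
  exact: inv1B_le.
rewrite -expR_sum -expRD ler_expR -big_split.
rewrite -[leLHS]/(\sum_(k < n) (p%:R * (l k + (1 - l 0)^-1 * l k ^+ 2) - gapsum (Num.min (l k) (1/2)) L)).
have := gapsumE n srt win; rewrite -/L -/p => E.
rewrite (eq_bigr (fun k : 'I_n => (p%:R * l k - gapsum (Num.min (l k) (1/2)) L) +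
    (p%:R * (1 - l 0)^-1) * l k ^+ 2)); last by move=> k _; ring.
rewrite big_split/= E -mulr_sumr -[X in _ <= _ + X]/(gap_excess n L) mulrDl.
have h1 : \sum_(k < n) (l k - Num.min (l k) (1/2)) <= 1/2 * \sum_(k < n) l k ^+ 2.
  rewrite mulr_sumr; apply: ler_sum => k _.
  have := sqr_ge0 (l k - 1); have := sqr_ge0 (l k).
  rewrite sqrrB1 => q0 q1.
  have [h|h] := leP (l k) (1/2); first by rewrite subrr; lra.
  by lra.
have h2 := lS2 n.
have c0 : 0 <= p%:R * (1 - l 0)^-1 by rewrite mulr_ge0// invr_ge0 subr_ge0 ltW.
have h3 : p%:R * (1 - l 0)^-1 * \sum_(k < n) l k ^+ 2 <= p%:R * (1 - l 0)^-1 * S2 by exact: ler_wpM2l.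
lra.
Qed.

End correlation.

(** * Fejer kernels and sums over signs *)

Section sign_sums.
Variable R : realType.
Local Notation mR := (measurableTypeR R).
Local Notation lam := (@circle_lebesgue R).
Local Notation torus n := (torus_lebesgue R n).

Lemma integral_cst_probability d (T : measurableType d) (Q : probability T R) (c : \bar R) :
  (\int[Q]__ c = c)%E.
Proof.
by rewrite integral_cst// -[RHS]mule1; congr (_ * _)%E; exact: (@probability_setT _ _ _ Q).
Qed.

(** This is the sum of Phi over the 2^p points y +- t_1 ... +- t_p. *)
Fixpoint sgs (Phi : R -> R) (ts : seq R) (y : R) : R :=
  if ts is t :: ts' then sgs Phi ts' (y + t) + sgs Phi ts' (y - t) else Phi y.

Lemma sgs_ge0 Phi ts y : (forall z, 0 <= Phi z) -> 0 <= sgs Phi ts y.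
Proof. by move=> P0; elim: ts y => [|t ts IH] y //=; rewrite addr_ge0. Qed.

Lemma sgs_mid Phi s1 x s2 y : sgs Phi (s1 ++ x :: s2) y = sgs Phi (x :: s1 ++ s2) y.
Proof.
elim: s1 y => [//|z s1 IH] y /=; rewrite !IH /=.
rewrite addrACA [y + x + z]addrAC [y + x - z]addrAC [y - x + z]addrAC [y - x - z]addrAC.
by [].
Qed.

Lemma sgs_perm Phi s t y : perm_eq s t -> sgs Phi s y = sgs Phi t y.
Proof.
elim: s t y => [|x s IH] t y.
  by rewrite perm_sym => /perm_nilP ->.
move=> pst; have xt : x \in t by rewrite -(perm_mem pst) mem_head.
case/splitPr: xt pst => t1 t2 pst; rewrite sgs_mid /=.
have pst' : perm_eq s (t1 ++ t2).
  by move: pst; rewrite perm_sym perm_catC /= perm_cons perm_sym => /perm_trans; apply; rewrite perm_catC.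
by rewrite !(IH _ _ pst').
Qed.

Section trig.
Variables (N : nat) (phi : R).

Definition freq (i j : 'I_N) : R := 2 * pi * (i%:R - j%:R).

(** This is N times the Fejer kernel: the squared modulus of a sum of N exponentials. *)
Definition Fejer (y : R) : R := \sum_(i < N) \sum_(j < N) cos (freq i j * y).

Lemma FejerE y : Fejer y = (\sum_(i < N) cos (2 * pi * i%:R * y)) ^+ 2 +
  (\sum_(i < N) sin (2 * pi * i%:R * y)) ^+ 2.
Proof.
rewrite !expr2 !mulr_suml -big_split/=; apply: eq_bigr => i _.
rewrite !mulr_sumr -big_split/=; apply: eq_bigr => j _.
by rewrite /freq mulrBr mulrBl cosB.
Qed.

Lemma Fejer_ge0 y : 0 <= Fejer y.
Proof. by rewrite FejerE addr_ge0 ?sqr_ge0. Qed.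

Lemma sum_sin0 y : \sum_(i < N) \sum_(j < N) sin (freq i j * y) = 0.
Proof.
have E : \sum_(i < N) \sum_(j < N) sin (freq i j * y) = - \sum_(i < N) \sum_(j < N) sin (freq i j * y).
  rewrite {1}exchange_big/= -sumrN; apply: eq_bigr => i _; rewrite -sumrN; apply: eq_bigr => j _.
  by rewrite -sinN /freq; congr sin; ring.
lra.
Qed.

(** The formula cos A cos B = (cos (A + B) + cos (A - B)) / 2 trades each factor for a choice
    of sign and a shift of the phase.  Once no factor is left, the sines cancel in pairs and
    the remaining sum is the cosine of a phase times a nonnegative Fejer sum. *)
Lemma cos_prod_le ts y psi :
  \sum_(i < N) \sum_(j < N) cos (freq i j * y - psi) * \prod_(t <- ts) cos (freq i j * t - phi)
    <= sgs Fejer ts y.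
Proof.
elim: ts y psi => [|t ts IH] y psi.
  under eq_bigr do under eq_bigr do rewrite big_nil mulr1 cosB.
  under eq_bigr do rewrite big_split/= -!mulr_suml.
  rewrite big_split/= -!mulr_suml sum_sin0 mul0r addr0 /=.
  by rewrite -[leRHS]mulr1 ler_wpM2l ?Fejer_ge0 ?cos_le1.
rewrite /=; have h1 := IH (y + t) (psi + phi); have h2 := IH (y - t) (psi - phi).
have g1 := sgs_ge0 ts (y + t) Fejer_ge0; have g2 := sgs_ge0 ts (y - t) Fejer_ge0.
rewrite (_ : \sum_(i < N) _ = 1/2 * (
  \sum_(i < N) \sum_(j < N) cos (freq i j * (y + t) - (psi + phi)) * \prod_(t <- ts) cos (freq i j * t - phi) +
  \sum_(i < N) \sum_(j < N) cos (freq i j * (y - t) - (psi - phi)) * \prod_(t <- ts) cos (freq i j * t - phi))).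
  lra.
rewrite -big_split/= mulr_sumr; apply: eq_bigr => i _.
rewrite -big_split/= mulr_sumr; apply: eq_bigr => j _.
rewrite big_cons mulrA -mulrDl mulrA; congr (_ * _).
have -> : freq i j * (y + t) - (psi + phi) = (freq i j * y - psi) + (freq i j * t - phi) by ring.
have -> : freq i j * (y - t) - (psi - phi) = (freq i j * y - psi) - (freq i j * t - phi) by ring.
move: (freq i j * y - psi) (freq i j * t - phi) => A B.
by rewrite cosD cosB; field.
Qed.

Lemma measurable_cos_lin (c e : R) : measurable_fun [set: mR] (fun t : mR => cos (c * t - e)).
Proof.
have mc : measurable_fun [set: R] (@cos R) by apply: continuous_measurable_fun; exact: continuous_cos.
by apply: (measurableT_comp mc); apply: measurable_funB => //; exact: measurable_funM.
Qed.

Lemma measurable_Fejer : measurable_fun [set: mR] (Fejer : mR -> mR).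
Proof.
apply: measurable_sum => i; apply: measurable_sum => j.
have := measurable_cos_lin (freq i j) 0.
by under eq_fun do rewrite subr0.
Qed.

Lemma cosD_period (n : nat) (z : R) : cos (z + 2 * pi * n%:R) = cos z.
Proof.
elim: n => [|n IH]; first by rewrite mulr0 addr0.
have -> : z + 2 * pi * n.+1%:R = (z + 2 * pi * n%:R) + pi *+ 2 by rewrite -natr1 mulr2n; ring.
by rewrite mulr2n addrA !cosDpi opprK IH.
Qed.

Lemma cos_per (i j : nat) y : cos (2 * pi * (i%:R - j%:R) * (y + 1)) = cos (2 * pi * (i%:R - j%:R) * y) :> R.
Proof.
have -> : 2 * pi * (i%:R - j%:R) * (y + 1) = 2 * pi * (i%:R - j%:R) * y - 2 * pi * j%:R + 2 * pi * i%:R :> R by ring.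
by rewrite cosD_period -(cosD_period j) subrK.
Qed.

Lemma circle_fun_Fejer : circle_fun (EFin \o Fejer).
Proof.
split.
- by move=> t /=; congr EFin; apply: eq_bigr => i _; apply: eq_bigr => j _; exact: cos_per.
- apply/measurable_EFinP; exact: measurable_Fejer.
- by move=> t; rewrite lee_fin Fejer_ge0.
Qed.

(** A translation by half a period changes the sign of the cosine.  The constant 1 keeps the
    integrands nonnegative, so that the integrals of 1 + cos and 1 - cos, which are equal and
    sum to 2, can be handled in the extended reals. *)
Lemma integral_1cos (i j : 'I_N) :
  (\int[lam]_t (1 + cos (freq i j * t))%:E = if i == j then 2%:E else 1%:E)%E.
Proof.
have [->|ij] := eqVneq i j.
  rewrite /freq subrr mulr0; under eq_integral do rewrite mul0r cos0.
  exact: (integral_cst_probability lam).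
have f0 t : 0 <= 1 + cos (freq i j * t) by have := cos_geN1 (freq i j * t); lra.
have f0' t : 0 <= 1 - cos (freq i j * t) by have := cos_le1 (freq i j * t); lra.
have mc : measurable_fun [set: mR] (fun t : mR => cos (freq i j * t)).
  by have := measurable_cos_lin (freq i j) 0; under eq_fun do rewrite subr0.
have m1 : measurable_fun setT (fun t : mR => (1 + cos (freq i j * t))%:E).
  by apply/measurable_EFinP; exact: measurable_funD.
have m2 : measurable_fun setT (fun t : mR => (1 - cos (freq i j * t))%:E).
  by apply/measurable_EFinP; exact: measurable_funB.
have E : (\int[lam]_t (1 + cos (freq i j * t))%:E = \int[lam]_t (1 - cos (freq i j * t))%:E)%E.
  rewrite -(@integral_lam_shift _ (2 * (i%:R - j%:R))^-1 (fun t => (1 + cos (freq i j * t))%:E))//.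
  - apply: eq_integral => t _; congr EFin.
    have -> : freq i j * (t + (2 * (i%:R - j%:R))^-1) = freq i j * t + pi.
      rewrite /freq; have : (i%:R - j%:R : R) != 0 by rewrite subr_eq0 eqr_nat.
      by move=> ij0; field.
    by rewrite cosDpi.
  - by move=> t; rewrite /freq cos_per.
have S : (\int[lam]_t (1 + cos (freq i j * t))%:E + \int[lam]_t (1 - cos (freq i j * t))%:E = 2%:E)%E.
  rewrite -ge0_integralD//.
  rewrite (eq_integral (fun _ : mR => 2%:E)); first exact: (integral_cst_probability lam).
  by move=> t _; rewrite -EFinD; congr EFin; ring.
move: S; rewrite -E; move: (\int[lam]_t _)%E => [r| |] //= /eqP.
rewrite -EFinD eqe => /eqP rr; congr EFin; lra.
Qed.

Lemma integral_Fejer : (\int[lam]_t (Fejer t)%:E = N%:R%:E)%E.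
Proof.
have E : (\int[lam]_t ((Fejer t)%:E + (N%:R * N%:R)%:E) = (N%:R * N%:R)%:E + N%:R%:E)%E.
  transitivity (\int[lam]_t (\sum_(i < N) \sum_(j < N) (1 + cos (freq i j * t))%:E))%E.
    apply: eq_integral => t _.
    under eq_bigr do rewrite sumEFin. rewrite sumEFin -EFinD; congr EFin.
    under eq_bigr do rewrite big_split/= sumr_const card_ord.
    rewrite big_split/= sumr_const card_ord mulr_natr addrC; congr (_ + _).
  have mf i j : measurable_fun setT (fun t : mR => (1 + cos (freq i j * t))%:E).
    apply/measurable_EFinP; apply: measurable_funD => //.
    by have := measurable_cos_lin (freq i j) 0; under eq_fun do rewrite subr0.
  have f0 i j t : (0 <= (1 + cos (freq i j * t))%:E)%E.
    by rewrite lee_fin; have := cos_geN1 (freq i j * t); lra.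
  rewrite ge0_integral_sum//; last 2 first.
  - by move=> i; apply: emeasurable_sum => j.
  - by move=> i t _; apply: sume_ge0 => j _.
  under eq_bigr => i _.
    rewrite ge0_integral_sum//.
    under eq_bigr => j _ do rewrite integral_1cos.
    rewrite (_ : \sum_(j < N) _ = (N%:R + 1)%:E)%E; last first.
      rewrite (bigD1 i)//= eqxx (eq_bigr (fun=> 1%:E)); last by move=> j; rewrite eq_sym => /negbTE ->.
      rewrite sumEFin -EFinD; congr EFin.
      have : \sum_(j < N) (1 : R) = N%:R by rewrite sumr_const card_ord.
      by rewrite (bigD1 i)//=; lra.
    over.
  rewrite sumEFin -EFinD; congr EFin.
  by rewrite sumr_const card_ord -[_ *+ _]mulr_natr; ring.
have mF : measurable_fun setT (fun t : mR => (Fejer t)%:E).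
  by apply/measurable_EFinP; exact: measurable_Fejer.
move: E; rewrite ge0_integralD//; try by move=> t _; rewrite lee_fin ?Fejer_ge0 ?mulr_ge0.
rewrite (integral_cst_probability lam).
move: (\int[lam]_t _)%E => [r| |] //= /eqP.
by rewrite -!EFinD eqe => /eqP rr; congr EFin; lra.
Qed.

End trig.

Lemma measurable_tuple_head d (T : measurableType d) n (f : T -> n.+1.-tuple mR) :
  measurable_fun setT f -> measurable_fun setT (fun z => thead (f z) : mR).
Proof. by move=> mf; exact: (measurableT_comp (measurable_tnth ord0) mf). Qed.

Lemma measurable_tuple_tail d (T : measurableType d) n (f : T -> n.+1.-tuple mR) :
  measurable_fun setT f -> measurable_fun setT (fun z => [tuple of behead (f z)] : n.-tuple mR).
Proof. by move=> mf; exact: (measurableT_comp (@measurable_behead _ mR n) mf). Qed.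

Lemma tuple_headE n (t : n.+1.-tuple mR) : (t : seq mR) = thead t :: [tuple of behead t].
Proof. by case/tupleP: t => x t; rewrite theadE. Qed.

Lemma measurable_sgs d (T : measurableType d) n Phi (f : T -> n.-tuple mR) (g : T -> mR) :
  measurable_fun [set: mR] (Phi : mR -> mR) -> measurable_fun setT f -> measurable_fun setT g ->
  measurable_fun setT (fun z => sgs Phi (f z) (g z) : mR).
Proof.
move=> mP; elim: n f g => [|n IH] f g mf mg.
  by under eq_fun do rewrite tuple0; exact: (measurableT_comp mP).
under eq_fun do rewrite tuple_headE /=.
have mh := measurable_tuple_head mf; have mt := measurable_tuple_tail mf.
apply: measurable_funD; apply: (IH (fun z => [tuple of behead (f z)])) => //.
  exact: measurable_funD.
exact: measurable_funB.
Qed.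

Lemma measurable_path d (T : measurableType d) n (f : T -> n.-tuple mR) (g : T -> mR) :
  measurable_fun setT f -> measurable_fun setT g ->
  measurable_fun setT (fun z => path <=%R (g z) (f z)).
Proof.
elim: n f g => [|n IH] f g mf mg.
  by under eq_fun do rewrite tuple0; exact: measurable_cst.
under eq_fun do rewrite tuple_headE /=.
have mh := measurable_tuple_head mf; have mt := measurable_tuple_tail mf.
by apply: measurable_and; [exact: measurable_fun_ler|exact: (IH (fun z => [tuple of behead (f z)]))].
Qed.

Lemma measurable_sorted d (T : measurableType d) n (f : T -> n.-tuple mR) :
  measurable_fun setT f -> measurable_fun setT (fun z => sorted <=%R (f z)).
Proof.
case: n f => [|n] f mf; first by under eq_fun do rewrite tuple0; exact: measurable_cst.
under eq_fun do rewrite tuple_headE /=.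
by apply: measurable_path; [exact: measurable_tuple_tail|exact: measurable_tuple_head].
Qed.

Lemma measurable_tprod d (T : measurableType d) n (f : T -> n.-tuple mR) (h : T -> mR -> R) :
  measurable_fun [set: T * mR] (fun z => h z.1 z.2) -> measurable_fun setT f ->
  measurable_fun setT (fun z => \prod_(s <- f z) h z s).
Proof.
move=> mh mf.
under eq_fun do rewrite big_tuple.
apply: measurable_prod => i _.
apply: (measurableT_comp mh (g := fun z => (z, tnth (f z) i : mR))).
apply/measurable_fun_pair => //.
exact: (measurableT_comp (measurable_tnth i) mf).
Qed.

Section simplex.
Variable l : nat -> R.
Local Notation K := (covering_kernel l).
Local Notation cst_if := (@cst_if R).
Variables (a b : R).

Fixpoint links (x : R) (ts : seq R) : \bar R :=
  if ts is t :: ts' then (cst_if (x <= t < b)%R * K (t - x)%R * links t ts')%E else 1%E.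

Lemma links_ge0 x ts : (0 <= links x ts)%E.
Proof. by elim: ts x => [//|t ts IH] x /=; rewrite !mule_ge0 ?cst_if_ge0 ?K_ge0. Qed.

Lemma measurable_links d (T : measurableType d) n (f : T -> n.-tuple mR) (g : T -> mR) :
  measurable_fun setT f -> measurable_fun setT g ->
  measurable_fun setT (fun z => links (g z) (f z)).
Proof.
elim: n f g => [|n IH] f g mf mg.
  by under eq_fun do rewrite tuple0; exact: measurable_cst.
under eq_fun do rewrite tuple_headE /=.
have mh := measurable_tuple_head mf; have mt := measurable_tuple_tail mf.
by apply: emeasurable_funM; [exact: measurable_link|exact: (IH (fun z => [tuple of behead (f z)]))].
Qed.

Lemma chain_torus (Phi : R -> R) j y x :
  measurable_fun [set: mR] (Phi : mR -> mR) -> (forall z, 0 <= Phi z) ->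
  (\int[torus j]_s (links x s * (sgs Phi s y)%:E) = chain l b (EFin \o Phi) j y x)%E.
Proof.
move=> mP P0.
have mF n (z u : R) : measurable_fun setT (fun s : n.-tuple mR => links z s * (sgs Phi s u)%:E)%E.
  apply: emeasurable_funM; first by apply: measurable_links.
  by apply/measurable_EFinP; apply: measurable_sgs.
have F0 n (z u : R) (s : n.-tuple mR) : (0 <= links z s * (sgs Phi s u)%:E)%E.
  by rewrite mule_ge0 ?links_ge0// lee_fin sgs_ge0.
elim: j x y => [|j IH] x y.
  by rewrite [LHS](integral_dirac _ _ (mF 0%N x y))//= diracE mem_set//= mul1e mul1e.
rewrite integral_torus_cons// chainS; apply: eq_integral => t _.
rewrite -!IH -ge0_integralD//; try exact: mF.
rewrite -ge0_integralZl//; last 3 first.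
- by apply: emeasurable_funD; exact: mF.
- by move=> s _; rewrite adde_ge0.
- by rewrite mule_ge0 ?cst_if_ge0 ?K_ge0.
apply: eq_integral => s _ /=.
by rewrite EFinD -muleA; congr (_ * _)%E; rewrite ge0_muleDr// lee_fin sgs_ge0.
Qed.

Lemma link_prod_links t ts : (cst_if (sorted <=%R (t :: ts) && all (fun u => a <= u < b)%R (t :: ts)) *
   link_prod l (t :: ts) <= cst_if (a <= t < b)%R * links t ts)%E.
Proof.
rewrite {1}/cst_if; case: ifP => [/andP[srt win]|_]; last first.
  by rewrite mul0e mule_ge0 ?links_ge0 ?cst_if_ge0.
rewrite mul1e le_eqVlt; apply/orP; left; apply/eqP.
elim: ts t srt win => [|t' ts IH] t srt win.
  by move: win; rewrite /= andbT /cst_if => ->; rewrite !mule1.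
rewrite [LHS]/= -/(link_prod l (t' :: ts)) IH; [|by case/andP: srt|by case/andP: win].
have wt : a <= t < b by case/andP: win.
have wt' : a <= t' < b by case/and3P: win.
have tt' : t <= t' < b by case/andP: srt => ->; case/andP: wt'.
by rewrite /= /cst_if wt wt' tt' !mul1e.
Qed.

End simplex.

Lemma probability_lty d (T : measurableType d) (Q : probability T R) : (Q setT < +oo)%E.
Proof. by rewrite probability_setT ltry. Qed.

Lemma integral_torus_prod (h : mR -> R) (Mb : R) p :
  measurable_fun setT h -> (forall t, `|h t| <= Mb) ->
  lam.-integrable setT (EFin \o h) /\
  ((torus p).-integrable setT (fun t : p.-tuple mR => (\prod_(s <- t) h s)%:E) /\
  (\int[torus p]_t (\prod_(s <- t) h s)%:E = ((\int[lam]_t h t) ^+ p)%:E)%E).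
Proof.
move=> mh hM.
have ih : lam.-integrable setT (EFin \o h).
  apply: measurable_bounded_integrable => //.
    exact: (probability_lty lam).
  by exists Mb; split; [exact: num_real|move=> x Mx t _; exact: le_trans (hM t) (ltW Mx)].
have M0 : 0 <= Mb by exact: le_trans (hM 0).
have mp n : measurable_fun setT (fun t : n.-tuple mR => \prod_(s <- t) h s).
  apply: (@measurable_tprod _ _ n id (fun _ s => h s)) => //.
  exact: (measurableT_comp mh measurable_snd).
have ip n : (torus n).-integrable setT (fun t : n.-tuple mR => (\prod_(s <- t) h s)%:E).
  apply: measurable_bounded_integrable => //; [exact: (probability_lty (torus n))|exact: mp|].
  exists (Mb ^+ n); split; [exact: num_real|move=> x Mx t _; apply: le_trans (ltW Mx)].
  rewrite normr_prod big_tuple -[X in _ <= _ ^+ X]card_ord -prodr_const.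
  by apply: ler_prod => i _; rewrite normr_ge0 hM.
split => //; split; first exact: ip.
elim: p => [|p IH].
  rewrite expr0 [LHS](_ : _ = (\int[torus 0]_t 1%:E))%E.
    by rewrite integral_cst// mul1e; exact: (@probability_setT _ _ _ (torus 0)).
  by apply: eq_integral => t _; rewrite tuple0 big_nil.
pose G (z : mR * p.-tuple mR) : \bar R := (h z.1 * \prod_(s <- z.2) h s)%:E.
have mG : measurable_fun setT G.
  apply/measurable_EFinP; apply: measurable_funM.
    exact: (measurableT_comp mh measurable_fst).
  exact: (measurableT_comp (mp p) measurable_snd).
have iG : (lam \x torus p)%E.-integrable setT G.
  apply: measurable_bounded_integrable => //.
  - exact: (probability_lty (lam \x torus p)%E).
  - exact/measurable_EFinP.
  exists (Mb * Mb ^+ p); split; [exact: num_real|move=> x Mx z _; apply: le_trans (ltW Mx)].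
  rewrite normrM; apply: ler_pM => //.
  rewrite normr_prod big_tuple -[X in _ <= _ ^+ X]card_ord -prodr_const.
  by apply: ler_prod => i _; rewrite normr_ge0 hM.
have E1 : (\int[torus p.+1]_t (\prod_(s <- t) h s)%:E = \int[lam \x torus p]_z G z)%E.
  have E2 := @integral_pushforward _ _ _ _ R (@tuple_cons R p) (@measurable_tuple_cons R p) (lam \x torus p)%E setT
    (fun t : p.+1.-tuple mR => (\prod_(s <- t) h s)%:E).
  have GE : (fun t : p.+1.-tuple mR => (\prod_(s <- t) h s)%:E) \o @tuple_cons R p = G.
    by apply/funext => z; rewrite /G /= big_cons.
  rewrite GE in E2.
  by apply: E2 => //; apply/measurable_EFinP; exact: (mp p.+1).
rewrite E1 -integral12_prod_meas1//.
have -> : (\int[lam]_x fubini_F (torus p) G x = \int[lam]_x ((h x)%:E * ((\int[lam]_t h t) ^+ p)%:E))%E.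
  apply: eq_integral => t _; rewrite /fubini_F -IH -integralZl//.
rewrite integralZr// exprS EFinM; congr (_ * _)%E.
by rewrite /Rintegral fineK//; exact: integrable_fin_num.
Qed.

Lemma le_integral_ge0 d (T : measurableType d) (mu : {measure set T -> \bar R}) (f g : T -> \bar R) :
  measurable_fun setT f -> measurable_fun setT g -> (forall x, 0 <= g x)%E ->
  (forall x, f x <= g x)%E -> (\int[mu]_x f x <= \int[mu]_x g x)%E.
Proof.
move=> mf mg g0 fg; rewrite [leLHS]integralE.
apply: (@le_trans _ _ (\int[mu]_x f^\+ x)%E).
  rewrite -[leRHS]sube0; apply: leeB => //; exact: integral_ge0.
apply: ge0_le_integral => //.
- exact: measurable_funepos.
- by move=> x _; rewrite funeposE ge_max fg g0.
Qed.

(** Every tuple is sorted by some permutation. *)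
Lemma integral_sort p (F : p.-tuple mR -> \bar R) :
  measurable_fun setT F -> (forall t, 0 <= F t)%E ->
  (forall (s : {perm 'I_p}) t, F (perm_tuple s t) = F t) ->
  (\int[torus p]_t F t <=
   (#|{perm 'I_p}|%:R)%:E * \int[torus p]_t (cst_if R (sorted <=%R (t : seq R)) * F t))%E.
Proof.
move=> mF F0 FS.
pose S (t : p.-tuple mR) := (cst_if R (sorted <=%R (t : seq R)) * F t)%E.
have mS : measurable_fun setT S.
  apply: emeasurable_funM => //; apply: measurable_cst_if; exact: (@measurable_sorted _ _ p id).
have S0 t : (0 <= S t)%E by rewrite mule_ge0 ?cst_if_ge0.
apply: (@le_trans _ _ (\int[torus p]_t (\sum_(s : {perm 'I_p}) S (perm_tuple s t)))%E); last first.
  rewrite ge0_integral_sum//; try by move=> s; apply: (measurableT_comp mS); exact: measurable_perm_tuple.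
  rewrite (eq_bigr (fun=> \int[torus p]_t S t)%E); last by move=> s _; exact: integral_torus_perm.
  rewrite sumr_const.
  by rewrite mule_natl.
apply: ge0_le_integral => //.
- by apply: emeasurable_sum => s; apply: (measurableT_comp mS); exact: measurable_perm_tuple.
move=> t _.
have [s Es] : exists s : {perm 'I_p}, sorted <=%R (perm_tuple s t : seq R).
  have st : size (sort <=%R (t : seq R)) == p by rewrite size_sort size_tuple.
  have /tuple_permP[s Es] : perm_eq (Tuple st) t by rewrite /= perm_sort.
  exists s; rewrite (_ : (perm_tuple s t : seq R) = sort <=%R (t : seq R)); last first.
    by rewrite /perm_tuple -Es.
  by apply: sort_sorted; exact: le_total.
rewrite (bigD1 s)//= -[leLHS]adde0; apply: leeD.
  by rewrite /S Es /cst_if mul1e FS.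
by apply: sume_ge0.
Qed.

End sign_sums.

(** * Moments of the Fourier coefficients over a half circle *)

Section moment.
Variable R : realType.
Local Notation mR := (measurableTypeR R).
Local Notation lam := (@circle_lebesgue R).
Local Notation torus n := (torus_lebesgue R n).
Variable l : nat -> R.
Hypothesis l01 : forall n, 0 < l n < 1.
Hypothesis lanti : {homo l : m n / (m <= n)%N >-> n <= m}.
Variable S2 : R.
Hypothesis lS2 : forall n, \sum_(k < n) l k ^+ 2 <= S2.
Local Notation K := (covering_kernel l).
Context (dd : measure_display) (Om : measurableType dd) (P : probability Om R).
Variable omega : nat -> {RV P >-> R}.
Hypothesis indep : mutually_independent omega.
Hypothesis unif : forall n, circle_uniform (omega n).

Definition dens n (x : Om) (t : R) := dvoretzky_density l (fun k => omega k x) n t.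

Lemma dens_ge0 n x t : 0 <= dens n x t.
Proof.
apply: prodr_ge0 => k _; rewrite dvoretzky_factorE; have := l01 k; case: ifP => _ /andP[_ h].
  by rewrite mul0r.
by rewrite mul1r invr_ge0 subr_ge0 ltW.
Qed.

Definition dens_bound n : R := \prod_(k < n) (1 - l k)^-1.

Lemma dens_le n x t : dens n x t <= dens_bound n.
Proof.
apply: ler_prod => k _; rewrite dvoretzky_factorE; have /andP[_ h] := l01 k.
have h' : 0 <= (1 - l k)^-1 by rewrite invr_ge0 subr_ge0 ltW.
by case: ifP => _; rewrite ?mul0r ?mul1r lexx h'.
Qed.

Lemma measurable_dens n : measurable_fun [set: Om * mR] (fun z => dens n z.1 z.2 : mR).
Proof.
apply: measurable_prod => k _.
under eq_fun do rewrite dvoretzky_factorE.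
apply: measurable_funM => //; apply: measurable_fun_ifT => //.
apply: measurable_alive; first exact: measurable_snd.
exact: (measurableT_comp (measurable_funPT (omega k)) measurable_fst).
Qed.

Variables (a phi : R).
Hypothesis a0 : 0 <= a.

Definition window (t : R) : R := if a <= t < a + 1/2 then 1 else 0.

Lemma window_ge0 t : 0 <= window t. Proof. by rewrite /window; case: ifP. Qed.
Lemma window_le1 t : window t <= 1. Proof. by rewrite /window; case: ifP. Qed.

Lemma measurable_window : measurable_fun [set: mR] (window : mR -> mR).
Proof.
apply: measurable_fun_ifT => //; apply: measurable_and.
  exact: measurable_fun_ler.
exact: measurable_fun_ltr.
Qed.

Definition wave n x (c t : R) : R := cos (c * t - phi) * (window t * dens n x t).

Definition half_coef n x (c : R) : R := \int[lam]_t wave n x c t.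

Lemma wave_bound n x c t : `|wave n x c t| <= dens_bound n.
Proof.
have D0 := dens_ge0 n x t; have DB := dens_le n x t; have w0 := window_ge0 t; have w1 := window_le1 t.
rewrite normrM [X in _ * X]ger0_norm ?mulr_ge0//.
have c1 : `|cos (c * t - phi)| <= 1 by rewrite ler_norml cos_geN1 cos_le1.
apply: le_trans DB; apply: le_trans (ler_piMl _ c1) _; first by rewrite mulr_ge0.
exact: ler_piMl.
Qed.

Lemma measurable_wave2 n c : measurable_fun [set: Om * mR] (fun z => wave n z.1 c z.2 : mR).
Proof.
apply: measurable_funM.
  exact: (measurableT_comp (measurable_cos_lin c phi) measurable_snd).
apply: measurable_funM; last exact: measurable_dens.
exact: (measurableT_comp measurable_window measurable_snd).
Qed.

Lemma measurable_wave n x c : measurable_fun [set: mR] (wave n x c : mR -> mR).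
Proof. exact: (measurableT_comp (measurable_wave2 n c) (measurable_pair1 x)). Qed.

Lemma measurable_half_coef n c : measurable_fun [set: Om] (fun x => half_coef n x c : mR).
Proof.
have iW : (P \x lam)%E.-integrable setT (fun z : Om * mR => (wave n z.1 c z.2)%:E).
  apply: measurable_bounded_integrable => //.
  - exact: (probability_lty (P \x lam)%E).
  - exact: measurable_wave2.
  exists (dens_bound n); split; [exact: num_real|move=> y My z _; exact: le_trans (wave_bound _ _ _ _) (ltW My)].
exact: (measurableT_comp (fine_measurable measurableT) (measurable_fubini_F iW)).
Qed.

Lemma dens_prod_measurable n p :
  measurable_fun [set: Om * p.-tuple mR] (fun z => \prod_(s <- z.2) (window s * dens n z.1 s) : mR).
Proof.
apply: (@measurable_tprod _ _ _ _ (@snd Om (p.-tuple mR)) (fun z s => window s * dens n z.1 s)) => //.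
apply: measurable_funM.
  exact: (measurableT_comp measurable_window measurable_snd).
apply: (measurableT_comp (measurable_dens n) (g := fun z : (Om * p.-tuple mR) * mR => (z.1.1, z.2))).
apply/measurable_fun_pair => //=.
exact: (measurableT_comp measurable_fst measurable_fst).
Qed.

(* The exponent p is twice the number d + 1 of kernels in the integrability assumption. *)
Variable d : nat.
Local Notation p := d.*2.+2.

(** What is left of the double sum of p-th powers once [cos_prod_le] has been applied. *)
Definition majorant N n x (t : p.-tuple mR) : R :=
  sgs (@Fejer R N) t 0 * \prod_(s <- t) (window s * dens n x s).

Lemma majorant_ge0 N n x t : 0 <= majorant N n x t.
Proof.
rewrite mulr_ge0//; first by apply: sgs_ge0 => z; exact: Fejer_ge0.
by apply: prodr_ge0 => s _; rewrite mulr_ge0 ?window_ge0 ?dens_ge0.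
Qed.

Lemma measurable_majorant N n :
  measurable_fun [set: Om * p.-tuple mR] (fun z => (majorant N n z.1 z.2)%:E).
Proof.
apply/measurable_EFinP; apply: measurable_funM; last exact: dens_prod_measurable.
apply: measurable_sgs => //; exact: measurable_Fejer.
Qed.

Lemma power_sum_le N n x :
  ((\sum_(i < N) \sum_(j < N) half_coef n x (freq R i j) ^+ p)%:E <=
   (#|{perm 'I_p}|%:R)%:E *
     \int[torus p]_t (cst_if R (sorted <=%R (t : seq R)) * (majorant N n x t)%:E))%E.
Proof.
have mM : measurable_fun setT (fun t : p.-tuple mR => (majorant N n x t)%:E).
  exact: (measurableT_comp (measurable_majorant N n) (measurable_pair1 x)).
apply: (le_trans _ (integral_sort mM _ _)); last 2 first.
- by move=> t; rewrite lee_fin majorant_ge0.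
- move=> s t; congr EFin; rewrite /majorant.
  have st : perm_eq (perm_tuple s t) t by apply/tuple_permP; exists s.
  by rewrite (sgs_perm _ _ st) (perm_big _ st).
have Hp i j := integral_torus_prod p (measurable_wave n x (@freq R N i j)) (wave_bound n x (@freq R N i j)).
have -> : ((\sum_(i < N) \sum_(j < N) half_coef n x (freq R i j) ^+ p)%:E =
    \int[torus p]_t (\sum_(i < N) \sum_(j < N) (\prod_(s <- t) wave n x (freq R i j) s)%:E))%E.
  rewrite integral_sum//; last first.
    by move=> i; apply: integrable_sum => // j _; have [_ []] := Hp i j.
  rewrite -sumEFin; apply: eq_bigr => i _.
  rewrite integral_sum//; last by move=> j; have [_ []] := Hp i j.
  by rewrite -sumEFin; apply: eq_bigr => j _; have [_ [_ ->]] := Hp i j.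
apply: le_integral_ge0 => //.
- by apply: emeasurable_sum => i; apply: emeasurable_sum => j; have [_ [/measurable_int]] := Hp i j.
- by move=> t; rewrite lee_fin majorant_ge0.
move=> t; under eq_bigr do rewrite sumEFin; rewrite sumEFin lee_fin /majorant.
have W0 : 0 <= \prod_(s <- t) (window s * dens n x s).
  by apply: prodr_ge0 => s _; rewrite mulr_ge0 ?window_ge0 ?dens_ge0.
have CL : \sum_(i < N) \sum_(j < N) \prod_(s <- t) cos (freq R i j * s - phi) <= sgs (@Fejer R N) t 0.
  rewrite tuple_headE /= add0r sub0r -[leLHS]addr0; apply: lerD; last first.
    by apply: sgs_ge0 => z; exact: Fejer_ge0.
  apply: (le_trans _ (cos_prod_le N phi (behead t) (thead t) phi)).
  by under eq_bigr do under eq_bigr do rewrite big_cons.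
apply: le_trans (ler_wpM2r W0 CL).
rewrite mulr_suml; apply: ler_sum => i _; rewrite mulr_suml; apply: ler_sum => j _.
by rewrite /wave big_split.
Qed.

Local Notation IK := (\int[lam]_t K t)%E.

Definition corr_const : R := expR ((p%:R * (1 - l 0%N)^-1 + 1/2) * S2).

Definition moment_const : \bar R :=
  ((#|{perm 'I_p}|%:R)%:E * (corr_const%:E *
     (2%:E * ((16%:E * IK) ^+ d * (2%:E * Kpow l d 0)))))%E.

(** [correlation_le] applies because the points are sorted and lie in a half circle. *)
Lemma mean_majorant_le N n (t : p.-tuple mR) : (cst_if R (sorted <=%R (t : seq R)) *
    \int[P]_x (majorant N n x t)%:E <=
  corr_const%:E * (cst_if R (a <= thead t < a + 1/2)%R * links l (a + 1/2) (thead t) [tuple of behead t] *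
    (sgs (@Fejer R N) t 0)%:E))%E.
Proof.
have F0 : 0 <= sgs (@Fejer R N) t 0 by apply: sgs_ge0 => z; exact: Fejer_ge0.
have RHS0 : (0 <= corr_const%:E * (cst_if R (a <= thead t < a + 1/2)%R *
    links l (a + 1/2) (thead t) [tuple of behead t] * (sgs (@Fejer R N) t 0)%:E))%E.
  by rewrite !mule_ge0 ?cst_if_ge0 ?links_ge0 ?lee_fin ?expR_ge0.
have [srt|_] := boolP (sorted <=%R (t : seq R)); last by rewrite mul0e.
have [win|nwin] := boolP (all (fun u => a <= u < a + 1/2) t); last first.
  rewrite (_ : (\int[P]_x _)%E = 0%E) ?mule0//.
  under eq_integral => x _.
    rewrite /majorant.
    have -> : \prod_(s <- t) (window s * dens n x s) = 0.
      have /allPn[s st ws] := nwin; rewrite (big_rem s)//= /window (negbTE ws).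
      by rewrite !mul0r.
    rewrite mulr0.
    over.
  exact: integral0.
rewrite mul1e.
have -> : (\int[P]_x (majorant N n x t)%:E = (sgs (@Fejer R N) t 0)%:E *
     \int[P]_x (\prod_(s <- t) dens n x s)%:E)%E.
  rewrite -ge0_integralZl//.
  - apply: eq_integral => x _; rewrite /majorant -EFinM; congr (_ * _)%:E.
    by apply: eq_big_seq => s st; rewrite /window (allP win s st) mul1r.
  - apply/measurable_EFinP.
    apply: (@measurable_tprod _ _ _ _ (fun=> t) (fun x s => dens n x s)) => //.
    exact: measurable_dens.
  - by move=> x _; rewrite lee_fin; apply: prodr_ge0 => s _; exact: dens_ge0.
rewrite muleC muleA; apply: lee_wpmul2r; first by rewrite lee_fin.
have tE := tuple_headE t.
have := link_prod_links l a (a + 1/2) (thead t) [tuple of behead t].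
rewrite -tE.
have -> : sorted <=%R (t : seq R) && all (fun u => a <= u < a + 1/2) t by rewrite srt win.
rewrite mul1e => LL.
have srt' := srt; have win' := win; rewrite tE in srt' win'.
have := correlation_le l01 lanti lS2 indep unif n srt' win'.
rewrite -tE (size_tuple t) -/corr_const => CC; apply: (le_trans CC).
by apply: lee_wpmul2l => //; rewrite lee_fin expR_ge0.
Qed.

(** Of the N^2 terms of the double sum only an order of N survives in the mean, since the
    Fejer kernel has integral N: after d + 1 convolutions with K it is bounded by this integral
    times the supremum of a convolution power. *)
Lemma moment_le N n :
  (\int[P]_x (\sum_(i < N) \sum_(j < N) half_coef n x (freq R i j) ^+ p)%:E <=
   moment_const * N%:R%:E)%E.
Proof.
have mS : measurable_fun setT (fun t : p.-tuple mR => cst_if R (sorted <=%R (t : seq R))).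
  by apply: measurable_cst_if; exact: (@measurable_sorted _ _ _ p id).
pose G (z : Om * p.-tuple mR) := (cst_if R (sorted <=%R (z.2 : seq R)) * (majorant N n z.1 z.2)%:E)%E.
have mG : measurable_fun setT G.
  apply: emeasurable_funM; last exact: measurable_majorant.
  exact: (measurableT_comp mS measurable_snd).
have G0 z : (0 <= G z)%E by rewrite mule_ge0 ?cst_if_ge0// lee_fin majorant_ge0.
have mGx : measurable_fun setT (fun x => \int[torus p]_t G (x, t))%E.
  exact: measurable_fun_fubini_tonelli_F.
apply: (@le_trans _ _ (\int[P]_x ((#|{perm 'I_p}|%:R)%:E * \int[torus p]_t G (x, t)))%E).
  apply: le_integral_ge0.
  - apply/measurable_EFinP; apply: measurable_sum => i; apply: measurable_sum => j.
    by apply: measurable_funX; exact: measurable_half_coef.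
  - by apply: emeasurable_funM.
  - by move=> x; rewrite mule_ge0 ?lee_fin//; apply: integral_ge0.
  - by move=> x; exact: power_sum_le.
rewrite ge0_integralZl//; try (by move=> x _; apply: integral_ge0).
rewrite /moment_const -muleA; apply: lee_wpmul2l; first by rewrite lee_fin.
rewrite fubini_tonelli//.
have K0 := K_ge0 l.
have IK0 : (0 <= IK)%E by apply: integral_ge0.
have Kp0 : (0 <= Kpow l d 0)%E by apply: le_trans (Kpow_ge1 l d 0).
set B := (Kpow l d 0 * N%:R%:E)%E.
have B0 : (0 <= B)%E by rewrite mule_ge0 ?lee_fin.
have cF := circle_fun_Fejer R N.
have chB : forall z, (iter d.+1 (conv K) (EFin \o @Fejer R N) z <= B)%E.
  by move=> z; rewrite /B -integral_Fejer; exact: iter_conv_le.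
have CL := chain_le a0 (erefl (a + 1/2)) B0 cF chB.
pose U (t : p.-tuple mR) := (cst_if R (a <= thead t < a + 1/2)%R *
  links l (a + 1/2) (thead t) [tuple of behead t] * (sgs (@Fejer R N) t 0)%:E)%E.
have mid : measurable_fun [set: p.-tuple mR] (@id (p.-tuple mR)) by [].
have mh := measurable_tuple_head mid; have mt := measurable_tuple_tail mid.
have mU : measurable_fun setT U.
  apply: emeasurable_funM.
    apply: emeasurable_funM; last exact: measurable_links.
    apply: measurable_cst_if; apply: measurable_and.
      exact: measurable_fun_ler.
    exact: measurable_fun_ltr.
  apply/measurable_EFinP; apply: measurable_sgs => //; exact: measurable_Fejer.
have U0 t : (0 <= U t)%E.
  by rewrite !mule_ge0 ?cst_if_ge0 ?links_ge0// lee_fin; apply: sgs_ge0 => z; exact: Fejer_ge0.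
apply: (@le_trans _ _ (\int[torus p]_t (corr_const%:E * U t))%E).
  apply: ge0_le_integral => //.
  - by move=> t _; apply: integral_ge0.
  - exact: measurable_fun_fubini_tonelli_G.
  - exact: emeasurable_funM.
  move=> t _; apply: le_trans (mean_majorant_le N n t).
  rewrite -ge0_integralZl//; try by move=> x _; rewrite lee_fin majorant_ge0.
    exact: (measurableT_comp (measurable_majorant N n) (measurable_pair2 t)).
  exact: cst_if_ge0.
rewrite ge0_integralZl//; last by rewrite lee_fin expR_ge0.
rewrite -muleA; apply: lee_wpmul2l; first by rewrite lee_fin expR_ge0.
rewrite integral_torus_cons//.
set Q := (_ * N%:R%:E)%E.
apply: (@le_trans _ _ (\int[lam]_t Q)%E); last first.
  by rewrite (integral_cst_probability lam).
have mch y : measurable_fun setT (fun s : d.*2.+1.-tuple mR => (sgs (@Fejer R N) s y)%:E).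
  by apply/measurable_EFinP; apply: (@measurable_sgs _ _ _ _ _ id) => //; exact: measurable_Fejer.
have Q0 : (0 <= Q)%E by rewrite !mule_ge0 ?expe_ge0 ?mule_ge0 ?lee_fin.
apply: ge0_le_integral => //.
- by move=> t _; apply: integral_ge0.
- have mUc : measurable_fun setT (fun z : mR * d.*2.+1.-tuple mR => U (tuple_cons z)).
    exact: (measurableT_comp mU (@measurable_tuple_cons R d.*2.+1)).
  have Uc0 z : (0 <= U (@tuple_cons R d.*2.+1 z))%E by exact: U0.
  exact: (measurable_fun_fubini_tonelli_F _ mUc).
move=> t _.
rewrite /U.
under eq_integral => s _.
  rewrite theadE (_ : [tuple of behead (tuple_cons (t, s))] = s); last exact/val_inj.
  rewrite /= add0r sub0r EFinD.
  over.
rewrite /cst_if; case: ifP => at_; last first.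
  by under eq_integral do rewrite !mul0e; rewrite integral0.
have a_t : a <= t by case/andP: at_.
under eq_integral => s _.
  rewrite mul1e ge0_muleDr ?lee_fin ?sgs_ge0//; try by move=> z; exact: Fejer_ge0.
  over.
have mL : measurable_fun setT (fun s : d.*2.+1.-tuple mR => links l (a + 1/2) t s) by exact: measurable_links.
rewrite ge0_integralD//; try (by move=> s _; rewrite mule_ge0 ?links_ge0// lee_fin sgs_ge0// => z; exact: Fejer_ge0);
  try by apply: emeasurable_funM.
rewrite !chain_torus//; try (exact: measurable_Fejer); try (exact: Fejer_ge0).
apply: le_trans (leeD (CL _ _ a_t) (CL _ _ a_t)) _.
rewrite /Q /B; set V := ((16%:E * IK) ^+ d)%E.
have V0 : (0 <= V)%E by rewrite expe_ge0// mule_ge0.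
rewrite -!muleA; set W := (V * _)%E.
rewrite (_ : 2%:E = 1%E + 1%E)%E; last by rewrite -EFinD.
rewrite ge0_muleDl//  ?mul1e//.
Qed.

End moment.

(** * From moments to almost sure decay *)

Section rajchman_tools.
Variable R : realType.
Local Notation mR := (measurableTypeR R).
Local Notation lam := (@circle_lebesgue R).

Lemma ae_circle : {ae lam, forall t, @circle R t}.
Proof.
exists (~` @circle R); split.
- by apply: measurableC; exact: measurable_circle.
- by rewrite /circle_lebesgue /mrestr/= setIC setICr measure0.
- by move=> t.
Qed.

Lemma eq_integral_circle (f g : mR -> \bar R) :
  measurable_fun setT f -> measurable_fun setT g ->
  (forall t, @circle R t -> f t = g t) -> (\int[lam]_t f t = \int[lam]_t g t)%E.
Proof.
move=> mf mg fg; apply: ae_eq_integral => //.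
by apply: filterS ae_circle => t /fg + _.
Qed.

Lemma even_power_cvg0 (u : nat -> R) p : (0 < p)%N -> ~~ odd p ->
  u n ^+ p @[n --> \oo] --> (0 : R) -> u n @[n --> \oo] --> (0 : R).
Proof.
move=> p0 ep /cvgrPdist_lt H; apply/cvgrPdist_lt => e e0.
have := H (e ^+ p) (exprn_gt0 _ e0); apply: filterS => n.
by rewrite !sub0r !normrN normrX ltr_pXn2r// nnegrE ltW.
Qed.

(** By Fatou's lemma the series of the limits has a finite mean. *)
Lemma ae_cvg0_of_mean (dd : measure_display) (Om : measurableType dd) (P : probability Om R)
   (A : nat -> nat -> Om -> R) (L : nat -> Om -> R) (C : R) :
  (forall n k, measurable_fun setT (A n k : Om -> mR)) -> (forall n k x, 0 <= A n k x) ->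
  (forall n, (\int[P]_x (\sum_(k < n) A n k x)%:E <= C%:E)%E) ->
  {ae P, forall x, forall k, A n k x @[n --> \oo] --> L k x} ->
  {ae P, forall x, L k x @[k --> \oo] --> (0 : R)}.
Proof.
move=> mA A0 AC AL.
pose G n (x : Om) : \bar R := (\sum_(k < n) A n k x)%:E.
have mG n : measurable_fun setT (G n).
  have mS : measurable_fun setT (fun x => \sum_(k < n) A n k x : mR) by apply: measurable_sum => k; exact: mA.
  exact/measurable_EFinP.
have G0 n x : (0 <= G n x)%E by rewrite lee_fin; exact: sumr_ge0.
have mL : measurable_fun setT (fun x => limn_einf (G^~ x)).
  by apply: (emeasurable_fun_cvg (fun n x => einfs (G^~ x) n)) => [n|x _]; [exact: measurable_fun_einfs|rewrite limn_einf_lim; exact: is_cvg_einfs].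
have L0 x : (0 <= limn_einf (G^~ x))%E.
  by rewrite limn_einf_lim; apply: lime_ge; [exact: is_cvg_einfs|apply: nearW => n; apply: le_ereal_inf_tmp => _ [k _ <-]].
have intL : (\int[P]_x limn_einf (G^~ x) <= C%:E)%E.
  apply: le_trans (fatou _ _ _ _) _ => //.
  rewrite limn_einf_lim; apply: lime_le; first exact: is_cvg_einfs.
  by apply: nearW => n; apply: le_trans (AC n); apply: ereal_inf_lbound; exists n => /=.
have iL : P.-integrable setT (fun x => limn_einf (G^~ x)).
  apply/integrableP; split => //; rewrite (eq_integral (fun x => limn_einf (G^~ x))).
    by apply: le_lt_trans intL _; rewrite ltry.
  by move=> x _; rewrite gee0_abs.
have := integrable_ae measurableT iL; apply: filterS2 AL => x AL /(_ I) fL.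
have L0' k : 0 <= L k x by apply: (cvgr_to_ge (AL k)); exact: nearW.
have bound M : \sum_(k < M) L k x <= fine (limn_einf (G^~ x)).
  rewrite -lee_fin fineK//; apply/lee_addgt0Pr => e e0; rewrite -lee_subel_addr//.
  have : \sum_(k < M) A n k x @[n --> \oo] --> \sum_(k < M) L k x.
    elim: M => [|m IH]; first by under eq_fun do rewrite big_ord0; rewrite big_ord0; exact: cvg_cst.
    under eq_fun do rewrite big_ord_recr/=; rewrite big_ord_recr/=.
    by apply: cvgD => //; exact: AL.
  move=> /cvgrPdist_le/(_ e e0)[n0 _ H].
  apply: (@le_trans _ _ (einfs (G^~ x) (maxn n0 M))); last first.
    by rewrite limn_einf_lim; apply: lime_ge; [exact: is_cvg_einfs|exists (maxn n0 M) => // m; exact: nondecreasing_einfs].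
  apply: le_ereal_inf_tmp => _ [n /= nn <-].
  have n0n : (n0 <= n)%N by apply: leq_trans nn; exact: leq_maxl.
  have Mn : (M <= n)%N by apply: leq_trans nn; exact: leq_maxr.
  rewrite -EFinB lee_fin; have := H _ n0n; rewrite ler_distl => /andP[_].
  have : \sum_(k < M) A n k x <= \sum_(k < n) A n k x.
    rewrite -(subnKC Mn) big_split_ord/= lerDl; exact: sumr_ge0.
  lra.
apply: cvg_series_cvg_0; apply: nondecreasing_is_cvgn.
  by apply/nondecreasing_seqP => n; rewrite !seriesEnat/= big_nat_recr//= lerDl.
by exists (fine (limn_einf (G^~ x))) => _ [n _ <-]; rewrite seriesEnat/= big_mkord.
Qed.

Lemma expr_add_even_le (x y : R) p : ~~ odd p -> (x + y) ^+ p <= 2 ^+ p * (x ^+ p + y ^+ p).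
Proof.
move=> ep; have xp (z : R) : z ^+ p = `|z| ^+ p by rewrite -normrX ger0_norm// exprn_even_ge0.
rewrite (xp (x + y)) (xp x) (xp y).
wlog xy : x y / `|x| <= `|y|.
  by move=> H; have [/H//|/ltW/H] := leP `|x| `|y|; rewrite addrC [X in _ * X]addrC.
apply: (@le_trans _ _ ((2 * `|y|) ^+ p)).
  apply: lerXn2r; rewrite ?nnegrE ?mulr_ge0//.
  by apply: le_trans (ler_normD _ _) _; lra.
by rewrite exprMn ler_wpM2l ?exprn_ge0// lerDr exprn_ge0.
Qed.

(** Every k < M is the difference of at least M pairs of indices below 2M. *)
Lemma diagonal_sum_le (f : nat -> nat -> R) (g : nat -> R) M :
  (forall i j, 0 <= f i j) -> (forall k j, f (j + k)%N j = g k) ->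
  M%:R * \sum_(k < M) g k <= \sum_(i < M.*2) \sum_(j < M.*2) f i j.
Proof.
move=> f0 fg; rewrite exchange_big/= -addnn big_split_ord/= -[leLHS]addr0; apply: lerD; last first.
  by apply: sumr_ge0 => i _; exact: sumr_ge0.
rewrite mulr_natl (_ : (\sum_(k < M) g k) *+ M = \sum_(j < M) \sum_(k < M) g k); last first.
  by rewrite sumr_const card_ord.
apply: ler_sum => j _.
rewrite -(big_mkord xpredT (fun i => f i j)) (@big_cat_nat _ _ _ j)//=; last first.
  by rewrite ltnW// (leq_trans (ltn_ord j))// leq_addr.
rewrite (@big_cat_nat _ _ _ (j + M) j)/=; [|exact: leq_addr|by rewrite leq_add2r ltnW].
rewrite addrCA -[leLHS]addr0; apply: lerD; last by rewrite addr_ge0// sumr_ge0.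
rewrite -{1}[j : nat]add0n [(j + M)%N]addnC big_addn addnK big_mkord.
by apply: ler_sum => k _; rewrite addnC fg.
Qed.

End rajchman_tools.

Section shepp.
Variables (R : realType) (l : nat -> R).
Hypothesis l01 : forall n, 0 < l n < 1.
Hypothesis lanti : {homo l : m n / (m <= n)%N >-> n <= m}.
Hypothesis lcvg0 : l @ \oo --> (0 : R).
Hypothesis lshepp : (\sum_(0 <= n <oo)
       ((l n - l n.+1) * expR (\sum_(k < n.+1) l k))%:E < +oo)%E.

(** With S_n = l 0 + ... + l n, telescoping Shepp's series gives l n <= C exp (- S_n).  Then
    l n ^ 2 is at most the increment from n - 1 to n of - C exp (- S_n), and
    these increments add up to at most C. *)
Lemma square_sum_bounded : exists S2 : R, forall n, \sum_(k < n) l k ^+ 2 <= S2.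
Proof.
pose u n := (l n - l n.+1) * expR (\sum_(k < n.+1) l k).
have u0 n : 0 <= u n by rewrite mulr_ge0 ?expR_ge0// subr_ge0 lanti.
set C := fine (\sum_(0 <= n <oo) (u n)%:E)%E.
have uC n : \sum_(k < n) u k <= C.
  rewrite -lee_fin fineK; last first.
    by rewrite ge0_fin_numE//; apply: nneseries_ge0 => k _ _; rewrite lee_fin.
  by rewrite -sumEFin -(big_mkord xpredT (fun k => (u k)%:E)); apply: nneseries_lim_ge => k _ _; rewrite lee_fin.
have lC n : l n * expR (\sum_(k < n.+1) l k) <= C.
  set E := expR _.
  have H m : (n <= m)%N -> (l n - l m) * E <= C.
    move=> nm; apply: le_trans (uC m).
    rewrite -(subnKC nm) big_split_ord/= -[leLHS]add0r lerD ?sumr_ge0//.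
    elim: (m - n)%N => [|j IH]; first by rewrite addn0 subrr mul0r big_ord0.
    rewrite big_ord_recr/= addnS.
    have -> : (l n - l (n + j).+1) * E = (l n - l (n + j)%N) * E + (l (n + j)%N - l (n + j).+1) * E by ring.
    apply: lerD => //; apply: ler_wpM2l; first by rewrite subr_ge0 lanti.
    rewrite ler_expR -addSn big_split_ord/= lerDl.
    by apply: sumr_ge0 => i _; have /andP[/ltW] := l01 (n.+1 + i).
  have : (l n - l m) * E @[m --> \oo] --> (l n - 0) * E.
    by apply: cvgMl; apply: cvgB => //; exact: cvg_cst.
  rewrite subr0 => Hcv; apply: (cvgr_to_le Hcv).
  by exists n => // m /= nm; exact: H.
exists C => n.
have C0 : 0 <= C by have := uC 0%N; rewrite big_ord0.
suff : \sum_(k < n) l k ^+ 2 <= C * (1 - expR (- \sum_(k < n) l k)).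
  move=> /le_trans; apply; rewrite -[leRHS]mulr1 ler_wpM2l// gerBl; exact: expR_ge0.
elim: n => [|n IH]; first by rewrite !big_ord0 oppr0 expR0 subrr mulr0.
rewrite big_ord_recr/=.
have := lC n; rewrite !big_ord_recr/= opprD !expRD expRN.
set e := expR (\sum_(k < n) l k); move: IH; rewrite expRN -/e.
have e0 : 0 < e by exact: expR_gt0.
have := expR_ge1Dx (l n); rewrite expRN.
have E0 : 0 < expR (l n) by exact: expR_gt0.
have /andP[p0 _] := l01 n.
move: (l n) (expR (l n)) (\sum_(k < n) _) p0 E0 => x E S x0 E0 E1 IH H.
suff : x ^+ 2 <= C * (e^-1 - e^-1 * E^-1) by lra.
have -> : C * (e^-1 - e^-1 * E^-1) = C * (E - 1) / (e * E) by field; rewrite !gt_eqF.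
rewrite ler_pdivlMr ?mulr_gt0//.
have : x * (e * E) * x <= C * (E - 1) by apply: ler_pM => //; [rewrite !mulr_ge0// ltW|exact: ltW|lra].
lra.
Qed.

End shepp.

(** * The Dvoretzky measure is Rajchman *)

Section rajchman_ae.
Variable R : realType.
Local Notation mR := (measurableTypeR R).
Local Notation lam := (@circle_lebesgue R).
Local Notation torus n := (torus_lebesgue R n).
Variable l : nat -> R.
Hypothesis l01 : forall n, 0 < l n < 1.
Hypothesis lanti : {homo l : m n / (m <= n)%N >-> n <= m}.
Variable S2 : R.
Hypothesis lS2 : forall n, \sum_(k < n) l k ^+ 2 <= S2.
Local Notation K := (covering_kernel l).
Context (dd : measure_display) (Om : measurableType dd) (P : probability Om R).
Variable omega : nat -> {RV P >-> R}.
Hypothesis indep : mutually_independent omega.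
Hypothesis unif : forall n, circle_uniform (omega n).
Variable d : nat.
Hypothesis d1 : (1 <= d)%N.
Hypothesis K_int : (\int[torus d]_t
          ((\prod_(i < d) covering_kernel l (tnth t i)) *
           covering_kernel l (- \sum_(i < d) tnth t i)%R) < +oo)%E.

Local Notation p := d.*2.+2.

Lemma moment_const_fin : moment_const l S2 d \is a fin_num.
Proof.
have Kd : (Kpow l d 0 < +oo)%E.
  by rewrite -Kpow_torus; under eq_integral do rewrite sub0r.
have Kf : Kpow l d 0 \is a fin_num.
  by rewrite ge0_fin_numE//; exact: le_trans (Kpow_ge1 l d 0).
have If : (\int[lam]_t K t)%E \is a fin_num.
  rewrite ge0_fin_numE; last by apply: integral_ge0 => t _; exact: K_ge0.
  by apply: le_lt_trans Kd; case: d d1 => // e _; exact: Kpow_integral.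
by rewrite /moment_const !fin_numM// fin_numX// fin_numM.
Qed.

Let C := fine (moment_const l S2 d).

Section one_phase.
Variable phi : R.

Definition coef n x (c : R) : R := \int[lam]_t (cos (c * t - phi) * dens l omega n x t).

Lemma coefE n x c : coef n x c =
  half_coef l omega 0 phi n x c + half_coef l omega (1/2) phi n x c.
Proof.
have H a := @integral_torus_prod R _ _ 0 (measurable_wave l omega a phi n x c) (wave_bound l01 omega a phi n x c).
rewrite /half_coef -RintegralD//; [|exact: (H 0).1|exact: (H (1/2)).1].
rewrite /coef /Rintegral; congr fine; apply: eq_integral_circle.
- apply/measurable_EFinP; apply: measurable_funM; first exact: measurable_cos_lin.
  exact: (measurableT_comp (measurable_dens l omega n) (measurable_pair1 x)).
- by apply/measurable_EFinP; apply: measurable_funD; exact: measurable_wave.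
move=> t; rewrite /circle /= in_itv/= => /andP[t0 t1]; congr EFin.
rewrite /wave -mulrDr; congr (_ * _); rewrite -mulrDl -[LHS]mul1r; congr (_ * _).
rewrite /window; case: ifP => h1; case: ifP => h2; lra.
Qed.

(** The bound of [moment_le] for 2M frequencies, read along the diagonals i - j = k, is
    divided by M. *)
Lemma half_moment (a : R) M n : 0 <= a ->
  (\int[P]_x (\sum_(k < M) half_coef l omega a phi n x (2 * pi * k%:R) ^+ p)%:E <= (C * 2)%:E)%E.
Proof.
move=> a0.
have pe : ~~ odd p by rewrite /= odd_double.
have C0 : 0 <= C.
  by apply: fine_ge0; rewrite /moment_const !mule_ge0 ?lee_fin ?expR_ge0// ?expe_ge0 ?mule_ge0 ?integral_ge0// => *; rewrite ?K_ge0//; exact: le_trans (Kpow_ge1 l d 0).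
have mh c : measurable_fun [set: Om] (fun x => half_coef l omega a phi n x c ^+ p : mR).
  by apply: measurable_funX; exact: measurable_half_coef.
case: M => [|M].
  under eq_integral do rewrite big_ord0.
  by rewrite integral0 lee_fin mulr_ge0.
have M0 : (0 < M.+1%:R :> R) by rewrite ltr0n.
rewrite -(@lee_pmul2l _ M.+1%:R%:E)//.
apply: (@le_trans _ _ (moment_const l S2 d * (M.+1.*2)%:R%:E)%E); last first.
  rewrite -(fineK moment_const_fin) -/C -!EFinM lee_fin -mul2n natrM; lra.
apply: le_trans (moment_le l01 lanti lS2 indep unif phi a0 d _ n).
rewrite -ge0_integralZl//.
- apply: le_integral_ge0.
  + apply: emeasurable_funM => //; apply/measurable_EFinP.
    by apply: measurable_sum => k; exact: mh.
  + by apply/measurable_EFinP; apply: measurable_sum => i; apply: measurable_sum => j; exact: mh.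
  + by move=> x; rewrite lee_fin; apply: sumr_ge0 => i _; apply: sumr_ge0 => j _; exact: exprn_even_ge0.
  move=> x; rewrite -EFinM lee_fin.
  pose f (i j : nat) := half_coef l omega a phi n x (2 * pi * (i%:R - j%:R)) ^+ p.
  apply: (@diagonal_sum_le _ f (fun k => half_coef l omega a phi n x (2 * pi * k%:R) ^+ p)).
    by move=> i j; exact: exprn_even_ge0.
  by move=> k j; rewrite /f natrD addrAC subrr add0r.
- by apply/measurable_EFinP; apply: measurable_sum => k; exact: mh.
- by move=> x _; rewrite lee_fin; apply: sumr_ge0 => i _; exact: exprn_even_ge0.
Qed.

Lemma coef_moment n :
  (\int[P]_x (\sum_(k < n) coef n x (2 * pi * k%:R) ^+ p)%:E <= (2 ^+ p * (C * 2 + C * 2))%:E)%E.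
Proof.
have pe : ~~ odd p by rewrite /= odd_double.
have mh a : measurable_fun [set: Om] (fun x => \sum_(k < n) half_coef l omega a phi n x (2 * pi * k%:R) ^+ p : mR).
  by apply: measurable_sum => k; apply: measurable_funX; exact: measurable_half_coef.
have h0 a x : (0 <= (\sum_(k < n) half_coef l omega a phi n x (2 * pi * k%:R) ^+ p)%:E)%E.
  by rewrite lee_fin; apply: sumr_ge0 => i _; exact: exprn_even_ge0.
have H0 := half_moment n n (lexx 0); have H1 := half_moment n n (divr_ge0 ler01 (ler0n R 2)).
apply: (@le_trans _ _ (\int[P]_x ((2 ^+ p)%:E * ((\sum_(k < n) half_coef l omega 0 phi n x (2 * pi * k%:R) ^+ p)%:E
    + (\sum_(k < n) half_coef l omega (1/2) phi n x (2 * pi * k%:R) ^+ p)%:E)))%E).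
  apply: le_integral_ge0.
  - apply/measurable_EFinP; apply: measurable_sum => k; apply: measurable_funX.
    under eq_fun do rewrite coefE; apply: measurable_funD; exact: measurable_half_coef.
  - apply: emeasurable_funM => //; apply: emeasurable_funD; apply/measurable_EFinP; exact: mh.
  - by move=> x; rewrite mule_ge0 ?adde_ge0// lee_fin exprn_ge0.
  move=> x; rewrite -EFinD -EFinM lee_fin -big_split/= mulr_sumr; apply: ler_sum => k _.
  by rewrite coefE; exact: expr_add_even_le.
rewrite ge0_integralZl//; try (by move=> x _; rewrite adde_ge0); try (by rewrite lee_fin exprn_ge0);
  try by (apply: emeasurable_funD; apply/measurable_EFinP; exact: mh).
rewrite [leRHS]EFinM; apply: lee_wpmul2l; first by rewrite lee_fin exprn_ge0.
rewrite ge0_integralD//; try by apply/measurable_EFinP; exact: mh.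
exact: (leeD H0 H1).
Qed.

Lemma continuous_cos_lin (c e : R) : continuous (fun t : R => cos (c * t - e)).
Proof.
move=> t; apply: (@continuous_comp _ _ _ (fun t => c * t - e) (@cos R)); last exact: continuous_cos.
by apply: cvgB; [apply: cvgMr; exact: cvg_id|exact: cvg_cst].
Qed.

Lemma cos_lin_periodic (k : nat) (t : R) : cos (2 * pi * k%:R * (t + 1) - phi) = cos (2 * pi * k%:R * t - phi).
Proof.
by rewrite -[RHS](cosD_period k); congr cos; ring.
Qed.

Variable muD : Om -> {finite_measure set mR -> \bar R}.
Hypothesis muD_limit : {ae P, forall x, is_dvoretzky_measure l (omega^~ x) (muD x)}.

Lemma ae_coef_cvg0 :
  {ae P, forall x, \int[muD x]_t cos (2 * pi * k%:R * t - phi) @[k --> \oo] --> (0 : R)}.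
Proof.
have pe : ~~ odd p by rewrite /= odd_double.
have H : {ae P, forall x, (\int[muD x]_t cos (2 * pi * k%:R * t - phi)) ^+ p @[k --> \oo] --> (0 : R)}.
  apply: (@ae_cvg0_of_mean R _ _ P (fun n k x => coef n x (2 * pi * k%:R) ^+ p)
    (fun k x => (\int[muD x]_t cos (2 * pi * k%:R * t - phi)) ^+ p) _ _ _ coef_moment).
  - move=> n k; apply: measurable_funX.
    under eq_fun do rewrite coefE; apply: measurable_funD; exact: measurable_half_coef.
  - by move=> n k x; exact: exprn_even_ge0.
  apply: filterS muD_limit => x [_ Hx] k.
  have Hk := Hx _ (@continuous_cos_lin (2 * pi * k%:R) phi) (cos_lin_periodic k).
  exact: (cvg_comp _ _ Hk (@exprn_continuous _ p _)).
by apply: filterS H => x; apply: even_power_cvg0.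
Qed.

End one_phase.

Variable muD : Om -> {finite_measure set mR -> \bar R}.
Hypothesis muD_limit : {ae P, forall x, is_dvoretzky_measure l (omega^~ x) (muD x)}.

Lemma ae_rajchman : {ae P, forall x, rajchman (muD x)}.
Proof.
have H0 := ae_coef_cvg0 0 muD_limit; have H1 := ae_coef_cvg0 (pi / 2) muD_limit.
apply: filterS2 H0 H1 => x H0 H1.
pose co (k : nat) := \int[muD x]_t cos (2 * pi * k%:R * t).
pose si (k : nat) := \int[muD x]_t sin (2 * pi * k%:R * t).
have Hc : co k @[k --> \oo] --> (0 : R).
  apply: cvg_trans H0; apply: near_eq_cvg; near=> k.
  by apply: eq_Rintegral => t _; rewrite subr0.
have Hs : si k @[k --> \oo] --> (0 : R).
  apply: cvg_trans H1; apply: near_eq_cvg; near=> k.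
  by apply: eq_Rintegral => t _; rewrite cosBpihalf.
have N : Num.sqrt (co k ^+ 2 + si k ^+ 2) @[k --> \oo] --> (0 : R).
  rewrite -[X in _ --> X]sqrtr0; apply: continuous_cvg; first exact: sqrt_continuous.
  rewrite (_ : 0 = 0 * 0 + 0 * 0 :> R); last by rewrite mul0r addr0.
  under eq_fun do rewrite !expr2.
  by apply: cvgD; exact: cvgM.
have normE (n : int) k : n%:~R = k%:R :> R \/ n%:~R = - k%:R :> R ->
    ComplexField.Normc.normc (fourier_coef (muD x) n) = Num.sqrt (co k ^+ 2 + si k ^+ 2).
  rewrite /fourier_coef /= => -[] ->; first by rewrite sqrrN.
  congr (Num.sqrt (_ ^+ 2 + _)).
    by apply: eq_Rintegral => t _; rewrite -cosN; congr cos; ring.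
  rewrite sqrrN.
  have -> : \int[muD x]_t sin (2 * pi * - k%:R * t) = \int[muD x]_t (- sin (2 * pi * k%:R * t)).
    by apply: eq_Rintegral => t _; rewrite -sinN; congr sin; ring.
  have is_ : (muD x).-integrable setT (EFin \o (fun t : mR => sin (2 * pi * k%:R * t))).
    apply: measurable_bounded_integrable => //.
    - by rewrite ltey_eq fin_num_measure.
    - under eq_fun do rewrite -cosBpihalf; exact: measurable_cos_lin.
    exists 1; split; [exact: num_real|move=> y y1 t _; apply: le_trans (ltW y1)].
    by rewrite ler_norml sin_geN1 sin_le1.
  under eq_Rintegral do rewrite -mulN1r.
  by rewrite RintegralZl// mulN1r sqrrN.
split; (apply: cvg_trans N; apply: near_eq_cvg; near=> k).
  by rewrite (normE _ k)//; left.
by rewrite (normE _ k)//; right; rewrite mulrNz.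
Unshelve. all: by end_near.
Qed.

End rajchman_ae.

(** * Resampling one arc at a time *)

Section hybrid.
Variable R : realType.
Local Notation mR := (measurableTypeR R).
Local Notation lam := (@circle_lebesgue R).
Local Notation torus n := (torus_lebesgue R n).
Local Notation cst_if := (@cst_if R).
Variable m : nat.
Local Notation tup := (m.-tuple mR).
Implicit Types (w : tup) (j : 'I_m).

Lemma tnth_upd w j y i : tnth (upd w j y) i = if i == j then y else tnth w i.
Proof. by rewrite tnth_mktuple. Qed.

Lemma upd_upd w j y z : upd (upd w j y) j z = upd w j z.
Proof.
by apply: eq_from_tnth => i; rewrite !tnth_upd; case: eqP.
Qed.

Variable right : mR -> mR -> bool.
Hypothesis mright : measurable_fun [set: mR * mR] (fun z => right z.1 z.2).
Variable tau : tup -> mR.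
Hypothesis mtau : measurable_fun setT tau.

(** As long as arc j starts to the right of tau, F does not depend on where it starts. *)
Definition inert (F : tup -> \bar R) j :=
  forall w y, right (tau w) (tnth w j) -> right (tau w) y -> F (upd w j y) = F w.

(** When arc j is resampled to the right of tau, F is constant, so that only the means of the
    two factors over these positions matter there; elsewhere they are compared pointwise. *)
Lemma integral_swap_factor (F : tup -> \bar R) j (g h : mR -> mR -> \bar R) :
  measurable_fun setT F -> (forall w, 0 <= F w)%E -> inert F j ->
  (forall w y, tau (upd w j y) = tau w) ->
  measurable_fun [set: mR * mR] (fun z => g z.1 z.2) -> (forall t y, 0 <= g t y)%E ->
  measurable_fun [set: mR * mR] (fun z => h z.1 z.2) -> (forall t y, 0 <= h t y)%E ->
  (forall t y, ~~ right t y -> (g t y <= h t y)%E) ->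
  (forall w, F w != 0%E -> (\int[lam]_y (cst_if (right (tau w) y) * g (tau w) y) <=
                         \int[lam]_y (cst_if (right (tau w) y) * h (tau w) y))%E) ->
  (\int[torus m]_w (F w * g (tau w) (tnth w j)) <= \int[torus m]_w (F w * h (tau w) (tnth w j)))%E.
Proof.
move=> mF F0 iF tj mg g0 mh h0 gh IG.
have mF2 (f : mR -> mR -> \bar R) : measurable_fun [set: mR * mR] (fun z => f z.1 z.2) ->
    measurable_fun setT (fun w => F w * f (tau w) (tnth w j))%E.
  move=> mf; apply: emeasurable_funM => //.
  apply: (measurableT_comp mf (g := fun w : tup => (tau w, tnth w j : mR))).
  by apply/measurable_fun_pair => //; exact: measurable_tnth.
have mu w : measurable_fun [set: mR] (upd w j).
  exact: (measurableT_comp (@measurable_upd R m j) (measurable_pair1 w)).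
have mf1 (f : mR -> mR -> \bar R) t : measurable_fun [set: mR * mR] (fun z => f z.1 z.2) ->
  measurable_fun setT (f t).
  by move=> mf; exact: (measurableT_comp mf (measurable_pair1 t)).
have mr t : measurable_fun [set: mR] (fun y => cst_if (right t y)).
  apply: measurable_cst_if; exact: (measurableT_comp mright (measurable_pair1 t)).
have mr' t : measurable_fun [set: mR] (fun y => cst_if (~~ right t y)).
  apply: measurable_cst_if; apply: measurable_neg; exact: (measurableT_comp mright (measurable_pair1 t)).
rewrite -(integral_resample j (mF2 g mg)); last by move=> w; rewrite mule_ge0.
rewrite -(integral_resample j (mF2 h mh)); last by move=> w; rewrite mule_ge0.
have mG (f : mR -> mR -> \bar R) : measurable_fun [set: mR * mR] (fun z => f z.1 z.2) ->
   (forall t y, 0 <= f t y)%E ->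
   measurable_fun setT (fun w => \int[lam]_y (F (upd w j y) * f (tau (upd w j y)) (tnth (upd w j y) j)))%E.
  move=> mf f0.
  have m2 := measurableT_comp (mF2 f mf) (@measurable_upd R m j).
  by apply: (measurable_fun_fubini_tonelli_F _ m2) => z; rewrite /= mule_ge0.
apply: ge0_le_integral => //; try exact: (mG _ mg g0); try exact: (mG _ mh h0);
  try by move=> w _; apply: integral_ge0 => y _; rewrite mule_ge0.
move=> w _.
set t := tau w.
under eq_integral do rewrite tj tnth_upd eqxx.
under [leRHS]eq_integral do rewrite tj tnth_upd eqxx.
have mFu : measurable_fun [set: mR] (fun y => F (upd w j y)) by exact: measurableT_comp.
have [[y0 r0]|nr] := pselect (exists y, right t y); last first.
  have lr y : ~~ right t y by apply/negP => ry; apply: nr; exists y.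
  apply: ge0_le_integral => //; try (by move=> y _; rewrite mule_ge0);
    try (by apply: emeasurable_funM => //; exact: mf1).
  by move=> y _; apply: lee_wpmul2l => //; exact: gh.
have Fr y : right t y -> F (upd w j y) = F (upd w j y0).
  by move=> ry; rewrite -(upd_upd w j y0) iF// tj ?tnth_upd ?eqxx.
have split (f : mR -> mR -> \bar R) : measurable_fun [set: mR * mR] (fun z => f z.1 z.2) ->
   (forall t y, 0 <= f t y)%E ->
   (\int[lam]_y (F (upd w j y) * f t y) = \int[lam]_y (cst_if (~~ right t y) * (F (upd w j y) * f t y)) +
      F (upd w j y0) * \int[lam]_y (cst_if (right t y) * f t y))%E.
  move=> mf f0; rewrite -ge0_integralZl//; last 2 first.
  - by apply: emeasurable_funM => //; exact: mf1.
  - by move=> y _; rewrite mule_ge0 ?cst_if_ge0.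
  rewrite -ge0_integralD//.
  - apply: eq_integral => y _; rewrite /cst_if.
    by have [ry|_] := boolP (right t y); rewrite ?mul0e ?mule0 ?add0e ?adde0 ?mul1e// Fr.
  - by move=> y _; rewrite !mule_ge0 ?cst_if_ge0.
  - by apply: emeasurable_funM => //; apply: emeasurable_funM => //; exact: mf1.
  - by move=> y _; rewrite !mule_ge0 ?cst_if_ge0.
  - by apply: emeasurable_funM => //; apply: emeasurable_funM => //; exact: mf1.
rewrite (split g mg g0) (split h mh h0); apply: leeD.
  apply: ge0_le_integral => //; try (by move=> y _; rewrite !mule_ge0 ?cst_if_ge0);
    try (by apply: emeasurable_funM => //; apply: emeasurable_funM => //; exact: mf1).
  move=> y _; rewrite /cst_if; have [ry|lr] := boolP (right t y); rewrite ?mul0e// !mul1e.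
  by apply: lee_wpmul2l => //; exact: gh.
have [->|Fn0] := eqVneq (F (upd w j y0)) 0%E; first by rewrite !mul0e.
by apply: lee_wpmul2l => //; have := IG _ Fn0; rewrite tj.
Qed.

(** The factors are replaced one at a time: those of the other arcs are not affected when
    arc j is resampled. *)
Lemma integral_swap_factors (S : mR -> Prop) (J : seq 'I_m) (F : tup -> \bar R)
    (g h : 'I_m -> mR -> mR -> \bar R) : uniq J ->
  measurable_fun setT F -> (forall w, 0 <= F w)%E -> (forall j, j \in J -> inert F j) ->
  (forall w, F w != 0%E -> S (tau w)) ->
  (forall j w y, j \in J -> tau (upd w j y) = tau w) ->
  (forall j, measurable_fun [set: mR * mR] (fun z => g j z.1 z.2)) -> (forall j t y, 0 <= g j t y)%E ->
  (forall j, measurable_fun [set: mR * mR] (fun z => h j z.1 z.2)) -> (forall j t y, 0 <= h j t y)%E ->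
  (forall j t y, ~~ right t y -> (g j t y <= h j t y)%E) ->
  (forall j t, j \in J -> S t -> (\int[lam]_y (cst_if (right t y) * g j t y) <=
                         \int[lam]_y (cst_if (right t y) * h j t y))%E) ->
  (\int[torus m]_w (F w * \prod_(j <- J) g j (tau w) (tnth w j)) <=
   \int[torus m]_w (F w * \prod_(j <- J) h j (tau w) (tnth w j)))%E.
Proof.
move=> uJ + + + + + mg g0 mh h0 gh.
elim: J uJ F => [|j J IH] /= uJ F mF F0 iF FS tJ IG.
  by under eq_integral do rewrite big_nil; under [leRHS]eq_integral do rewrite big_nil.
have /andP[jJ uJ'] := uJ.
have mc (f : 'I_m -> mR -> mR -> \bar R) i : (forall j, measurable_fun [set: mR * mR] (fun z => f j z.1 z.2)) ->
    measurable_fun setT (fun w => f i (tau w) (tnth w i)).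
  move=> mf; apply: (measurableT_comp (mf i) (g := fun w : tup => (tau w, tnth w i : mR))).
  by apply/measurable_fun_pair => //; exact: measurable_tnth.
have mP : measurable_fun setT (fun w => F w * \prod_(i <- J) g i (tau w) (tnth w i))%E.
  by apply: emeasurable_funM => //; apply: emeasurable_prod => i; exact: mc.
apply: (@le_trans _ _ (\int[torus m]_w (F w * \prod_(i <- J) g i (tau w) (tnth w i) * h j (tau w) (tnth w j)))%E).
  under eq_integral do rewrite big_cons muleCA muleC.
  apply: integral_swap_factor => //.
  - by move=> w; rewrite mule_ge0// eprod_ge0.
  - move=> w y rw ry; rewrite iF ?mem_head//; congr (_ * _)%E.
    apply: eq_big_seq => i iJ; rewrite tnth_upd tJ ?mem_head//.
    by case: eqP iJ jJ => // -> ->.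
  - by move=> w y; rewrite tJ ?mem_head.
  - exact: gh.
  move=> w Fw; apply: IG; first exact: mem_head.
  by apply: FS; apply: contraNneq Fw => ->; rewrite mul0e.
under eq_integral do rewrite -muleA [X in (_ * X)%E]muleC muleA.
under [leRHS]eq_integral do rewrite big_cons muleA.
apply: IH => //.
- by apply: emeasurable_funM => //; exact: mc.
- by move=> w; rewrite mule_ge0.
- move=> i iJ w y rw ry; rewrite iF ?inE ?iJ ?orbT// tJ ?inE ?iJ ?orbT// tnth_upd.
  by case: eqP jJ iJ => // -> /negP.
- by move=> w Fw; apply: FS; apply: contraNneq Fw => ->; rewrite mul0e.
- by move=> i w y iJ; apply: tJ; rewrite inE iJ orbT.
- by move=> i t iJ; apply: IG; rewrite inE iJ orbT.
Qed.

End hybrid.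

(** * The effect of a single arc *)

Section half_arcs.
Variable R : realType.
Local Notation mR := (measurableTypeR R).
Local Notation lam := (@circle_lebesgue R).
Local Notation cst_if := (@cst_if R).

(** An arc of length less than 1/2 that starts to the right of t does not contain t. *)
Definition right (t y : mR) : bool := mod1 (y - t) < 1/2.

Definition hit (s u : R) (t y : mR) : bool := right t y && (0 < mod1 (t + u - y) < s).

Definition alive s u t y : \bar R := cst_if (~~ hit s u t y).

(** This is the mean of [alive] given on which side of t the arc starts: among the starts to
    the right of t, those of the arcs that hit t + u have relative measure 2 min (s, u). *)
Definition alive_mean s u t y : \bar R := (if right t y then 1 - 2 * Num.min s u else 1)%:E.

Lemma measurable_right2 d (T : measurableType d) (f g : T -> mR) :
  measurable_fun setT f -> measurable_fun setT g -> measurable_fun setT (fun z => right (f z) (g z)).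
Proof.
move=> mf mg; apply: measurable_fun_ltr => //.
by apply: (measurableT_comp (@measurable_mod1 R)); exact: measurable_funB.
Qed.

Lemma measurable_hit d (T : measurableType d) s (f g h : T -> mR) :
  measurable_fun setT f -> measurable_fun setT g -> measurable_fun setT h ->
  measurable_fun setT (fun z => hit s (f z) (g z) (h z)).
Proof.
move=> mf mg mh; apply: measurable_and; first exact: measurable_right2.
by apply: (measurable_alive s (f := fun z => g z + f z)) => //; exact: measurable_funD.
Qed.

Lemma measurable_alivef d (T : measurableType d) s (f g h : T -> mR) :
  measurable_fun setT f -> measurable_fun setT g -> measurable_fun setT h ->
  measurable_fun setT (fun z => alive s (f z) (g z) (h z)).
Proof.
by move=> mf mg mh; apply: measurable_cst_if; apply: measurable_neg; exact: measurable_hit.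
Qed.

Lemma measurable_alive_mean d (T : measurableType d) s (f g h : T -> mR) :
  measurable_fun setT f -> measurable_fun setT g -> measurable_fun setT h ->
  measurable_fun setT (fun z => alive_mean s (f z) (g z) (h z)).
Proof.
move=> mf mg mh; apply/measurable_EFinP; apply: measurable_fun_ifT => //; first exact: measurable_right2.
by apply: measurable_funB => //; apply: measurable_funM => //; exact: measurable_minr.
Qed.

Lemma integral_itvoo (c e : R) : 0 <= c -> c <= e -> e <= 1 ->
  (\int[lam]_x cst_if (c < x < e)%R = (e - c)%:E)%E.
Proof.
move=> c0 ce e1; rewrite -(lam_itvoo c0 ce e1).
have mI : measurable (`]c, e[%classic : set mR) by exact: measurable_itv.
transitivity (\int[lam]_x (\1_(`]c, e[%classic : set mR) x)%:E)%E; last by rewrite integral_indic// setIT.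
by apply: eq_integral => x _; rewrite /cst_if indicE mem_setE in_itv/=; case: ifP.
Qed.

Lemma integral_lt_half : (\int[lam]_x cst_if (x < 1/2)%R = (1/2)%:E)%E.
Proof.
have mI : measurable (`]-oo, 1/2[%classic : set mR) by exact: measurable_itv.
transitivity (lam `]-oo, 1/2[%classic).
  transitivity (\int[lam]_x (\1_(`]-oo, 1/2[%classic : set mR) x)%:E)%E; last by rewrite integral_indic// setIT.
  by apply: eq_integral => x _; rewrite /cst_if indicE mem_setE in_itv/=; case: ifP.
rewrite lamE.
have -> : `]-oo, 1/2[%classic `&` @circle R = `[0, 1/2[%classic.
  by apply/seteqP; split => t; rewrite /circle /= !in_itv/=; lra.
rewrite lebesgue_measure_itv/= lte_fin ifT; last by lra.
by rewrite -EFinB subr0.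
Qed.

Lemma integral_rotate (t : R) (f : mR -> \bar R) : measurable_fun setT f -> (forall x, 0 <= f x)%E ->
  (\int[lam]_y f (mod1 (y - t)) = \int[lam]_x f x)%E.
Proof.
move=> mf f0; apply: (integral_lam_map (g := fun y => mod1 (y - t))) => //.
  exact: measurable_circle_map.
by move=> A mA; exact: lam_shift.
Qed.

Lemma mod1_rotate t u y : mod1 (t + u - y) = mod1 (u - mod1 (y - t)) :> R.
Proof. by rewrite mod1Br; congr mod1; ring. Qed.

Lemma measurable_cst_lt (c e : R) : measurable_fun [set: mR] (fun x : mR => cst_if (c < x < e)).
Proof.
apply: measurable_cst_if; apply: measurable_and.
  exact: (@measurable_fun_ltr _ _ _ _ (cst c) id).
exact: (@measurable_fun_ltr _ _ _ _ id (cst e)).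
Qed.

Lemma measurable_lt_half : measurable_fun [set: mR] (fun x : mR => x < 1/2).
Proof. exact: (@measurable_fun_ltr _ _ _ _ id (cst (1/2))). Qed.

Lemma integral_right t : (\int[lam]_y cst_if (right t y) = (1/2)%:E)%E.
Proof.
rewrite -integral_lt_half -[RHS](integral_rotate t)//.
  by apply: measurable_cst_if; exact: measurable_lt_half.
by move=> x; exact: cst_if_ge0.
Qed.

Lemma integral_right_cst t (c : R) : 0 <= c ->
  (\int[lam]_y (cst_if (right t y) * c%:E) = (1/2 * c)%:E)%E.
Proof.
move=> c0; rewrite ge0_integralZr ?integral_right//.
- by apply: measurable_cst_if; exact: (measurable_right2 (f := cst t) (g := id)).
- by move=> x _; exact: cst_if_ge0.
Qed.

Lemma mod1_sub (u x : R) : -1/2 < u - x < 1/2 -> mod1 (u - x) = if x <= u then u - x else u - x + 1.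
Proof.
move=> ux; case: leP => h; first by rewrite mod1_id//; lra.
by rewrite mod1_shiftN1//; lra.
Qed.

Lemma alive_mean_le (s t u : R) : 0 < s -> s <= 1/8 -> 0 <= u -> u < 1/2 ->
  (\int[lam]_y (cst_if (right t y) * alive_mean s u t y) <=
   \int[lam]_y (cst_if (right t y) * alive s u t y))%E.
Proof.
move=> s0 s1 u0 u1; set v := Num.min s u.
have v0 : 0 <= v by rewrite le_min ltW.
have vu : v <= u by rewrite ge_min lexx orbT.
have vs : v <= s by rewrite ge_min lexx.
rewrite (eq_integral (fun y => cst_if (right t y) * (1 - 2 * v)%:E)%E); last first.
  by move=> y _; rewrite /alive_mean /cst_if; case: ifP => // _; rewrite !mul0e.
rewrite integral_right_cst; last lra.
pose f (x : mR) := cst_if ((x < 1/2) && ~~ (0 < mod1 (u - x) < s)).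
have mf : measurable_fun setT f.
  apply: measurable_cst_if; apply: measurable_and; first exact: measurable_lt_half.
  by apply: measurable_neg; exact: (measurable_alive s (f := cst u) (g := id)).
rewrite (eq_integral (fun y : mR => f (mod1 (y - t)))); last first.
  move=> y _; rewrite /f /alive /hit /cst_if -mod1_rotate -/(right t y).
  by case: (right t y); rewrite ?mul0e//= mul1e.
rewrite integral_rotate//; last by move=> x; exact: cst_if_ge0.
rewrite (_ : 1/2 * (1 - 2 * v) = (u - v - 0) + (1/2 - u)); last by lra.
rewrite EFinD -(@integral_itvoo 0 (u - v)); [|lra..].
rewrite -(@integral_itvoo u (1/2)); [|lra..].
rewrite -ge0_integralD//; try exact: measurable_cst_lt; try by move=> x _; exact: cst_if_ge0.
apply: ge0_le_integral => //.
- by move=> x _; rewrite adde_ge0 ?cst_if_ge0.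
- by apply: emeasurable_funD; exact: measurable_cst_lt.
move=> x _; rewrite /f /cst_if.
case: ifP => [/andP[x0 xu]|_].
  have -> : (u < x < 1/2) = false by apply/negbTE; lra.
  rewrite adde0 mod1_sub; last lra.
  have -> : x <= u by lra.
  have -> : x < 1/2 by lra.
  have sv : s <= u - x.
    have [su|us] := leP s u; first by move: xu; rewrite /v min_l//; lra.
    by move: xu; rewrite /v (min_r (ltW us)) subrr; lra.
  by rewrite ifT// negb_and -!leNgt sv orbT.
rewrite add0e; case: ifP => [/andP[ux x1]|_]; last by case: ifP.
rewrite mod1_sub; last lra.
have -> : (x <= u) = false by apply/negbTE; lra.
by rewrite x1 ifT//=; lra.
Qed.

(** The starts to the right of t of the arcs that hit t + u contain an interval of length
    v = min (s, u), those of the arcs that hit t + u' an interval of length v' = min (s, u' - u)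
    beyond t + u.  These are disjoint, and 1 - 2 v - 2 v' <= (1 - 2 v) (1 - 2 v'). *)
Lemma alive2_mean_le (s t u u' : R) : 0 < s -> 0 <= u -> u <= u' -> u' < 1/2 ->
  (\int[lam]_y (cst_if (right t y) * (alive s u t y * alive s u' t y)) <=
   \int[lam]_y (cst_if (right t y) * (alive_mean s u t y * alive_mean s (u' - u)%R t y)))%E.
Proof.
move=> s0 u0 uu u1; set v := Num.min s u; set v' := Num.min s (u' - u).
have v0 : 0 <= v by rewrite le_min u0 ltW.
have vu : v <= u by rewrite ge_min lexx orbT.
have vs : v <= s by rewrite ge_min lexx.
have v0' : 0 <= v' by rewrite le_min subr_ge0 uu ltW.
have vu' : v' <= u' - u by rewrite ge_min lexx orbT.
have vs' : v' <= s by rewrite ge_min lexx.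
rewrite [leRHS](eq_integral (fun y => cst_if (right t y) * ((1 - 2 * v) * (1 - 2 * v'))%:E)%E); last first.
  by move=> y _; rewrite /alive_mean /cst_if; case: ifP => // _; rewrite !mul0e.
rewrite integral_right_cst; last by rewrite mulr_ge0//; lra.
pose f (x : mR) := cst_if ((x < 1/2) && (~~ (0 < mod1 (u - x) < s) && ~~ (0 < mod1 (u' - x) < s))).
have mf : measurable_fun setT f.
  apply: measurable_cst_if; apply: measurable_and; first exact: measurable_lt_half.
  by apply: measurable_and; apply: measurable_neg;
    [exact: (measurable_alive s (f := cst u) (g := id))|exact: (measurable_alive s (f := cst u') (g := id))].
have f0 x : (0 <= f x)%E by exact: cst_if_ge0.
rewrite (eq_integral (fun y : mR => f (mod1 (y - t)))); last first.
  move=> y _; rewrite /f /alive /hit /cst_if -!mod1_rotate -/(right t y).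
  case: (right t y); rewrite ?mul0e//= mul1e.
  by case: (~~ (0 < mod1 (t + u - y) < s)); rewrite ?mul1e ?mul0e.
rewrite integral_rotate//.
have H : (\int[lam]_x f x + v%:E + v'%:E <= (1/2)%:E)%E.
  rewrite -integral_lt_half.
  rewrite (_ : v = u - (u - v)); last ring.
  rewrite (_ : v' = u' - (u' - v')); last ring.
  rewrite -(@integral_itvoo (u - v) u); [|lra..].
  rewrite -(@integral_itvoo (u' - v') u'); [|lra..].
  have g0 c e (x : mR) : (0 <= cst_if (c < x < e)%R)%E by exact: cst_if_ge0.
  have mg := measurable_cst_lt.
  rewrite -ge0_integralD// -ge0_integralD//; try (by move=> x _; rewrite adde_ge0); try exact: emeasurable_funD.
  apply: ge0_le_integral => //.
  - by move=> x _; rewrite !adde_ge0.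
  - by apply: emeasurable_funD => //; exact: emeasurable_funD.
  - by apply: measurable_cst_if; exact: measurable_lt_half.
  move=> x _; rewrite /f /cst_if.
  have [h1|h1] := boolP (u - v < x < u).
    have -> : (u' - v' < x < u') = false by apply/negbTE; lra.
    have -> : x < 1/2 by lra.
    rewrite mod1_sub; last lra.
    have -> : x <= u by lra.
    have -> : 0 < u - x < s by lra.
    by rewrite add0e adde0.
  have [h2|h2] := boolP (u' - v' < x < u').
    have -> : x < 1/2 by lra.
    rewrite (@mod1_sub u'); last lra.
    have -> : x <= u' by lra.
    have -> : 0 < u' - x < s by lra.
    by rewrite /= andbF !add0e.
  by rewrite !adde0; case: (x < 1/2) => //=; case: ifP.
have : (0 <= \int[lam]_x f x)%E by apply: integral_ge0.
move: H; case: (\int[lam]_x f x)%E => [r| |]//=; rewrite -!EFinD !lee_fin => H _.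
have := mulr_ge0 v0 v0'; lra.
Qed.

(** This fixed arc lies to the right of every point of [a, a + 1/8]. *)
Definition far_window (a : R) (y : mR) : bool := 1/4 < mod1 (y - a) < 1/2.

Lemma integral_far_window a : (\int[lam]_y cst_if (far_window a y) = (1/4)%:E)%E.
Proof.
rewrite (_ : 1/4 = 1/2 - 1/4 :> R); last lra.
rewrite -(@integral_itvoo (1/4) (1/2)); [|lra..].
rewrite -[RHS](integral_rotate a)//; first exact: measurable_cst_lt.
by move=> x; exact: cst_if_ge0.
Qed.

Lemma measurable_far_window a : measurable_fun setT (far_window a).
Proof.
have mm : measurable_fun [set: mR] (fun y : mR => mod1 (y - a) : mR) by exact: measurable_circle_map.
by apply: measurable_and; apply: measurable_fun_ltr.
Qed.

Lemma far_window_right a t y : a <= t <= a + 1/8 -> far_window a y -> right t y.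
Proof.
move=> at_ /andP[h1 h2]; rewrite /right.
have -> : y - t = (y - a) - (t - a) by ring.
by rewrite -mod1Dl mod1_id; lra.
Qed.

(** The half circle to the right of t is traded for the fixed arc [far_window a], which has
    half its measure.  The means agree since (1 - 2 s) (1 + 2 s) = 1 - 4 s^2, and only the
    second order is lost. *)
Lemma tilt_mean_le (s a t : R) : 0 < s -> s <= 1/8 -> a <= t <= a + 1/8 ->
  (\int[lam]_y (cst_if (right t y) * ((1 - 2 * s)^-1)%:E) <=
   \int[lam]_y (cst_if (right t y) * ((1 - 4 * s ^+ 2)^-1%:E * (1 + 4 * s * (if far_window a y then 1 else 0))%:E)))%E.
Proof.
move=> s0 s1 at_.
have k0 : 0 < 1 - 4 * s ^+ 2.
  have : s * s <= 1/8 * s by apply: ler_wpM2r; lra.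
  by rewrite expr2; lra.
have k1 : 0 < 1 - 2 * s by lra.
have k2 : 0 <= (1 - 2 * s)^-1 by rewrite invr_ge0 ltW.
rewrite integral_right_cst//.
have mr : measurable_fun setT (fun y => cst_if (right t y)).
  by apply: measurable_cst_if; exact: (measurable_right2 (f := cst t) (g := id)).
have mw : measurable_fun setT (fun y => cst_if (far_window a y)).
  by apply: measurable_cst_if; exact: measurable_far_window.
rewrite (eq_integral (fun y => cst_if (right t y) * ((1 - 4 * s ^+ 2)^-1)%:E +
    ((1 - 4 * s ^+ 2)^-1 * (4 * s))%:E * cst_if (far_window a y))%E); last first.
  move=> y _; rewrite /cst_if; case: ifP => r1; last first.
    rewrite !mul0e add0e ifF ?mule0//; apply: contraFF r1; exact: far_window_right.
  by rewrite !mul1e; case: ifP => _; rewrite ?mulr1 ?mule1 ?mule0 ?mulr0 ?addr0 ?mule1 ?adde0// -EFinM -EFinD; congr EFin; ring.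
have c0 : 0 <= (1 - 4 * s ^+ 2)^-1 by rewrite invr_ge0 ltW.
rewrite ge0_integralD//; last 4 first.
- by move=> y _; rewrite mule_ge0 ?cst_if_ge0.
- exact: emeasurable_funM.
- by move=> y _; rewrite mule_ge0 ?cst_if_ge0// lee_fin mulr_ge0//; lra.
- exact: emeasurable_funM.
rewrite integral_right_cst// ge0_integralZl//; last 2 first.
- by move=> y _; exact: cst_if_ge0.
- by rewrite lee_fin mulr_ge0//; lra.
rewrite integral_far_window -EFinM -EFinD lee_fin le_eqVlt; apply/orP; left; apply/eqP.
have -> : 1 - 4 * s ^+ 2 = (1 - 2 * s) * (1 + 2 * s) by ring.
by field; lra.
Qed.

End half_arcs.

(** * The free time beyond an end point *)

Section paley_zygmund.
Variable R : realType.
Local Notation mR := (measurableTypeR R).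
Local Notation lam := (@circle_lebesgue R).
Local Notation torus n := (torus_lebesgue R n).
Local Notation cst_if := (@cst_if R).

Local Notation right := (@right R).

Lemma tonelli_weight d1 d2 (T1 : measurableType d1) (T2 : measurableType d2)
    (Q1 : probability T1 R) (Q2 : probability T2 R)
    (L : T1 -> \bar R) (c : T2 -> \bar R) (g : T1 -> T2 -> \bar R) :
  measurable_fun setT L -> (forall x, 0 <= L x)%E ->
  measurable_fun setT c -> (forall y, 0 <= c y)%E ->
  measurable_fun [set: T1 * T2] (fun z => g z.1 z.2) -> (forall x y, 0 <= g x y)%E ->
  (\int[Q1]_x (L x * \int[Q2]_y (c y * g x y)) = \int[Q2]_y (c y * \int[Q1]_x (L x * g x y)))%E.
Proof.
move=> mL L0 mc c0 mg g0.
have m1 x : measurable_fun setT (g x) by exact: (measurableT_comp mg (measurable_pair1 x)).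
have m2 y : measurable_fun setT (g ^~ y) by exact: (measurableT_comp mg (measurable_pair2 y)).
pose G (z : T1 * T2) := (L z.1 * (c z.2 * g z.1 z.2))%E.
have mG : measurable_fun setT G.
  apply: emeasurable_funM; first exact: (measurableT_comp mL measurable_fst).
  by apply: emeasurable_funM => //; exact: (measurableT_comp mc measurable_snd).
have G0 z : (0 <= G z)%E by rewrite !mule_ge0.
rewrite (eq_integral (fun x => \int[Q2]_y G (x, y))%E); last first.
  by move=> x _; rewrite -ge0_integralZl//; [exact: emeasurable_funM|move=> y _; rewrite mule_ge0].
rewrite fubini_tonelli//; apply: eq_integral => y _.
rewrite -ge0_integralZl//; last 2 first.
- by apply: emeasurable_funM.
- by move=> x _; rewrite mule_ge0.
by apply: eq_integral => x _; rewrite /G /= muleCA.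
Qed.

Lemma measurable_weighted (f : mR -> \bar R) (g : mR -> mR -> \bar R) :
  measurable_fun setT f -> (forall u, 0 <= f u)%E ->
  measurable_fun [set: mR * mR] (fun z => g z.1 z.2) -> (forall x y, 0 <= g x y)%E ->
  measurable_fun setT (fun u => \int[lam]_v (f v * g u v))%E.
Proof.
move=> mf f0 mg g0.
have mf2 : measurable_fun [set: mR * mR] (fun z => f z.2) by exact: (measurableT_comp mf measurable_snd).
have mfg : measurable_fun [set: mR * mR] (fun z => f z.2 * g z.1 z.2)%E by exact: (emeasurable_funM mf2 mg).
by apply: (measurable_fun_fubini_tonelli_F _ mfg) => z; rewrite mule_ge0.
Qed.

Lemma integral_le_add d (T : measurableType d) (mu : {measure set T -> \bar R}) (f f1 f2 : T -> \bar R) :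
  measurable_fun setT f -> measurable_fun setT f1 -> measurable_fun setT f2 ->
  (forall x, 0 <= f x)%E -> (forall x, 0 <= f1 x)%E -> (forall x, 0 <= f2 x)%E ->
  (forall x, f x <= f1 x + f2 x)%E ->
  (\int[mu]_x f x <= \int[mu]_x f1 x + \int[mu]_x f2 x)%E.
Proof.
move=> mf m1 m2 f0 f10 f20 le; rewrite -ge0_integralD//.
by apply: ge0_le_integral => //; exact: emeasurable_funD.
Qed.

Lemma cst_if_cover (x : \bar R) (p q : bool) : (0 <= x)%E -> p || q ->
  (x <= x * cst_if p + x * cst_if q)%E.
Proof.
by move=> x0; case: p; case: q => //= _; rewrite /cst_if ?mule1 ?mule0 ?add0e ?adde0// leeDl.
Qed.

Lemma measurable_integral_weight d1 d2 (T1 : measurableType d1) (T2 : measurableType d2)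
    (Q2 : probability T2 R) (c : T2 -> \bar R) (g : T1 -> T2 -> \bar R) :
  measurable_fun setT c -> (forall y, 0 <= c y)%E ->
  measurable_fun [set: T1 * T2] (fun z => g z.1 z.2) -> (forall x y, 0 <= g x y)%E ->
  measurable_fun setT (fun x => \int[Q2]_y (c y * g x y))%E.
Proof.
move=> mc c0 mg g0.
have mP : measurable_fun [set: T1 * T2] (fun z => c z.2 * g z.1 z.2)%E.
  exact: (emeasurable_funM (measurableT_comp mc measurable_snd) mg).
by apply: (measurable_fun_fubini_tonelli_F _ mP) => z; rewrite mule_ge0.
Qed.

Lemma square_le_twice (f : mR -> \bar R) : measurable_fun setT f -> (forall u, 0 <= f u)%E ->
  (\int[lam]_u f u * \int[lam]_u f u <=
   2%:E * \int[lam]_u (f u * \int[lam]_v (f v * cst_if (u <= v)%R)))%E.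
Proof.
move=> mf f0.
pose I1 (u : mR) := (\int[lam]_v (f v * cst_if (u <= v)%R))%E.
pose I2 (u : mR) := (\int[lam]_v (f v * cst_if (v <= u)%R))%E.
have c1 (x y : mR) : (0 <= cst_if (x <= y)%R)%E by exact: cst_if_ge0.
have c2 (x y : mR) : (0 <= cst_if (y <= x)%R)%E by exact: cst_if_ge0.
have ml1 : measurable_fun [set: mR * mR] (fun z : mR * mR => cst_if (z.1 <= z.2)%R).
  by apply: measurable_cst_if; exact: measurable_fun_ler.
have ml2 : measurable_fun [set: mR * mR] (fun z : mR * mR => cst_if (z.2 <= z.1)%R).
  by apply: measurable_cst_if; exact: measurable_fun_ler.
have mI1 : measurable_fun setT I1 := measurable_weighted mf f0 ml1 c1.
have mI2 : measurable_fun setT I2 := measurable_weighted mf f0 ml2 c2.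
have I10 u : (0 <= I1 u)%E by apply: integral_ge0 => v _; rewrite mule_ge0.
have I20 u : (0 <= I2 u)%E by apply: integral_ge0 => v _; rewrite mule_ge0.
have E : (\int[lam]_u (f u * I2 u) = \int[lam]_u (f u * I1 u))%E.
  exact: (esym (tonelli_weight lam lam mf f0 mf f0 ml1 c1)).
have I12 u : (\int[lam]_v f v <= I1 u + I2 u)%E.
  have m1 : measurable_fun setT (fun v => f v * cst_if (u <= v)%R)%E.
    exact: (emeasurable_funM mf (measurableT_comp ml1 (measurable_pair1 u))).
  have m2 : measurable_fun setT (fun v => f v * cst_if (v <= u)%R)%E.
    exact: (emeasurable_funM mf (measurableT_comp ml2 (measurable_pair1 u))).
  apply: (@integral_le_add _ _ lam _ _ _ mf m1 m2 f0) => v; [by rewrite mule_ge0|by rewrite mule_ge0|].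
  by apply: cst_if_cover; [exact: f0|exact: le_total].
clear ml1 ml2 c1 c2; rewrite -/I1.
have -> : (2%:E * \int[lam]_u (f u * I1 u) = \int[lam]_u (f u * I1 u) + \int[lam]_u (f u * I2 u))%E.
  by rewrite E mule_natl mule2n.
move: I1 I2 mI1 mI2 I10 I20 I12 {E} => I1 I2 mI1 mI2 I10 I20 I12.
have F0 : (0 <= \int[lam]_u f u)%E by exact: integral_ge0.
rewrite -ge0_integralD//; try (by move=> u _; rewrite mule_ge0); try exact: emeasurable_funM.
rewrite -ge0_integralZr//; try exact: F0.
apply: ge0_le_integral => //.
- by move=> u _; rewrite mule_ge0.
- exact: emeasurable_funM.
- by apply: emeasurable_funD; exact: emeasurable_funM.
by move=> u _; rewrite -ge0_muleDr//; exact: lee_wpmul2l.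
Qed.

Lemma integral_itvco (e : R) : 0 <= e -> e <= 1 ->
  (\int[lam]_x cst_if (0 <= x < e)%R = e%:E)%E.
Proof.
move=> e0 e1.
have mI : measurable (`[0, e[%classic : set mR) by exact: measurable_itv.
transitivity (lam (`[0, e[%classic : set mR)).
  transitivity (\int[lam]_x (\1_(`[0, e[%classic : set mR) x)%:E)%E; last by rewrite integral_indic// setIT.
  by apply: eq_integral => x _; rewrite /cst_if indicE mem_setE in_itv/=; case: ifP.
rewrite lamE.
have -> : `[0, e[%classic `&` @circle R = `[0, e[%classic.
  by apply/setIidl => t; rewrite /circle /= !in_itv/=; lra.
rewrite lebesgue_measure_itv/= lte_fin; case: ltP => [_|h]; first by rewrite -EFinB subr0.
by congr EFin; lra.
Qed.

(** With r = x / y: if r < 1/4 the first term is enough, and r - r^2 / 8 never exceeds 2. *)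
Lemma paley_zygmund_pointwise (x y : R) : 0 < y -> 0 <= x ->
  y^-1 * x <= 1/4 + 1/8 * (y^-1 * y^-1 * (x * x)) + (if y <= 4 * x then 2 else 0).
Proof.
move=> y0 x0; have -> : y^-1 * y^-1 * (x * x) = (y^-1 * x) ^+ 2 by rewrite expr2; ring.
have q0 : 0 <= y^-1 * x by rewrite mulr_ge0// invr_ge0 ltW.
have := sqr_ge0 (y^-1 * x - 4); rewrite sqrrB; case: ifP => [_|/negbT].
  by lra.
rewrite -ltNge => h; suff : y^-1 * x < 1/4 by have := sqr_ge0 (y^-1 * x); lra.
by rewrite mulrC ltr_pdivrMr//; lra.
Qed.

Lemma weighted_pointwise (f : \bar R) (p q : R) (b : bool) : (0 <= f)%E -> 0 <= q ->
  p <= 1/4 + 1/8 * q + (if b then 2 else 0) ->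
  (f * p%:E <= (1/4)%:E * f + (1/8)%:E * (f * q%:E) + 2%:E * (f * cst_if b))%E.
Proof.
move=> f0 q0 h.
have -> : ((1/4)%:E * f + (1/8)%:E * (f * q%:E) + 2%:E * (f * cst_if b) =
    f * (1/4 + 1/8 * q + (if b then 2 else 0))%:E)%E.
  rewrite [(1/4 + 1/8 * q + _)%:E]EFinD (ge0_muleDr f); last 2 first.
  - by rewrite lee_fin addr_ge0 ?mulr_ge0.
  - by rewrite lee_fin; case: b {h}.
  rewrite [(1/4 + 1/8 * q)%:E]EFinD ge0_muleDr ?lee_fin ?mulr_ge0//; congr (_ + _ + _)%E.
  - by rewrite muleC.
  - by rewrite muleCA EFinM.
  - by rewrite muleCA /cst_if; case: b {h}; rewrite ?mule1 ?mule0.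
by apply: lee_wpmul2l => //; rewrite lee_fin.
Qed.

Variable l : nat -> R.
Hypothesis l01 : forall n, 0 < l n < 1.
Variables (m n : nat) (k : 'I_m).
Hypothesis lsmall : forall j, (n <= j)%N -> l j <= 1/8.
Local Notation tup := (m.-tuple mR).

Definition endpoint (w : tup) : mR := mod1 (tnth w k + l k).

(** The short arcs, without the one whose end is considered. *)
Definition late : seq 'I_m := [seq j : 'I_m <- enum 'I_m | (n <= j)%N && (j != k)].

Lemma late_uniq : uniq late. Proof. by rewrite filter_uniq ?enum_uniq. Qed.

Lemma lateP j : (j \in late) = (n <= j)%N && (j != k).
Proof. by rewrite mem_filter mem_enum andbT. Qed.

Lemma endpoint_upd j w y : j \in late -> endpoint (upd w j y) = endpoint w.
Proof. by rewrite lateP => /andP[_ jk]; rewrite /endpoint tnth_upd eq_sym (negbTE jk). Qed.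

Lemma measurable_endpoint : measurable_fun setT endpoint.
Proof.
apply: (measurableT_comp (@measurable_mod1 R)); apply: measurable_funD => //.
exact: measurable_tnth.
Qed.

(** Truncating the lengths makes the estimates on a single arc valid for every index.  Late
    arcs are not changed, see [lenE]. *)
Definition len (j : nat) : R := Num.min (l j) (1/8).

Lemma len_gt0 j : 0 < len j.
Proof. by rewrite lt_min; have /andP[-> _] := l01 j; lra. Qed.

Lemma len_le j : len j <= 1/8.
Proof. by rewrite ge_min lexx orbT. Qed.

Lemma lenE j : (n <= j)%N -> len j = l j.
Proof. by move=> /lsmall nj; rewrite /len min_l. Qed.

Definition late_prod (g : R -> mR -> mR -> mR -> \bar R) (u : mR) (w : tup) : \bar R :=
  (\prod_(j <- late) g (len j) u (endpoint w) (tnth w j))%E.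

Definition jointly_measurable (g : R -> mR -> mR -> mR -> \bar R) :=
  forall s d (T : measurableType d) (u t y : T -> mR), measurable_fun setT u -> measurable_fun setT t ->
    measurable_fun setT y -> measurable_fun setT (fun z => g s (u z) (t z) (y z)).

Lemma jm_alive : jointly_measurable (fun s u t y => alive s u t y).
Proof. by move=> s d T u t y mu mt my; exact: measurable_alivef. Qed.

Lemma jm_alive_mean : jointly_measurable (fun s u t y => alive_mean s u t y).
Proof. by move=> s d T u t y mu mt my; exact: measurable_alive_mean. Qed.

Lemma measurable_late_prod g d (T : measurableType d) (u : T -> mR) (w : T -> tup) :
  jointly_measurable g -> measurable_fun setT u -> measurable_fun setT w ->
  measurable_fun setT (fun z => late_prod g (u z) (w z)).
Proof.
move=> mg mu mw; apply: emeasurable_prod => j; apply: mg => //.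
  exact: (measurableT_comp measurable_endpoint).
exact: (measurableT_comp (measurable_tnth j) mw).
Qed.

Lemma alive_mean_ge0 (s u : R) t y : s <= 1/8 -> (0 <= alive_mean s u t y)%E.
Proof.
move=> s1; rewrite lee_fin; case: ifP => // _.
have : Num.min s u <= s by rewrite ge_min lexx.
lra.
Qed.

Lemma alive_mean_le1 (s u : R) t y : 0 < s -> 0 <= u -> (alive_mean s u t y <= 1)%E.
Proof.
move=> s1 u0; rewrite lee_fin; case: ifP => // _.
have : 0 <= Num.min s u by rewrite le_min u0 ltW.
lra.
Qed.

Lemma late_alive_ge0 u w : (0 <= late_prod (fun s u t y => alive s u t y) u w)%E.
Proof. by apply: eprod_ge0 => j; exact: cst_if_ge0. Qed.

Lemma late_mean_ge0 u w : (0 <= late_prod (fun s u t y => alive_mean s u t y) u w)%E.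
Proof. by apply: eprod_ge0 => j; apply: alive_mean_ge0; exact: len_le. Qed.

Variable eps : R.
Hypotheses (eps0 : 0 < eps) (eps1 : eps <= 1/4).

Local Notation early := (fun u : mR => cst_if (0 <= u < eps)).

Lemma measurable_early : measurable_fun [set: mR] early.
Proof.
apply: measurable_cst_if; apply: measurable_and.
  exact: (@measurable_fun_ler _ _ _ _ (cst 0) id).
exact: (@measurable_fun_ltr _ _ _ _ id (cst eps)).
Qed.

(** The measure of the u < eps such that c + u is not covered by a late arc that starts to
    the right of the end point c. *)
Definition free_time (w : tup) : \bar R :=
  (\int[lam]_u (early u * late_prod (fun s u t y => alive s u t y) u w))%E.

(** The mean of [free_time] given on which side of c the late arcs start. *)
Definition mean_free_time (w : tup) : \bar R :=
  (\int[lam]_u (early u * late_prod (fun s u t y => alive_mean s u t y) u w))%E.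

Lemma measurable_late_prod2 g : jointly_measurable g ->
  measurable_fun [set: tup * mR] (fun z => late_prod g z.2 z.1).
Proof. by move=> mg; apply: measurable_late_prod. Qed.

Lemma measurable_time g : jointly_measurable g -> (forall u w, 0 <= late_prod g u w)%E ->
  measurable_fun setT (fun w => \int[lam]_u (early u * late_prod g u w))%E.
Proof.
move=> mg g0.
have mE2 : measurable_fun [set: tup * mR] (fun z => early z.2) := measurableT_comp measurable_early measurable_snd.
have mP : measurable_fun [set: tup * mR] (fun z => early z.2 * late_prod g z.2 z.1)%E :=
  emeasurable_funM mE2 (measurable_late_prod2 mg).
by apply: (measurable_fun_fubini_tonelli_F _ mP) => z; rewrite mule_ge0 ?cst_if_ge0.
Qed.

Lemma measurable_free_time : measurable_fun setT free_time.
Proof. exact: (measurable_time jm_alive late_alive_ge0). Qed.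

Lemma measurable_mean_free_time : measurable_fun setT mean_free_time.
Proof. exact: (measurable_time jm_alive_mean late_mean_ge0). Qed.

Lemma free_time_ge0 w : (0 <= free_time w)%E.
Proof. by apply: integral_ge0 => u _; rewrite mule_ge0 ?cst_if_ge0 ?late_alive_ge0. Qed.

(** The integrand of [mean_free_time] decreases to this value as u grows. *)
Definition thinning (w : tup) : R :=
  \prod_(j <- late) (if right (endpoint w) (tnth w j) then 1 - 2 * len j else 1).

Lemma thinning_gt0 w : 0 < thinning w.
Proof.
apply: prodr_gt0 => j _; case: ifP => // _; have := len_le j; lra.
Qed.

Lemma measurable_late_prod1 g w : jointly_measurable g -> measurable_fun setT (late_prod g ^~ w).
Proof. by move=> mg; apply: measurable_late_prod. Qed.

Lemma mean_free_time_ge w : ((eps * thinning w)%:E <= mean_free_time w)%E.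
Proof.
have e1 : eps <= 1 by have h := eps1; lra.
rewrite EFinM -(integral_itvco (ltW eps0) e1) -ge0_integralZr//; last 3 first.
- exact: measurable_early.
- by move=> u _; exact: cst_if_ge0.
- by rewrite lee_fin ltW// thinning_gt0.
apply: ge0_le_integral => //.
- by move=> u _; rewrite mule_ge0 ?cst_if_ge0// lee_fin ltW// thinning_gt0.
- by apply: emeasurable_funM => //; exact: measurable_early.
- apply: emeasurable_funM; first exact: measurable_early.
  exact: measurable_late_prod1 jm_alive_mean.
move=> u _; apply: lee_wpmul2l; first exact: cst_if_ge0.
rewrite /thinning -prodEFin; apply: lee_prod => j.
have lj := len_le j; have mj : Num.min (len j) u <= len j by rewrite ge_min lexx.
by rewrite !lee_fin; case: ifP => // _; apply/andP; split; lra.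
Qed.

Lemma mean_free_time_le1 w : (mean_free_time w <= 1)%E.
Proof.
rewrite -(integral_cst_probability lam 1%E); apply: ge0_le_integral => //.
- by move=> u _; rewrite mule_ge0 ?cst_if_ge0 ?late_mean_ge0.
- apply: emeasurable_funM; first exact: measurable_early.
  exact: measurable_late_prod1 jm_alive_mean.
move=> u _; rewrite /cst_if; case: ifP => [/andP[u0 _]|_]; last by rewrite mul0e.
rewrite mul1e (_ : 1%E = \prod_(j <- late) 1)%E; last by rewrite big1.
apply: lee_prod => j; rewrite alive_mean_ge0 ?len_le//=.
by apply: alive_mean_le1 => //; exact: len_gt0.
Qed.

Lemma free_time_le1 w : (free_time w <= 1)%E.
Proof.
rewrite -(integral_cst_probability lam 1%E); apply: ge0_le_integral => //.
- by move=> u _; rewrite mule_ge0 ?cst_if_ge0 ?late_alive_ge0.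
- apply: emeasurable_funM; first exact: measurable_early.
  exact: measurable_late_prod1 jm_alive.
move=> u _; rewrite /cst_if; case: ifP => [_|_]; last by rewrite mul0e.
rewrite mul1e (_ : 1%E = \prod_(j <- late) 1)%E; last by rewrite big1.
by apply: lee_prod => j; rewrite cst_if_ge0/= /alive /cst_if; case: ifP.
Qed.

Lemma inert_mean_free_time j : j \in late -> forall w y,
  right (endpoint w) (tnth w j) -> right (endpoint w) y ->
  mean_free_time (upd w j y) = mean_free_time w.
Proof.
move=> jl w y r1 r2; apply: eq_integral => u _; congr (_ * _)%E.
apply: eq_bigr => i _; rewrite endpoint_upd// tnth_upd; case: eqP => [->|//].
by rewrite /alive_mean r1 r2.
Qed.

Lemma mean_free_time_gt0 w : (0 < mean_free_time w)%E.
Proof. by apply: lt_le_trans (mean_free_time_ge w); rewrite lte_fin mulr_gt0// thinning_gt0. Qed.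

Lemma mean_free_time_fin w : mean_free_time w \is a fin_num.
Proof.
rewrite ge0_fin_numE; last exact/ltW/mean_free_time_gt0.
by apply: le_lt_trans (mean_free_time_le1 w) _; rewrite ltry.
Qed.

Lemma free_time_fin w : free_time w \is a fin_num.
Proof.
by rewrite ge0_fin_numE ?free_time_ge0//; apply: le_lt_trans (free_time_le1 w) _; rewrite ltry.
Qed.

Variable F : tup -> \bar R.
Hypotheses (mF : measurable_fun setT F) (F0 : forall w, (0 <= F w)%E).
Hypothesis iF : forall j, j \in late -> inert right endpoint F j.

(** The inverse of [mean_free_time], through exp and ln because these are known to be
    measurable. *)
Definition inv_time (w : tup) : \bar R := (expR (- ln (fine (mean_free_time w))))%:E.

Lemma inv_timeE w : inv_time w = ((fine (mean_free_time w))^-1)%:E.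
Proof.
rewrite /inv_time expRN lnK// posrE.
by have := mean_free_time_gt0 w; rewrite -{1}(fineK (mean_free_time_fin w)) lte_fin.
Qed.

Lemma inv_time_ge0 w : (0 <= inv_time w)%E.
Proof. by rewrite lee_fin expR_ge0. Qed.

Lemma inv_timeK w : (inv_time w * mean_free_time w = 1)%E.
Proof.
have := mean_free_time_gt0 w; rewrite inv_timeE -(fineK (mean_free_time_fin w)) lte_fin /= => d0.
by rewrite -EFinM mulVf// gt_eqF.
Qed.

Lemma measurable_inv_time : measurable_fun setT inv_time.
Proof.
apply/measurable_EFinP.
have m1 : measurable_fun [set: tup] (fun w => fine (mean_free_time w) : mR).
  exact: (measurableT_comp (fine_measurable measurableT) measurable_mean_free_time).
have m2 : measurable_fun [set: tup] (fun w => ln (fine (mean_free_time w)) : mR).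
  exact: (measurableT_comp (@measurable_ln R) m1).
apply: (measurableT_comp (@measurable_expR R)).
exact: measurable_funN.
Qed.

Lemma inert_mul_inv (G : tup -> \bar R) :
  (forall j, j \in late -> inert right endpoint G j) ->
  forall j, j \in late -> inert right endpoint (fun w => G w * inv_time w)%E j.
Proof.
move=> iG j jl w y r1 r2; have E := inert_mean_free_time jl r1 r2.
by change (G (upd w j y) * inv_time (upd w j y) = G w * inv_time w)%E; rewrite (iG j jl w y r1 r2) /inv_time E.
Qed.

Let mright2 : measurable_fun [set: mR * mR] (fun z => right z.1 z.2).
Proof. by apply: measurable_right2. Qed.

Lemma swap_late (S : mR -> Prop) (G : tup -> \bar R) (g h : R -> mR -> mR -> \bar R) :
  measurable_fun setT G -> (forall w, 0 <= G w)%E ->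
  (forall j, j \in late -> inert right endpoint G j) ->
  (forall w, G w != 0%E -> S (endpoint w)) ->
  (forall s, measurable_fun [set: mR * mR] (fun z => g s z.1 z.2)) ->
  (forall s, measurable_fun [set: mR * mR] (fun z => h s z.1 z.2)) ->
  (forall (s : R) t y, 0 < s -> s <= 1/8 -> (0 <= g s t y)%E) ->
  (forall (s : R) t y, 0 < s -> s <= 1/8 -> (0 <= h s t y)%E) ->
  (forall (s : R) t y, 0 < s -> s <= 1/8 -> ~~ right t y -> (g s t y <= h s t y)%E) ->
  (forall (s : R) t, 0 < s -> s <= 1/8 -> S t -> (\int[lam]_y (cst_if (right t y) * g s t y) <=
                         \int[lam]_y (cst_if (right t y) * h s t y))%E) ->
  (\int[torus m]_w (G w * \prod_(j <- late) g (len j) (endpoint w) (tnth w j)) <=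
   \int[torus m]_w (G w * \prod_(j <- late) h (len j) (endpoint w) (tnth w j)))%E.
Proof.
move=> mG G0 iG GS mg mh g0 h0 gh IG.
apply: (@integral_swap_factors R m right mright2 endpoint measurable_endpoint S late G
  (fun j => g (len j)) (fun j => h (len j)) late_uniq mG G0 iG GS).
- by move=> j w y; exact: endpoint_upd.
- by move=> j; exact: mg.
- by move=> j t y; apply: g0; [exact: len_gt0|exact: len_le].
- by move=> j; exact: mh.
- by move=> j t y; apply: h0; [exact: len_gt0|exact: len_le].
- by move=> j t y; apply: gh; [exact: len_gt0|exact: len_le].
- by move=> j t _; apply: IG; [exact: len_gt0|exact: len_le].
Qed.

(** Normalised by its conditional mean, the free time has a mean of at least 1 for any weight
    that does not see the late arcs to the right. *)
Lemma first_moment_ge :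
  (\int[torus m]_w F w <= \int[torus m]_w (F w * inv_time w * free_time w))%E.
Proof.
have mG : measurable_fun setT (fun w => F w * inv_time w)%E := emeasurable_funM mF measurable_inv_time.
have G0 w : (0 <= F w * inv_time w)%E by rewrite mule_ge0 ?inv_time_ge0.
rewrite (eq_integral (fun w => F w * inv_time w * mean_free_time w)%E); last first.
  by move=> w _; rewrite -muleA inv_timeK mule1.
rewrite /mean_free_time /free_time.
have E0 u : (0 <= early u)%E by exact: cst_if_ge0.
rewrite (tonelli_weight (torus m) lam mG G0 measurable_early E0 (measurable_late_prod2 jm_alive_mean)); last by move=> w u; exact: late_mean_ge0.
rewrite (tonelli_weight (torus m) lam mG G0 measurable_early E0 (measurable_late_prod2 jm_alive)); last by move=> w u; exact: late_alive_ge0.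
have mI g : jointly_measurable g -> (forall u w, 0 <= late_prod g u w)%E ->
    measurable_fun setT (fun u => early u * \int[torus m]_w (F w * inv_time w * late_prod g u w))%E.
  move=> mg g0; apply: (emeasurable_funM measurable_early).
  have mP : measurable_fun [set: mR * tup] (fun z => late_prod g z.1 z.2) by apply: measurable_late_prod.
  have mP2 : measurable_fun [set: mR * tup] (fun z => F z.2 * inv_time z.2 * late_prod g z.1 z.2)%E.
    exact: (emeasurable_funM (measurableT_comp mG measurable_snd) mP).
  by apply: (measurable_fun_fubini_tonelli_F _ mP2) => z; rewrite mule_ge0.
apply: ge0_le_integral => //.
- by move=> u _; rewrite mule_ge0//; apply: integral_ge0 => w _; rewrite mule_ge0 ?late_mean_ge0.
- exact: (mI _ jm_alive_mean late_mean_ge0).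
- exact: (mI _ jm_alive late_alive_ge0).
move=> u _; rewrite /cst_if; case: ifP => [/andP[u0 ue]|_]; last by rewrite !mul0e.
rewrite !mul1e.
have iG : forall j, j \in late -> inert right endpoint (fun w => F w * inv_time w)%E j := inert_mul_inv iF.
have ms s : measurable_fun [set: mR * mR] (fun z => alive_mean s u z.1 z.2) :=
  jm_alive_mean s (measurable_cst u) measurable_fst measurable_snd.
have ma s : measurable_fun [set: mR * mR] (fun z => alive s u z.1 z.2) :=
  jm_alive s (measurable_cst u) measurable_fst measurable_snd.
have s0 (s : R) t y : 0 < s -> s <= 1/8 -> (0 <= alive_mean s u t y)%E by move=> _; exact: alive_mean_ge0.
have a0 (s : R) t y : 0 < s -> s <= 1/8 -> (0 <= alive s u t y)%E by move=> _ _; exact: cst_if_ge0.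
have le0 (s : R) t y : 0 < s -> s <= 1/8 -> ~~ right t y -> (alive_mean s u t y <= alive s u t y)%E.
  by move=> _ _ /negbTE r; rewrite /alive_mean /alive /hit r.
have IG (s : R) (t : mR) : 0 < s -> s <= 1/8 -> True -> (\int[lam]_y (cst_if (right t y) * alive_mean s u t y) <=
   \int[lam]_y (cst_if (right t y) * alive s u t y))%E.
  move=> s0' s1 _; apply: alive_mean_le => //.
  by apply: (lt_le_trans ue); have h := eps1; lra.
exact: (@swap_late (fun=> True) _ (fun s t y => alive_mean s u t y) (fun s t y => alive s u t y)
  mG G0 iG (fun _ _ => I) ms ma s0 a0 le0 IG).
Qed.

Let A u w := late_prod (fun s u t y => alive s u t y) u w.
Let M u w := late_prod (fun s u t y => alive_mean s u t y) u w.

Definition ordered (z : mR * mR) : \bar R := (early z.1 * early z.2 * cst_if (z.1 <= z.2)%R)%E.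

Lemma ordered_ge0 z : (0 <= ordered z)%E.
Proof. by rewrite !mule_ge0 ?cst_if_ge0. Qed.

Lemma measurable_ordered : measurable_fun setT ordered.
Proof.
have m1 : measurable_fun [set: mR * mR] (fun z => early z.1) := measurableT_comp measurable_early measurable_fst.
have m2 : measurable_fun [set: mR * mR] (fun z => early z.2) := measurableT_comp measurable_early measurable_snd.
have m3 : measurable_fun [set: mR * mR] (fun z : mR * mR => cst_if (z.1 <= z.2)%R).
  by apply: measurable_cst_if; exact: measurable_fun_ler.
exact: (emeasurable_funM (emeasurable_funM m1 m2) m3).
Qed.

Lemma free_time_sq_le w :
  (free_time w * free_time w <= 2%:E * \int[lam \x lam]_z (ordered z * (A z.1 w * A z.2 w)))%E.
Proof.
have A0 u : (0 <= A u w)%E by exact: late_alive_ge0.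
have mA1 : measurable_fun setT (fun u => A u w) := measurable_late_prod1 w jm_alive.
have mf : measurable_fun setT (fun u => early u * A u w)%E := emeasurable_funM measurable_early mA1.
have f0 u : (0 <= early u * A u w)%E by rewrite mule_ge0 ?cst_if_ge0.
apply: le_trans (square_le_twice mf f0) _.
rewrite le_eqVlt; apply/orP; left; apply/eqP; congr (_ * _)%E.
have mg : measurable_fun setT (fun z : mR * mR => ordered z * (A z.1 w * A z.2 w))%E.
  apply: (emeasurable_funM measurable_ordered).
  exact: (emeasurable_funM (measurableT_comp mA1 measurable_fst) (measurableT_comp mA1 measurable_snd)).
have g0 z : (0 <= ordered z * (A z.1 w * A z.2 w))%E by rewrite mule_ge0 ?ordered_ge0// mule_ge0.
rewrite (fubini_tonelli1 _ mg g0); apply: eq_integral => u _; rewrite /fubini_F/=.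
rewrite -ge0_integralZl//.
- apply: eq_integral => v _; rewrite /ordered /=.
  by rewrite -!muleA; congr (_ * _)%E; rewrite muleCA; congr (_ * _)%E; rewrite muleA muleC.
- apply: (emeasurable_funM mf).
  have m3 : measurable_fun [set: mR * mR] (fun z : mR * mR => cst_if (z.1 <= z.2)%R).
    by apply: measurable_cst_if; exact: measurable_fun_ler.
  exact: (measurableT_comp m3 (measurable_pair1 u)).
- by move=> v _; rewrite mule_ge0 ?cst_if_ge0.
Qed.

(** Change of variable from (u, v) to (u, v - u) on the ordered pairs. *)
Lemma mean_free_time_sq_ge w :
  (\int[lam \x lam]_z (ordered z * (M z.1 w * M (z.2 - z.1)%R w)) <= mean_free_time w * mean_free_time w)%E.
Proof.
have M0 u : (0 <= M u w)%E by exact: late_mean_ge0.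
have mM1 : measurable_fun setT (fun u => M u w) := measurable_late_prod1 w jm_alive_mean.
have mh : measurable_fun setT (fun u => early u * M u w)%E := emeasurable_funM measurable_early mM1.
have h0 u : (0 <= early u * M u w)%E by rewrite mule_ge0 ?cst_if_ge0.
have mg2 : measurable_fun [set: mR * mR] (fun z : mR * mR => M (z.2 - z.1)%R w).
  by apply: (measurableT_comp mM1 (g := fun z : mR * mR => z.2 - z.1)); exact: measurable_funB.
have mg : measurable_fun setT (fun z : mR * mR => ordered z * (M z.1 w * M (z.2 - z.1)%R w))%E.
  exact: (emeasurable_funM measurable_ordered (emeasurable_funM (measurableT_comp mM1 measurable_fst) mg2)).
have g0 z : (0 <= ordered z * (M z.1 w * M (z.2 - z.1)%R w))%E by rewrite mule_ge0 ?ordered_ge0// mule_ge0.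
have D0 : (0 <= mean_free_time w)%E by apply: ltW; exact: mean_free_time_gt0.
rewrite (fubini_tonelli1 _ mg g0).
rewrite {1}/mean_free_time -ge0_integralZr; [|exact: measurableT|exact: mh|by move=> u _; exact: h0|exact: D0].
apply: ge0_le_integral; first exact: measurableT.
- by move=> u _; apply: integral_ge0 => v _; exact: g0.
- exact: (measurable_fun_fubini_tonelli_F _ mg g0).
- by apply: emeasurable_funM.
move=> u _; rewrite /fubini_F /ordered /=.
rewrite /cst_if; have [/andP[u0 ue]|_] := boolP (0 <= u < eps); last first.
  by under eq_integral do rewrite !mul0e; rewrite integral0 !mul0e.
rewrite (eq_integral (fun v => M u w * (early v * cst_if (u <= v)%R * M (v - u)%R w))%E); last first.
  by move=> v _; rewrite mul1e muleCA.
have mgu : measurable_fun setT (fun v => early v * cst_if (u <= v)%R * M (v - u)%R w)%E.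
  apply: emeasurable_funM; last exact: (measurableT_comp mg2 (measurable_pair1 u)).
  apply: (emeasurable_funM measurable_early).
  have m3 : measurable_fun [set: mR * mR] (fun z : mR * mR => cst_if (z.1 <= z.2)%R).
    by apply: measurable_cst_if; exact: measurable_fun_ler.
  exact: (measurableT_comp m3 (measurable_pair1 u)).
have gu0 v : (0 <= early v * cst_if (u <= v)%R * M (v - u)%R w)%E by rewrite !mule_ge0 ?cst_if_ge0.
rewrite ge0_integralZl; [|exact: measurableT|exact: mgu|by move=> v _; exact: gu0|exact: M0].
rewrite mul1e; apply: lee_wpmul2l; first exact: M0.
rewrite /mean_free_time -[leRHS](integral_rotate u mh h0).
apply: ge0_le_integral; first exact: measurableT.
- by move=> v _; exact: gu0.
- exact: mgu.
- exact: (measurableT_comp mh (measurable_circle_map _)).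
move=> v _; rewrite /cst_if; have [/andP[v0 ve]|_] := boolP (0 <= v < eps); last by rewrite !mul0e; exact: h0.
have [uv|_] := boolP (u <= v); last by rewrite mule0 mul0e; exact: h0.
have h := eps1.
by rewrite mod1_id ?ifT ?mul1e//; lra.
Qed.

(** For u <= v, [alive2_mean_le] bounds the probability that u and v both survive by the
    product of the means at u and at v - u.  Up to the factor 2 that comes from the ordering of
    u and v, the integral of this product is at most the square of the mean. *)
Lemma second_moment_le :
  (\int[torus m]_w (F w * inv_time w * inv_time w * (free_time w * free_time w)) <=
   2%:E * \int[torus m]_w F w)%E.
Proof.
have mG : measurable_fun setT (fun w => F w * inv_time w * inv_time w)%E :=
  emeasurable_funM (emeasurable_funM mF measurable_inv_time) measurable_inv_time.
have G0 w : (0 <= F w * inv_time w * inv_time w)%E by rewrite !mule_ge0 ?inv_time_ge0.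
have iG : forall j, j \in late -> inert right endpoint (fun w => F w * inv_time w * inv_time w)%E j :=
  inert_mul_inv (inert_mul_inv iF).
have A0 u w : (0 <= A u w)%E by exact: late_alive_ge0.
have M0 u w : (0 <= M u w)%E by exact: late_mean_ge0.
have mAg : measurable_fun [set: tup * (mR * mR)] (fun z => A z.2.1 z.1 * A z.2.2 z.1)%E.
  apply: emeasurable_funM; apply: (measurable_late_prod jm_alive).
  - exact: (measurableT_comp measurable_fst measurable_snd).
  - exact: measurable_fst.
  - exact: (measurableT_comp measurable_snd measurable_snd).
  - exact: measurable_fst.
have mMg : measurable_fun [set: tup * (mR * mR)] (fun z => M z.2.1 z.1 * M (z.2.2 - z.2.1)%R z.1)%E.
  apply: emeasurable_funM; apply: (measurable_late_prod jm_alive_mean).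
  - exact: (measurableT_comp measurable_fst measurable_snd).
  - exact: measurable_fst.
  - apply: measurable_funB; last exact: (measurableT_comp measurable_fst measurable_snd).
    exact: (measurableT_comp measurable_snd measurable_snd).
  - exact: measurable_fst.
have Ag0 w (z : mR * mR) : (0 <= A z.1 w * A z.2 w)%E by rewrite mule_ge0.
have Mg0 w (z : mR * mR) : (0 <= M z.1 w * M (z.2 - z.1)%R w)%E by rewrite mule_ge0.
have TA := tonelli_weight (torus m) (lam \x lam)%E mG G0 measurable_ordered ordered_ge0 mAg Ag0.
have TM := tonelli_weight (torus m) (lam \x lam)%E mG G0 measurable_ordered ordered_ge0 mMg Mg0.
have mI (g : tup -> mR * mR -> \bar R) : measurable_fun [set: tup * (mR * mR)] (fun z => g z.1 z.2) ->
    (forall w z, 0 <= g w z)%E ->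
    measurable_fun setT (fun z => ordered z * \int[torus m]_w (F w * inv_time w * inv_time w * g w z))%E.
  move=> mg g0; apply: (emeasurable_funM measurable_ordered).
  have mP : measurable_fun [set: tup * (mR * mR)] (fun z => F z.1 * inv_time z.1 * inv_time z.1 * g z.1 z.2)%E.
    exact: (emeasurable_funM (measurableT_comp mG measurable_fst) mg).
  by apply: (measurable_fun_fubini_tonelli_G _ mP) => z; rewrite mule_ge0.
have mI2 (g : tup -> mR * mR -> \bar R) : measurable_fun [set: tup * (mR * mR)] (fun z => g z.1 z.2) ->
    (forall w z, 0 <= g w z)%E ->
    measurable_fun setT (fun w => \int[lam \x lam]_z (ordered z * g w z))%E.
  exact: (measurable_integral_weight (lam \x lam)%E measurable_ordered ordered_ge0).
have i0 (g : tup -> mR * mR -> \bar R) w : (forall w z, 0 <= g w z)%E ->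
    (0 <= \int[lam \x lam]_z (ordered z * g w z))%E.
  by move=> g0; apply: integral_ge0 => z _; rewrite mule_ge0 ?ordered_ge0.
have two0 : (0 <= 2%:E :> \bar R)%E by rewrite lee_fin.
have mLA : measurable_fun setT (fun w => F w * inv_time w * inv_time w * \int[lam \x lam]_z (ordered z * (A z.1 w * A z.2 w)))%E.
  exact: (emeasurable_funM mG (mI2 _ mAg Ag0)).
apply: (@le_trans _ _ (\int[torus m]_w (2%:E * (F w * inv_time w * inv_time w * \int[lam \x lam]_z (ordered z * (A z.1 w * A z.2 w)))))%E).
  apply: ge0_le_integral; first exact: measurableT.
  - by move=> w _; rewrite mule_ge0// mule_ge0 ?free_time_ge0.
  - exact: (emeasurable_funM mG (emeasurable_funM measurable_free_time measurable_free_time)).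
  - exact: (emeasurable_funM (measurable_cst _) mLA).
  move=> w _; rewrite [leRHS]muleCA; apply: lee_wpmul2l; [exact: G0|exact: free_time_sq_le].
rewrite ge0_integralZl; [|exact: measurableT|exact: mLA| |exact: two0]; last first.
  by move=> w _; rewrite mule_ge0// (i0 (fun w z => A z.1 w * A z.2 w)%E).
apply: lee_wpmul2l; first exact: two0.
rewrite TA.
apply: (@le_trans _ _ (\int[lam \x lam]_z (ordered z * \int[torus m]_w (F w * inv_time w * inv_time w * (M z.1 w * M (z.2 - z.1)%R w))))%E).
  apply: ge0_le_integral; first exact: measurableT.
  - by move=> z _; rewrite mule_ge0 ?ordered_ge0//; apply: integral_ge0 => w _; rewrite mule_ge0.
  - exact: (mI _ mAg Ag0).
  - exact: (mI _ mMg Mg0).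
  move=> -[u v] _; rewrite /ordered /cst_if /=.
  have [/andP[u0 ue]|_] := boolP (0 <= u < eps); last by rewrite !mul0e.
  have [/andP[v0 ve]|_] := boolP (0 <= v < eps); last by rewrite mule0 !mul0e.
  have [uv|_] := boolP (u <= v); last by rewrite mule0 !mul0e.
  rewrite !mul1e.
  under eq_integral do rewrite /A /late_prod -big_split/=.
  under [leRHS]eq_integral do rewrite /M /late_prod -big_split/=.
  have ms s : measurable_fun [set: mR * mR] (fun z => alive_mean s u z.1 z.2 * alive_mean s (v - u)%R z.1 z.2)%E.
    exact: (emeasurable_funM (jm_alive_mean s (measurable_cst u) measurable_fst measurable_snd)
      (jm_alive_mean s (measurable_cst (v - u)%R) measurable_fst measurable_snd)).
  have ma s : measurable_fun [set: mR * mR] (fun z => alive s u z.1 z.2 * alive s v z.1 z.2)%E.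
    exact: (emeasurable_funM (jm_alive s (measurable_cst u) measurable_fst measurable_snd)
      (jm_alive s (measurable_cst v) measurable_fst measurable_snd)).
  have s0 (s : R) t y : 0 < s -> s <= 1/8 -> (0 <= alive_mean s u t y * alive_mean s (v - u)%R t y)%E.
    by move=> _ s1; rewrite mule_ge0// alive_mean_ge0.
  have a0 (s : R) t y : 0 < s -> s <= 1/8 -> (0 <= alive s u t y * alive s v t y)%E.
    by move=> _ _; rewrite mule_ge0// cst_if_ge0.
  have le0 (s : R) t y : 0 < s -> s <= 1/8 -> ~~ right t y ->
      (alive s u t y * alive s v t y <= alive_mean s u t y * alive_mean s (v - u)%R t y)%E.
    by move=> _ _ /negbTE r; rewrite /alive_mean /alive /hit r.
  have IG (s : R) (t : mR) : 0 < s -> s <= 1/8 -> True ->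
     (\int[lam]_y (cst_if (right t y) * (alive s u t y * alive s v t y)) <=
      \int[lam]_y (cst_if (right t y) * (alive_mean s u t y * alive_mean s (v - u)%R t y)))%E.
    move=> s0' s1 _; apply: alive2_mean_le => //.
    by apply: (lt_le_trans ve); have h := eps1; lra.
  exact: (@swap_late (fun=> True) _ (fun s t y => alive s u t y * alive s v t y)%E
     (fun s t y => alive_mean s u t y * alive_mean s (v - u)%R t y)%E
    mG G0 iG (fun _ _ => I) ma ms a0 s0 le0 IG).
rewrite -TM; apply: ge0_le_integral; first exact: measurableT.
- by move=> w _; rewrite mule_ge0// (i0 (fun w z => M z.1 w * M (z.2 - z.1)%R w)%E).
- exact: (emeasurable_funM mG (mI2 _ mMg Mg0)).
- exact: mF.
move=> w _; apply: le_trans (lee_wpmul2l (G0 w) (mean_free_time_sq_ge w)) _.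
rewrite -!muleA [(inv_time w * _)%E in X in (_ * X)%E]muleA.
have K := inv_timeK w.
rewrite (_ : _ * (mean_free_time w * mean_free_time w) = (inv_time w * mean_free_time w) * (inv_time w * mean_free_time w))%E; last first.
  by rewrite muleACA.
by rewrite K !mule1.
Qed.

Definition enough_time (w : tup) : bool := fine (mean_free_time w) <= 4 * fine (free_time w).

Lemma measurable_enough_time : measurable_fun setT enough_time.
Proof.
have m1 : measurable_fun [set: tup] (fun w => fine (mean_free_time w) : mR).
  exact: (measurableT_comp (fine_measurable measurableT) measurable_mean_free_time).
have m2 : measurable_fun [set: tup] (fun w => 4 * fine (free_time w) : mR).
  apply: measurable_funM => //.
  exact: (measurableT_comp (fine_measurable measurableT) measurable_free_time).
exact: (measurable_fun_ler m1 m2).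
Qed.

(** With the weight F, the normalised free time has mean at least 1 and second moment at
    most 2. *)
Lemma paley_zygmund : (\int[torus m]_w F w < +oo)%E ->
  (\int[torus m]_w F w <= 4%:E * \int[torus m]_w (F w * cst_if (enough_time w)))%E.
Proof.
move=> Ffin.
have X0 : (0 <= \int[torus m]_w F w)%E by apply: integral_ge0.
have Xf : (\int[torus m]_w F w)%E \is a fin_num by rewrite ge0_fin_numE.
have mC : measurable_fun setT (fun w => F w * cst_if (enough_time w))%E.
  by apply: (emeasurable_funM mF); apply: measurable_cst_if; exact: measurable_enough_time.
have C0 w : (0 <= F w * cst_if (enough_time w))%E by rewrite mule_ge0 ?cst_if_ge0.
have Z0 : (0 <= \int[torus m]_w (F w * cst_if (enough_time w)))%E by apply: integral_ge0.
have Zf : (\int[torus m]_w (F w * cst_if (enough_time w)))%E \is a fin_num.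
  rewrite ge0_fin_numE//; apply: le_lt_trans Ffin; apply: ge0_le_integral => //.
  by move=> w _; rewrite /cst_if; case: ifP; rewrite ?mule1 ?mule0.
have mS : measurable_fun setT (fun w => F w * inv_time w * inv_time w * (free_time w * free_time w))%E.
  apply: (emeasurable_funM (emeasurable_funM (emeasurable_funM mF measurable_inv_time) measurable_inv_time)).
  exact: (emeasurable_funM measurable_free_time measurable_free_time).
have S0 w : (0 <= F w * inv_time w * inv_time w * (free_time w * free_time w))%E.
  by rewrite mule_ge0 ?mule_ge0 ?inv_time_ge0 ?free_time_ge0.
have H : (\int[torus m]_w F w <= (1/4)%:E * \int[torus m]_w F w + (1/8)%:E * (2%:E * \int[torus m]_w F w) +
   2%:E * \int[torus m]_w (F w * cst_if (enough_time w)))%E.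
  apply: le_trans first_moment_ge _.
  apply: (@le_trans _ _ (\int[torus m]_w ((1/4)%:E * F w +
     (1/8)%:E * (F w * inv_time w * inv_time w * (free_time w * free_time w)) +
     2%:E * (F w * cst_if (enough_time w))))%E).
    apply: ge0_le_integral; first exact: measurableT.
    - by move=> w _; rewrite mule_ge0 ?mule_ge0 ?inv_time_ge0 ?free_time_ge0.
    - exact: (emeasurable_funM (emeasurable_funM mF measurable_inv_time) measurable_free_time).
    - apply: (emeasurable_funD (emeasurable_funD (emeasurable_funM (measurable_cst _) mF) (emeasurable_funM (measurable_cst _) mS)) (emeasurable_funM (measurable_cst _) mC)).
    move=> w _; rewrite inv_timeE /enough_time.
    have := mean_free_time_gt0 w; have := free_time_ge0 w.
    rewrite -(fineK (mean_free_time_fin w)) -(fineK (free_time_fin w)) lte_fin lee_fin /=.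
    move: (fine (mean_free_time w)) (fine (free_time w)) (F0 w) => y x Fw x0 y0.
    have h := paley_zygmund_pointwise y0 x0; move: h; rewrite -[y^-1 * y^-1 * _]mulrA => h.
    rewrite -!muleA -!EFinM; apply: weighted_pointwise => //.
    by rewrite !mulr_ge0 ?invr_ge0 ?(ltW y0).
  rewrite ge0_integralD//; last 4 first.
  - by move=> w _; rewrite adde_ge0// mule_ge0// lee_fin.
  - exact: (emeasurable_funD (emeasurable_funM (measurable_cst _) mF) (emeasurable_funM (measurable_cst _) mS)).
  - by move=> w _; rewrite mule_ge0// lee_fin.
  - exact: (emeasurable_funM (measurable_cst _) mC).
  rewrite ge0_integralD//; last 4 first.
  - by move=> w _; rewrite mule_ge0// lee_fin.
  - exact: (emeasurable_funM (measurable_cst _) mF).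
  - by move=> w _; rewrite mule_ge0// lee_fin.
  - exact: (emeasurable_funM (measurable_cst _) mS).
  rewrite !ge0_integralZl//; try by rewrite lee_fin.
  rewrite leeD2r// leeD2l// lee_wpmul2l// ?lee_fin//.
  exact: second_moment_le.
move: H; rewrite -(fineK Xf) -(fineK Zf) -!EFinM -!EFinD !lee_fin; lra.
Qed.

End paley_zygmund.

(** * The leftmost gap of a window *)

Section first_gap.
Variable R : realType.
Local Notation mR := (measurableTypeR R).
Local Notation lam := (@circle_lebesgue R).
Local Notation torus n := (torus_lebesgue R n).
Local Notation cst_if := (@cst_if R).
Local Notation right := (@right R).

(** To cover s or to end in [a, t] the arc would have to go more than three eighths of the way
    around the circle. *)
Lemma right_arc_inert (a t s y lam_ : R) : 0 <= a -> a + 1/8 <= 1 -> a <= s -> s <= t -> t <= a + 1/8 ->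
  right t y -> 0 < lam_ -> lam_ <= 1/8 -> ~~ (0 < mod1 (s - y) < lam_) /\ ~~ (a <= mod1 (y + lam_) <= t).
Proof.
move=> a0 a1 as_ st ta; rewrite /right; have := mod1_ge0 (y - t).
move E : (mod1 (y - t)) => x x0 x1 p0 p1; split.
- have -> : mod1 (s - y) = mod1 ((s - t) - x).
    by rewrite -E mod1Br; congr mod1; ring.
  have [h|h] := ltP ((s - t) - x) 0.
    by rewrite mod1_shiftN1; lra.
  by rewrite mod1_id; lra.
have -> : mod1 (y + lam_) = mod1 ((t + lam_) + x).
  by rewrite -E mod1Dr; congr mod1; ring.
have [h|h] := ltP ((t + lam_) + x) 1.
  by rewrite mod1_id; lra.
by rewrite mod1_shift1; lra.
Qed.

(** An arc that contains t + u but not t starts between these points. *)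
Lemma uncovered_after (t u y lam_ : R) : 0 <= u -> u < mod1 (y - t) ->
  ~~ (0 < mod1 (t - y) < lam_) -> ~~ (0 < mod1 (t + u - y) < lam_).
Proof.
move=> u0 ux; have x1 := mod1_lt1 (y - t).
have E1 : mod1 (t - y) = 1 - mod1 (y - t).
  by rewrite -mod1N ?(le_lt_trans u0 ux)//; congr mod1; ring.
have E2 : mod1 (t + u - y) = u + 1 - mod1 (y - t).
  rewrite mod1_rotate mod1_shiftN1; lra.
rewrite E1 E2; lra.
Qed.

Lemma measurable_all d (T : measurableType d) (I : Type) (s : seq I) (p : I -> T -> bool) :
  (forall i, measurable_fun setT (p i)) -> measurable_fun setT (fun x => all (p ^~ x) s).
Proof.
move=> mp; elim: s => [|i s IH] /=; first exact: measurable_cst.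
by apply: measurable_and.
Qed.

Variable l : nat -> R.
Hypothesis l01 : forall n, 0 < l n < 1.
Variables (m n : nat).
Hypothesis lsmall : forall j, (n <= j)%N -> l j <= 1/8.
Local Notation tup := (m.-tuple mR).
Variables (a eps : R).
Hypotheses (a0 : 0 <= a) (a1 : a + 1/8 <= 1) (eps0 : 0 < eps) (eps1 : eps <= 1/4).

Local Notation endp := (@endpoint R l m).

Definition covered (w : tup) (s : mR) : bool :=
  ~~ all (fun j : 'I_m => ~~ (0 < mod1 (s - tnth w j) < l j)) (enum 'I_m).

(** The end of arc k is the leftmost gap seen in the window.  Ties are broken by the index, so
    that at most one k qualifies.  The last condition keeps the first n arcs, which may be long,
    away from the points just beyond the gap. *)
Definition first_gap (k : 'I_m) (w : tup) : bool :=
  [&& a <= endp k w, endp k w <= a + 1/8, ~~ covered w (endp k w),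
   all (fun j => ~~ ((a <= endp j w) && (endp j w < endp k w)) || covered w (endp j w)) (enum 'I_m),
   all (fun j : 'I_m => ~~ (j < k)%N || ~~ (endp j w == endp k w)) (enum 'I_m) &
   all (fun j : 'I_m => ~~ (j < n)%N || (eps <= mod1 (tnth w j - endp k w))) (enum 'I_m)].

Lemma measurable_covered d (T : measurableType d) (w : T -> tup) (s : T -> mR) :
  measurable_fun setT w -> measurable_fun setT s -> measurable_fun setT (fun z => covered (w z) (s z)).
Proof.
move=> mw ms; apply: measurable_neg; apply: measurable_all => j; apply: measurable_neg.
by apply: measurable_alive => //; exact: (measurableT_comp (measurable_tnth j) mw).
Qed.

Lemma measurable_first_gap k : measurable_fun setT (first_gap k).
Proof.
have me j : measurable_fun setT (endp j) := measurable_endpoint l j.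
have mc j : measurable_fun setT (fun w => covered w (endp j w)) by exact: measurable_covered.
apply: measurable_and; first exact: (measurable_fun_ler (measurable_cst a) (me k)).
apply: measurable_and; first exact: (measurable_fun_ler (me k) (measurable_cst (a + 1/8))).
apply: measurable_and; first exact: measurable_neg.
apply: measurable_and.
  apply: measurable_all => j; apply: measurable_or => //; apply: measurable_neg; apply: measurable_and.
    exact: (measurable_fun_ler (measurable_cst a) (me j)).
  exact: (measurable_fun_ltr (me j) (me k)).
apply: measurable_and.
  apply: measurable_all => j; apply: measurable_or => //; apply: measurable_neg.
  exact: (measurable_fun_eqr (me j) (me k)).
apply: measurable_all => j; apply: measurable_or => //.
apply: (measurable_fun_ler (measurable_cst eps)).
apply: (measurableT_comp (@measurable_mod1 R)); apply: measurable_funB; [exact: measurable_tnth|exact: me].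
Qed.

(** Late arcs that start to the right of the gap neither cover nor end at a point between a
    and the gap. *)
Lemma first_gap_inert k j w y : j \in late n k ->
  right (endp k w) (tnth w j) -> right (endp k w) y ->
  first_gap k (upd w j y) = first_gap k w.
Proof.
move=> jl r1 r2; have /andP[nj jk] : (n <= j)%N && (j != k) by rewrite -lateP.
have tk : endp k (upd w j y) = endp k w by apply: (@endpoint_upd _ _ _ n).
rewrite /first_gap tk; set t := endp k w in r1 r2 *.
have [ta|//] := boolP (a <= t); have [tb|//] := boolP (t <= a + 1/8).
have p0 : 0 < l j by have /andP[] := l01 j.
have p1 := lsmall nj.
have I1 s (h : a <= s) (h' : s <= t) := right_arc_inert a0 a1 h h' tb r1 p0 p1.
have I2 s (h : a <= s) (h' : s <= t) := right_arc_inert a0 a1 h h' tb r2 p0 p1.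
have cov s : a <= s -> s <= t -> covered (upd w j y) s = covered w s.
  move=> h1 h2; congr (~~ _); apply: eq_all => i; rewrite tnth_upd; case: eqP => // ->.
  by rewrite (I1 s h1 h2).1 (I2 s h1 h2).1.
have ej : (endp j w == t = false) /\ (a <= endp j w) && (endp j w < t) = false.
  have := (I1 t ta (lexx t)).2; rewrite -/(endp j w) => h.
  by split; apply: contraNF h; [move=> /eqP ->; rewrite ta lexx|move=> /andP[-> /ltW]].
have ej' : (endp j (upd w j y) == t = false) /\ (a <= endp j (upd w j y)) && (endp j (upd w j y) < t) = false.
  have := (I2 t ta (lexx t)).2; rewrite -[mod1 (y + l j)](_ : endp j (upd w j y) = _); last first.
    by rewrite /endpoint tnth_upd eqxx.
  move=> h; by split; apply: contraNF h; [move=> /eqP ->; rewrite ta lexx|move=> /andP[-> /ltW]].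
have ei i : i != j -> endp i (upd w j y) = endp i w.
  by move=> ij; rewrite /endpoint tnth_upd (negbTE ij).
congr [&& _, _, _, _ , _ & _].
- by rewrite cov.
- apply: eq_all => i; have [->|ij] := eqVneq i j; first by rewrite ej.2 ej'.2.
  rewrite ei//; have [/andP[h1 h2]|//] := boolP ((a <= endp i w) && (endp i w < t)).
  by rewrite cov// ltW.
- apply: eq_all => i; have [->|ij] := eqVneq i j; first by rewrite ej.1 ej'.1.
  by rewrite ei.
apply: eq_all => i; rewrite tnth_upd; case: eqP => // ->.
by rewrite ltnNge nj.
Qed.

Lemma first_gap_unique k k' w : first_gap k w -> first_gap k' w -> k = k'.
Proof.
wlog kk : k k' / endp k w <= endp k' w.
  by move=> H h h'; have [/H|/ltW/H] := leP (endp k w) (endp k' w); [exact|move=> ->].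
move=> /and5P[ak _ nk _ /andP[tie _]] /and5P[_ _ _ all' /andP[tie' _]].
have [lt|] := ltP (endp k w) (endp k' w).
  have := allP all' k (mem_enum _ _); rewrite ak lt /= => c; by rewrite c in nk.
move=> ge; have E : endp k w = endp k' w by apply/eqP; rewrite eq_le kk ge.
have := allP tie k' (mem_enum _ _); have := allP tie' k (mem_enum _ _).
rewrite E eqxx /= !orbF -!leqNgt => h1 h2; apply: val_inj; apply/eqP.
by rewrite eqn_leq h1 h2.
Qed.

Lemma sum_first_gap_le1 w (x : \bar R) : (0 <= x)%E ->
  (\sum_(k < m) (cst_if (first_gap k w) * x) <= x)%E.
Proof.
move=> x0; have [[k fk]|nk] := pselect (exists k, first_gap k w).
  rewrite (bigD1 k)//= big1 ?adde0; first by rewrite fk mul1e.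
  move=> i ik; rewrite /cst_if ifN ?mul0e//; apply: contraNN ik => fi; apply/eqP; exact: first_gap_unique fi fk.
rewrite big1// => k _; rewrite /cst_if ifN ?mul0e//; apply/negP => fk; apply: nk; by exists k.
Qed.

Definition wseq (w : tup) (j : nat) : R := nth 0 w j.

Definition density (w : tup) (t : R) : R := dvoretzky_density l (wseq w) m t.

Lemma densityE w t : density w t =
  \prod_(j < m) ((if 0 < mod1 (t - tnth w j) < l j then 0 else 1) / (1 - l j)).
Proof.
by apply: eq_bigr => j _; rewrite dvoretzky_factorE /wseq -tnth_nth.
Qed.

Lemma inv_len_ge1 j : 1 <= (1 - l j)^-1.
Proof. by have /andP[p0 p1] := l01 j; rewrite -invr1 lef_pV2 ?posrE; lra. Qed.

Lemma density_ge0 w t : 0 <= density w t.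
Proof.
rewrite densityE; apply: prodr_ge0 => j _; rewrite mulr_ge0//; first by case: ifP.
by have := inv_len_ge1 j; lra.
Qed.

Lemma density_le w t : density w t <= \prod_(j < m) (1 - l j)^-1.
Proof.
rewrite densityE; apply: ler_prod => j _; have := inv_len_ge1 j.
by case: ifP => _ h; rewrite ?mul0r ?mul1r lexx; lra.
Qed.

Lemma measurable_density : measurable_fun [set: tup * mR] (fun z => density z.1 z.2 : mR).
Proof.
under eq_fun do rewrite densityE.
apply: measurable_prod => j _; apply: measurable_funM => //; apply: measurable_fun_ifT => //.
apply: measurable_alive; first exact: measurable_snd.
exact: (measurableT_comp (measurable_tnth j) measurable_fst).
Qed.

Definition mass (w : tup) : R := \int[lam]_t density w t.

Lemma massE w : ((mass w)%:E = \int[lam]_t (density w t)%:E)%E.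
Proof.
have md : measurable_fun setT (fun t : mR => density w t : mR).
  exact: (measurableT_comp measurable_density (measurable_pair1 w)).
rewrite /mass /Rintegral fineK// ge0_fin_numE; last first.
  by apply: integral_ge0 => t _; rewrite lee_fin density_ge0.
apply: (@le_lt_trans _ _ (\int[lam]_t (\prod_(j < m) (1 - l j)^-1)%:E)%E); last first.
  by rewrite (integral_cst_probability lam) ltry.
apply: ge0_le_integral => //.
- by move=> t _; rewrite lee_fin density_ge0.
- exact/measurable_EFinP.
by move=> t _; rewrite lee_fin density_le.
Qed.

Lemma measurable_mass : measurable_fun setT (mass : tup -> mR).
Proof.
have mD : measurable_fun setT (fun w : tup => (\int[lam]_t (density w t)%:E)%E).
  apply: (measurable_fun_fubini_tonelli_F (fun z : tup * mR => (density z.1 z.2)%:E)).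
    by apply/measurable_EFinP; exact: measurable_density.
  by move=> z; rewrite lee_fin density_ge0.
exact: (measurableT_comp (fine_measurable measurableT) mD).
Qed.

Lemma prod_cst_if (I : Type) (s : seq I) (b : I -> bool) :
  (\prod_(i <- s) cst_if (b i) = cst_if (all b s))%E.
Proof.
elim: s => [|i s IH]; first by rewrite big_nil.
by rewrite big_cons IH /cst_if /=; case: (b i); rewrite ?mul1e ?mul0e.
Qed.

Definition late_gain (k : 'I_m) : R := \prod_(j <- late n k) (1 - l j)^-1.

Lemma late_gain_gt0 k : 0 < late_gain k.
Proof. by apply: prodr_gt0 => j _; have := inv_len_ge1 j; lra. Qed.

(** An arc that contains c + u, where c is the gap, must start between c and c + u, for it does
    not contain c.  Early arcs do not start there, and the late ones do not hit c + u. *)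
Lemma first_gap_survives k w (u : R) (j : 'I_m) : first_gap k w -> 0 <= u -> u < eps ->
  all (fun i : 'I_m => ~~ hit (len l i) u (endp k w) (tnth w i)) (late n k) ->
  ~~ (0 < mod1 (endp k w + u - tnth w j) < l j).
Proof.
move=> /and5P[_ _ nk _ /andP[_ start]] u0 ue free; set c := endp k w in nk start free *.
have nkj : ~~ (0 < mod1 (c - tnth w j) < l j).
  by move: nk; rewrite /covered negbK => /allP/(_ j (mem_enum _ _)).
have [ux|xu] := ltP u (mod1 (tnth w j - c)); first exact: uncovered_after.
have nj : (n <= j)%N.
  have := allP start j (mem_enum _ _); rewrite -leqNgt -/c => /orP[//|h].
  by have := le_lt_trans (le_trans h xu) ue; rewrite ltxx.
have jk : j != k.
  apply/eqP => jk; move: xu; rewrite jk /c /endpoint mod1Br.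
  have -> : tnth w k - (tnth w k + l k) = - l k by ring.
  have /andP[p0 p1] := l01 k; rewrite mod1_shiftN1; last lra.
  have := lsmall nj; rewrite jk; have h := eps1; lra.
have := allP free j; rewrite lateP nj jk => /(_ isT).
rewrite (lenE lsmall nj) /hit negb_and => /orP[|//].
by rewrite /right; have h := eps1; lra.
Qed.

(** The surviving points c + u are uncovered, and there the density is the full product of
    the normalisations. *)
Lemma mass_ge k w : first_gap k w -> ((late_gain k)%:E * free_time l n k eps w <= (mass w)%:E)%E.
Proof.
move=> fk; rewrite massE; set c := endp k w.
pose phi (u : mR) := (cst_if (0 <= u < eps)%R * late_prod l n k (fun s u t y => alive s u t y) u w)%E.
have phi0 u : (0 <= phi u)%E by rewrite mule_ge0 ?cst_if_ge0 ?late_alive_ge0.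
have mphi : measurable_fun setT phi.
  exact: (emeasurable_funM (measurable_early eps) (measurable_late_prod1 l n k w (@jm_alive R))).
have q0 : (0 <= (late_gain k)%:E)%E by rewrite lee_fin ltW// late_gain_gt0.
have mrot : measurable_fun setT (fun t : mR => phi (mod1 (t - c))).
  exact: (measurableT_comp mphi (measurable_circle_map _)).
have -> : free_time l n k eps w = (\int[lam]_t phi (mod1 (t - c)))%E.
  by rewrite integral_rotate.
rewrite -ge0_integralZl//.
apply: ge0_le_integral => //.
- by move=> t _; rewrite mule_ge0.
- exact: (emeasurable_funM (measurable_cst _) mrot).
- apply/measurable_EFinP; exact: (measurableT_comp measurable_density (measurable_pair1 w)).
move=> t _; rewrite /phi; set u := mod1 (t - c).
rewrite /late_prod /alive prod_cst_if {1}/cst_if.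
case: ifP => [/andP[u0 ue]|_]; last by rewrite mul0e mule0 lee_fin density_ge0.
rewrite mul1e /cst_if; case: ifP => [free|_]; last by rewrite mule0 lee_fin density_ge0.
rewrite mule1 lee_fin densityE /late_gain /late big_filter big_enum_cond big_mkcond/=.
apply: ler_prod => j _.
have -> : (0 < mod1 (t - tnth w j) < l j) = false.
  have tE : mod1 (t - tnth w j) = mod1 (c + u - tnth w j).
    have -> : c + u - tnth w j = u + (c - tnth w j) by ring.
    by rewrite /u mod1Dl; congr mod1; ring.
  by rewrite tE; apply/negbTE; exact: (first_gap_survives j fk u0 ue free).
by rewrite mul1r; case: ifP => _; have := inv_len_ge1 j; lra.
Qed.

Lemma mass_ge_thinning k w : first_gap k w -> enough_time l n k eps w ->
  eps / 4 * (thinning l n k w * late_gain k) <= mass w.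
Proof.
move=> fk; rewrite /enough_time => et; have := mass_ge fk.
have := mean_free_time_ge l n k eps0 eps1 w.
rewrite -(fineK (mean_free_time_fin l01 n k eps0 eps1 w)) -(fineK (free_time_fin l n k eps w)) -EFinM !lee_fin.
move: et; move: (fine _) (fine _) => M F MF M1 FM; apply: le_trans FM.
have -> : eps / 4 * (thinning l n k w * late_gain k) = late_gain k * (eps * thinning l n k w / 4) by ring.
by apply: ler_wpM2l; [exact/ltW/late_gain_gt0|lra].
Qed.

Definition late_all : seq 'I_m := [seq j : 'I_m <- enum 'I_m | (n <= j)%N].

Definition tilt_factor (j : nat) (y : mR) : R :=
  (1 - l j) * (1 + 4 * len l j * (if far_window a y then 1 else 0)).

Lemma tilt_factor_ge0 j y : 0 <= tilt_factor j y.
Proof.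
have /andP[p0 p1] := l01 j; have := len_gt0 l01 j.
by move=> s0; rewrite /tilt_factor mulr_ge0//; [lra|case: ifP => _; lra].
Qed.

(** A weight of mean at most 1, see [integral_tilt_le1], that on average dominates the inverse
    of the gain at any gap.  Since the weight does not depend on k, the sum over all gaps of
    its integrals is still at most 1. *)
Definition tilt (w : tup) : \bar R := (\prod_(j <- late_all) (tilt_factor j (tnth w j))%:E)%E.

Lemma measurable_tilt_factor d (T : measurableType d) j (y : T -> mR) : measurable_fun setT y ->
  measurable_fun setT (fun z => (tilt_factor j (y z))%:E).
Proof.
move=> my; apply/measurable_EFinP; apply: measurable_funM => //; apply: measurable_funD => //.
apply: measurable_funM => //; apply: measurable_fun_ifT => //.
exact: (measurableT_comp (measurable_far_window a) my).
Qed.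

Lemma measurable_tilt : measurable_fun setT tilt.
Proof.
apply: emeasurable_prod => j; apply: measurable_tilt_factor; exact: measurable_tnth.
Qed.

Lemma tilt_ge0 w : (0 <= tilt w)%E.
Proof. by apply: eprod_ge0 => j; rewrite lee_fin tilt_factor_ge0. Qed.

Lemma integral_tilt_factor j : (n <= j)%N ->
  (\int[lam]_y (tilt_factor j y)%:E = ((1 - l j) * (1 + l j))%:E)%E.
Proof.
move=> nj; have /andP[p0 p1] := l01 j.
have mw : measurable_fun setT (fun y => cst_if (far_window a y)).
  by apply: measurable_cst_if; exact: measurable_far_window.
have c0 : 0 <= 1 - l j by lra.
have c1 : 0 <= (1 - l j) * (4 * l j) by rewrite mulr_ge0//; lra.
rewrite (eq_integral (fun y => (1 - l j)%:E + ((1 - l j) * (4 * l j))%:E * cst_if (far_window a y))%E); last first.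
  move=> y _; rewrite /tilt_factor (lenE lsmall nj) /cst_if.
  by case: ifP => _; rewrite ?mule1 ?mule0 ?adde0 -?EFinD; congr EFin; ring.
rewrite ge0_integralD//; last 2 first.
- by move=> y _; rewrite mule_ge0 ?cst_if_ge0.
- exact: (emeasurable_funM (measurable_cst _) mw).
rewrite ge0_integralZl//; last by move=> y _; exact: cst_if_ge0.
rewrite (integral_cst_probability lam) integral_far_window -EFinM -EFinD; congr EFin.
lra.
Qed.

Let h01 j : 0 <= (1 - l j) * (1 + l j) <= 1.
Proof.
have /andP[p0 p1] := l01 j; have := mulr_ge0 (ltW p0) (ltW p0).
have : 0 <= (1 - l j) * (1 + l j) by rewrite mulr_ge0//; lra.
by move=> -> /=; lra.
Qed.

Lemma integral_tilt_le1 : (\int[torus m]_w tilt w <= 1)%E.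
Proof.
pose all_right (t y : mR) := true.
have mr : measurable_fun [set: mR * mR] (fun z => all_right z.1 z.2) by exact: measurable_cst.
have mt : measurable_fun [set: tup] (fun=> 0 : mR) by exact: measurable_cst.
have uJ : uniq late_all by rewrite filter_uniq ?enum_uniq.
have mF : measurable_fun [set: tup] (fun=> 1%E : \bar R) by exact: measurable_cst.
have F0 (w : tup) : (0 <= (1 : \bar R))%E by [].
have iF (j : 'I_m) : j \in late_all -> inert all_right (fun=> 0) (fun=> 1%E : \bar R) j by [].
have mg (j : 'I_m) : measurable_fun [set: mR * mR] (fun z => (tilt_factor j z.2)%:E).
  by apply: measurable_tilt_factor; exact: measurable_snd.
have g0 (j : 'I_m) (t y : mR) : (0 <= (tilt_factor j y)%:E)%E by rewrite lee_fin tilt_factor_ge0.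
have mh (j : 'I_m) : measurable_fun [set: mR * mR] (fun z => ((1 - l j) * (1 + l j))%:E) by exact: measurable_cst.
have h0 (j : 'I_m) (t y : mR) : (0 <= ((1 - l j) * (1 + l j))%:E)%E.
  by rewrite lee_fin; have /andP[] := h01 j.
have IG (j : 'I_m) (t : mR) : j \in late_all -> True ->
   (\int[lam]_y (cst_if (all_right t y) * (tilt_factor j y)%:E) <=
    \int[lam]_y (cst_if (all_right t y) * ((1 - l j) * (1 + l j))%:E))%E.
  rewrite mem_filter => /andP[nj _] _.
  under eq_integral do rewrite mul1e; under [leRHS]eq_integral do rewrite mul1e.
  by rewrite integral_tilt_factor// (integral_cst_probability lam).
have := @integral_swap_factors R m all_right mr (fun=> 0) mt (fun=> True) late_all (fun=> 1%E)
  (fun j t y => (tilt_factor j y)%:E) (fun j t y => ((1 - l j) * (1 + l j))%:E) uJ mF F0 iF (fun _ _ => I)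
  (fun _ _ _ _ => erefl) mg g0 mh h0 (fun _ _ _ => _) IG.
under eq_integral do rewrite mul1e.
move=> H; apply: (le_trans (H _)) => //.
rewrite -[leRHS](integral_cst_probability (torus m) 1%E).
apply: ge0_le_integral => //.
- by move=> w _; rewrite mul1e; apply: eprod_ge0 => j; rewrite (h0 j 0 0).
move=> w _; rewrite mul1e prodEFin lee_fin.
apply: (@le_trans _ _ (\prod_(j <- late_all) (1 : R))); last by rewrite big1_eq.
by apply: ler_prod => j _; exact: h01.
Qed.

(** The factor 2 makes up for arc k, which may be missing on the left: 2 (1 - l k) >= 1. *)
Lemma tilt_late k w :
  ((\prod_(j <- late n k) (tilt_factor j (tnth w j))%:E) <= 2%:E * tilt w)%E.
Proof.
have P0 : (0 <= \prod_(j <- late n k) (tilt_factor j (tnth w j))%:E)%E.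
  by apply: eprod_ge0 => j; rewrite lee_fin tilt_factor_ge0.
have E : (\prod_(j <- late n k) (tilt_factor j (tnth w j))%:E =
    \prod_(j < m | (n <= j)%N && (j != k)) (tilt_factor j (tnth w j))%:E)%E.
  by rewrite /late big_filter big_enum_cond.
rewrite E in P0; rewrite E /tilt /late_all big_filter big_enum_cond/=.
have [nk|nk] := boolP (n <= k)%N.
  rewrite [X in (_ * X)%E](bigD1 k)//= muleA -[leLHS]mul1e; apply: lee_wpmul2r => //.
  rewrite -EFinM lee_fin /tilt_factor.
  have := lsmall nk; have := len_gt0 l01 k; have /andP[p0 p1] := l01 k => s0 s1.
  set c := (if far_window a (tnth w k) then 1 else 0 : R).
  have c0 : 0 <= 4 * len l k * c by rewrite /c; case: ifP => _; [lra|rewrite mulr0].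
  have h : 0 <= 2 * (1 - l k) * (4 * len l k * c) by apply: mulr_ge0 => //; lra.
  have -> : 2 * ((1 - l k) * (1 + 4 * len l k * c)) = 2 * (1 - l k) + 2 * (1 - l k) * (4 * len l k * c) by ring.
  lra.
rewrite (eq_bigl (fun j : 'I_m => (n <= j)%N)); last first.
  by move=> j; have [nj|//] := boolP (n <= j)%N; apply/eqP => jk; rewrite jk (negbTE nk) in nj.
rewrite -[leLHS]mul1e; apply: lee_wpmul2r; last by rewrite lee_fin; lra.
by elim/big_ind : _ => // [x y|j _]; [exact: mule_ge0|rewrite lee_fin tilt_factor_ge0].
Qed.

Variable S2 : R.
Hypothesis lS2 : forall n, \sum_(k < n) l k ^+ 2 <= S2.

Lemma inv_quad_le (x : R) : 0 <= x -> x <= 1/8 -> (1 - 4 * x ^+ 2)^-1 <= expR (8 * x ^+ 2).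
Proof.
move=> x0 x1; have h : x ^+ 2 <= 1/8 * x by rewrite expr2; apply: ler_wpM2r.
have h0 := sqr_ge0 x; move: (x ^+ 2) h h0 => z h h0.
have d0 : 0 < 1 - 4 * z by lra.
apply: le_trans (expR_ge1Dx _); rewrite -[leLHS]mul1r ler_pdivrMr//.
have hz : z * z <= 1/8 * z by apply: ler_wpM2r => //; lra.
have -> : (1 + 8 * z) * (1 - 4 * z) = 1 + 4 * z - 32 * (z * z) by ring.
lra.
Qed.

Lemma late_quad_le (k : 'I_m) : \prod_(j <- late n k) (1 - 4 * len l j ^+ 2)^-1 <= expR (8 * S2).
Proof.
rewrite /late big_filter big_enum_cond/= big_mkcond/=.
apply: (@le_trans _ _ (\prod_(j < m) expR (8 * l j ^+ 2))); last first.
  by rewrite -expR_sum ler_expR -mulr_sumr ler_wpM2l.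
apply: ler_prod => j _; case: ifP => [/andP[nj _]|_]; last first.
  by rewrite ler01 -expR0 ler_expR mulr_ge0// sqr_ge0.
have /andP[p0 _] := l01 j; have p1 := lsmall nj.
rewrite (lenE lsmall nj) inv_quad_le ?(ltW p0)// andbT invr_ge0.
have h : l j ^+ 2 <= 1/8 * l j by rewrite expr2; apply: ler_wpM2r => //; exact: ltW.
lra.
Qed.

(** The inverse of the factor that bounds the mass in [mass_ge_thinning], see [inv_gainE], as
    a product over the late arcs to which [swap_late] applies. *)
Definition inv_gain (k : 'I_m) (w : tup) : \bar R :=
  ((\prod_(j <- late n k) (1 - l j))%:E *
   \prod_(j <- late n k) (if right (endp k w) (tnth w j) then (1 - 2 * len l j)^-1 else 1)%:E)%E.

Lemma inv_gainE k w : inv_gain k w = ((thinning l n k w * late_gain k)^-1)%:E.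
Proof.
rewrite /inv_gain prodEFin -EFinM; congr EFin; rewrite invfM mulrC; congr (_ * _).
  rewrite /thinning -prodfV; apply: eq_bigr => j _.
  by case: ifP => // _; rewrite invr1.
by rewrite /late_gain -prodfV; apply: eq_bigr => j _; rewrite invrK.
Qed.

Lemma inv_gain_ge0 k w : (0 <= inv_gain k w)%E.
Proof.
by rewrite inv_gainE lee_fin invr_ge0 mulr_ge0 ?ltW ?thinning_gt0 ?late_gain_gt0.
Qed.

Lemma measurable_inv_gain k : measurable_fun setT (inv_gain k).
Proof.
apply: emeasurable_funM => //; apply: emeasurable_prod => j; apply/measurable_EFinP.
apply: measurable_fun_ifT => //; apply: measurable_right2; last exact: measurable_tnth.
exact: measurable_endpoint.
Qed.

(** [tilt_mean_le] applies to each late arc; the second order errors multiply to at most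
    exp (8 S2). *)
Lemma integral_inv_gain_le k :
  (\int[torus m]_w (cst_if (first_gap k w) * inv_gain k w) <=
   (2 * expR (8 * S2))%:E * \int[torus m]_w (cst_if (first_gap k w) * tilt w))%E.
Proof.
set q := \prod_(j <- late n k) (1 - l j).
have q0 : 0 <= q.
  by apply: prodr_ge0 => j _; have /andP[_ p1] := l01 j; rewrite subr_ge0 ltW.
have mfg : measurable_fun setT (fun w => cst_if (first_gap k w)).
  by apply: measurable_cst_if; exact: measurable_first_gap.
pose G w := (cst_if (first_gap k w) * q%:E)%E.
have mG : measurable_fun setT G := emeasurable_funM mfg (measurable_cst _).
have G0 w : (0 <= G w)%E by rewrite mule_ge0 ?cst_if_ge0.
have iG j : j \in late n k -> inert right (endp k) G j.
  by move=> jl w y r1 r2; rewrite /G first_gap_inert.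
have GS w : G w != 0%E -> a <= endp k w <= a + 1/8.
  by rewrite /G /cst_if; case: ifP => [/and5P[-> -> _ _ _]//|_]; rewrite mul0e eqxx.
pose g (s : R) (t y : mR) : \bar R := (if right t y then (1 - 2 * s)^-1 else 1)%:E.
pose h (s : R) (t y : mR) : \bar R := ((1 - 4 * s ^+ 2)^-1%:E * (1 + 4 * s * (if far_window a y then 1 else 0))%:E)%E.
have mg s : measurable_fun [set: mR * mR] (fun z => g s z.1 z.2).
  by apply/measurable_EFinP; apply: measurable_fun_ifT => //; exact: measurable_right2.
have mh s : measurable_fun [set: mR * mR] (fun z => h s z.1 z.2).
  apply: emeasurable_funM => //; apply/measurable_EFinP; apply: measurable_funD => //.
  apply: measurable_funM => //; apply: measurable_fun_ifT => //.
  exact: (measurableT_comp (measurable_far_window a) measurable_snd).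
have quad (s : R) : 0 < s -> s <= 1/8 -> 0 < 1 - 4 * s ^+ 2 /\ 1 <= (1 - 4 * s ^+ 2)^-1.
  move=> s0 s1; have h' : s ^+ 2 <= 1/8 * s by rewrite expr2; apply: ler_wpM2r => //; exact: ltW.
  have p := sqr_ge0 s; have d : 0 < 1 - 4 * s ^+ 2 by lra.
  by split => //; rewrite -invr1 lef_pV2 ?posrE//; lra.
have g0 (s : R) t y : 0 < s -> s <= 1/8 -> (0 <= g s t y)%E.
  by move=> s0 s1; rewrite lee_fin; case: ifP => // _; rewrite invr_ge0; lra.
have ge1 (s : R) (y : mR) : 0 < s -> 1 <= 1 + 4 * s * (if far_window a y then 1 else 0).
  by move=> s0; case: ifP => _; lra.
have h0 (s : R) t y : 0 < s -> s <= 1/8 -> (0 <= h s t y)%E.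
  move=> s0 s1; have [d _] := quad _ s0 s1.
  by rewrite /h -EFinM lee_fin mulr_ge0 ?invr_ge0 ?(ltW d)//; apply: le_trans (ge1 s y s0).
have gh (s : R) t y : 0 < s -> s <= 1/8 -> ~~ right t y -> (g s t y <= h s t y)%E.
  move=> s0 s1 /negbTE r; rewrite /g /h r -EFinM lee_fin; have [_ d] := quad _ s0 s1.
  by rewrite -[leLHS]mulr1; apply: ler_pM => //; exact: ge1.
have IG (s : R) (t : mR) : 0 < s -> s <= 1/8 -> a <= t <= a + 1/8 ->
   (\int[lam]_y (cst_if (right t y) * g s t y) <= \int[lam]_y (cst_if (right t y) * h s t y))%E.
  move=> s0 s1 at_; apply: le_trans (tilt_mean_le s0 s1 at_).
  rewrite le_eqVlt; apply/orP; left; apply/eqP; apply: eq_integral => y _.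
  by rewrite /g /cst_if; case: ifP => // _; rewrite !mul0e.
have swap := @swap_late R l l01 m n k (fun t => a <= t <= a + 1/8) G g h mG G0 iG GS mg mh g0 h0 gh IG.
rewrite (eq_integral (fun w => G w * \prod_(j <- late n k) g (len l j) (endp k w) (tnth w j))%E); last first.
  by move=> w _; rewrite /G /inv_gain muleA.
apply: le_trans swap _.
have c0 : (0 <= (2 * expR (8 * S2))%:E)%E by rewrite lee_fin mulr_ge0 ?expR_ge0.
rewrite -ge0_integralZl; [|exact: measurableT|exact: (emeasurable_funM mfg measurable_tilt)
  |by move=> w _; rewrite mule_ge0 ?cst_if_ge0 ?tilt_ge0|exact: c0].
apply: ge0_le_integral; first exact: measurableT.
- move=> w _; rewrite mule_ge0//; apply: eprod_ge0 => j; apply: h0; [exact: len_gt0|exact: len_le].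
- apply: (emeasurable_funM mG); apply: emeasurable_prod => j.
  apply: (measurableT_comp (mh (len l j)) (g := fun w : tup => (endp k w, tnth w j : mR))).
  by apply/measurable_fun_pair; [exact: measurable_endpoint|exact: measurable_tnth].
- exact: (emeasurable_funM (measurable_cst _) (emeasurable_funM mfg measurable_tilt)).
move=> w _; rewrite /G -muleA [leRHS]muleCA; apply: lee_wpmul2l; first exact: cst_if_ge0.
have T0 : (0 <= \prod_(j <- late n k) (tilt_factor j (tnth w j))%:E)%E.
  by apply: eprod_ge0 => j; rewrite lee_fin tilt_factor_ge0.
have -> : (q%:E * \prod_(j <- late n k) h (len l j) (endp k w) (tnth w j) =
   (\prod_(j <- late n k) (1 - 4 * len l j ^+ 2)^-1)%:E * \prod_(j <- late n k) (tilt_factor j (tnth w j))%:E)%E.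
  rewrite /q -!prodEFin -!big_split/=; apply: eq_bigr => j _.
  by rewrite /h /tilt_factor -!EFinM; congr EFin; ring.
apply: (@le_trans _ _ ((expR (8 * S2))%:E * \prod_(j <- late n k) (tilt_factor j (tnth w j))%:E)%E).
  by apply: lee_wpmul2r => //; rewrite lee_fin late_quad_le.
have -> : (2 * expR (8 * S2))%:E = ((expR (8 * S2))%:E * 2%:E)%E by rewrite -EFinM mulrC.
rewrite -muleA; apply: lee_wpmul2l; [by rewrite lee_fin expR_ge0|exact: tilt_late].
Qed.

Definition gap_event (w : tup) : bool := ~~ all (fun k => ~~ first_gap k w) (enum 'I_m).

Lemma measurable_gap_event : measurable_fun setT gap_event.
Proof.
by apply: measurable_neg; apply: measurable_all => k; apply: measurable_neg; exact: measurable_first_gap.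
Qed.

Lemma gap_event_le w : (cst_if (gap_event w) <= \sum_(k < m) cst_if (first_gap k w))%E.
Proof.
rewrite {1}/cst_if; case: ifP => [|_]; last by apply: sume_ge0 => k _; exact: cst_if_ge0.
move=> /allPn[k _]; rewrite negbK => fk.
by rewrite (bigD1 k)//= fk {1}/cst_if leeDl//; apply: sume_ge0 => j _; exact: cst_if_ge0.
Qed.

(** On a gap there is enough free time with probability at least 1/4.  Then the mass is at
    least eps / 4 * c unless the gain is below c, an event controlled by the mean of the
    inverse gain.  The events [first_gap k] are disjoint, which allows summation over k. *)
Lemma gap_event_bound (G : tup -> bool) (c : R) :
  measurable_fun setT G -> (forall (j : 'I_m) w y, (n <= j)%N -> G (upd w j y) = G w) -> 0 < c ->
  (\int[torus m]_w cst_if (G w && gap_event w) <=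
   4%:E * \int[torus m]_w cst_if (G w && (eps / 4 * c <= mass w)%R) + (8 * c * expR (8 * S2))%:E)%E.
Proof.
move=> mG iG c0.
have mfg k : measurable_fun setT (fun w => cst_if (first_gap k w)).
  by apply: measurable_cst_if; exact: measurable_first_gap.
have mGc : measurable_fun setT (fun w => cst_if (G w)) by exact: measurable_cst_if.
pose B w := G w && (eps / 4 * c <= mass w).
have mB : measurable_fun setT (fun w => cst_if (B w)).
  apply: measurable_cst_if; apply: measurable_and => //.
  exact: (measurable_fun_ler (measurable_cst _) measurable_mass).
have i0 (f : tup -> \bar R) : (forall w, 0 <= f w)%E -> (0 <= \int[torus m]_w f w)%E.
  by move=> f0; apply: integral_ge0 => w _; exact: f0.
have fB0 k w : (0 <= cst_if (first_gap k w) * cst_if (B w))%E by rewrite mule_ge0 ?cst_if_ge0.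
have mfB k : measurable_fun setT (fun w => cst_if (first_gap k w) * cst_if (B w))%E := emeasurable_funM (mfg k) mB.
have fT0 k w : (0 <= cst_if (first_gap k w) * tilt w)%E by rewrite mule_ge0 ?cst_if_ge0 ?tilt_ge0.
have mfT k : measurable_fun setT (fun w => cst_if (first_gap k w) * tilt w)%E := emeasurable_funM (mfg k) measurable_tilt.
have fI0 k w : (0 <= cst_if (first_gap k w) * inv_gain k w)%E by rewrite mule_ge0 ?cst_if_ge0 ?inv_gain_ge0.
have mfI k : measurable_fun setT (fun w => cst_if (first_gap k w) * inv_gain k w)%E :=
  emeasurable_funM (mfg k) (measurable_inv_gain k).
have step k : (\int[torus m]_w (cst_if (G w) * cst_if (first_gap k w)) <=
   4%:E * (\int[torus m]_w (cst_if (first_gap k w) * cst_if (B w)) +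
     (c * (2 * expR (8 * S2)))%:E * \int[torus m]_w (cst_if (first_gap k w) * tilt w)))%E.
  pose F w := (cst_if (G w) * cst_if (first_gap k w))%E.
  have mF : measurable_fun setT F := emeasurable_funM mGc (mfg k).
  have F0 w : (0 <= F w)%E by rewrite mule_ge0 ?cst_if_ge0.
  have F1 w : (F w <= 1)%E.
    by rewrite /F /cst_if; case: (G w); case: (first_gap k w); rewrite ?mule1 ?mule0.
  have iF j : j \in late n k -> inert right (endp k) F j.
    move=> jl w y r1 r2; rewrite /F first_gap_inert// iG//.
    by move: jl; rewrite lateP => /andP[].
  have Ffin : (\int[torus m]_w F w < +oo)%E.
    apply: (@le_lt_trans _ _ (\int[torus m]_w 1)%E); last first.
      by rewrite (integral_cst_probability (torus m)) ltry.
    exact: ge0_le_integral.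
  apply: le_trans (paley_zygmund l01 eps0 eps1 mF F0 iF Ffin) _.
  apply: lee_wpmul2l; first by rewrite lee_fin.
  have cc0 : (0 <= c%:E)%E by rewrite lee_fin ltW.
  apply: (@le_trans _ _ (\int[torus m]_w (cst_if (first_gap k w) * cst_if (B w)) +
      c%:E * \int[torus m]_w (cst_if (first_gap k w) * inv_gain k w))%E); last first.
    apply: leeD => //; rewrite EFinM -muleA; apply: lee_wpmul2l => //.
    exact: integral_inv_gain_le.
  have mcI : measurable_fun setT (fun w => c%:E * (cst_if (first_gap k w) * inv_gain k w))%E :=
    emeasurable_funM (measurable_cst _) (mfI k).
  have mFE : measurable_fun setT (fun w => F w * cst_if (enough_time l n k eps w))%E.
    apply: (emeasurable_funM mF); apply: measurable_cst_if; exact: measurable_enough_time.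
  rewrite -ge0_integralZl; [|exact: measurableT|exact: mfI|by move=> w _; exact: fI0|exact: cc0].
  apply: (@integral_le_add _ _ _ (torus m) _ _ _ mFE (mfB k) mcI) => w.
  - by rewrite mule_ge0 ?cst_if_ge0.
  - exact: fB0.
  - by rewrite mule_ge0.
  have R0 : (0 <= cst_if true * cst_if (B w) + c%:E * (cst_if true * inv_gain k w))%E.
    have h1 : (0 <= cst_if true * inv_gain k w)%E := mule_ge0 (cst_if_ge0 R true) (inv_gain_ge0 k w).
    exact: (adde_ge0 (mule_ge0 (cst_if_ge0 R true) (cst_if_ge0 R (B w))) (mule_ge0 cc0 h1)).
  rewrite /F; have [fk|nk] := boolP (first_gap k w); last first.
    by rewrite -[cst_if false]/(0%E) !mule0 !mul0e mule0 add0e.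
  have [Gw|nG] := boolP (G w); last first.
    by rewrite -[cst_if false]/(0%E) ?mul0e ?mule0.
  have [et|_] := boolP (enough_time l n k eps w); last first.
    by rewrite -[cst_if false]/(0%E) ?mul0e ?mule0.
  rewrite -[cst_if true]/(1%E) !mule1 !mul1e /B Gw /=.
  have [_|mc] := leP (eps / 4 * c) (mass w).
    by rewrite -[cst_if true]/(1%E) leeDl// mule_ge0 ?inv_gain_ge0.
  rewrite -[cst_if false]/(0%E) add0e; move: (ltW mc).
  have := mass_ge_thinning fk et.
  move=> h1 h2; rewrite inv_gainE -EFinM lee_fin.
  have g0 : 0 < thinning l n k w * late_gain k by rewrite mulr_gt0 ?thinning_gt0 ?late_gain_gt0.
  rewrite ler_pdivlMr// mul1r.
  have e4 : 0 < eps / 4 by rewrite divr_gt0.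
  by rewrite -(ler_pM2l e4) (le_trans h1 h2).
pose D := (c * (2 * expR (8 * S2))).
have D0 : (0 <= D%:E)%E by rewrite lee_fin /D !mulr_ge0 ?expR_ge0 ?(ltW c0).
apply: (@le_trans _ _ (\int[torus m]_w \sum_(k < m) (cst_if (G w) * cst_if (first_gap k w)))%E).
  apply: ge0_le_integral => //.
  - by move=> w _; exact: cst_if_ge0.
  - by apply: measurable_cst_if; apply: measurable_and => //; exact: measurable_gap_event.
  - by apply: emeasurable_sum => k; exact: (emeasurable_funM mGc (mfg k)).
  move=> w _; have [/andP[Gw gw]|_] := boolP (G w && gap_event w); last first.
    by apply: sume_ge0 => k _; rewrite mule_ge0 ?cst_if_ge0.
  rewrite Gw; under eq_bigr do rewrite -[cst_if true]/(1%E) mul1e.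
  by have := gap_event_le w; rewrite gw.
rewrite ge0_integral_sum//; last 2 first.
- by move=> k; exact: (emeasurable_funM mGc (mfg k)).
- by move=> k w _; rewrite mule_ge0 ?cst_if_ge0.
apply: (@le_trans _ _ (\sum_(k < m) 4%:E * (\int[torus m]_w (cst_if (first_gap k w) * cst_if (B w)) +
     D%:E * \int[torus m]_w (cst_if (first_gap k w) * tilt w)))%E).
  by apply: lee_sum => k _; exact: step.
rewrite -ge0_sume_distrr; last first.
  by move=> k _; rewrite adde_ge0 ?mule_ge0// i0.
rewrite big_split/= -ge0_sume_distrr; last by move=> k _; apply: i0.
have -> : (8 * c * expR (8 * S2))%:E = (4%:E * D%:E)%E by rewrite -EFinM /D; congr EFin; ring.
rewrite -ge0_muleDr ?i0//; last by move=> w; exact: cst_if_ge0.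
apply: lee_wpmul2l; first by rewrite lee_fin.
apply: leeD.
  rewrite -ge0_integral_sum//.
  apply: ge0_le_integral => //.
  - by move=> w _; apply: sume_ge0 => k _; exact: fB0.
  - by apply: emeasurable_sum => k; exact: mfB.
  by move=> w _; apply: sum_first_gap_le1; exact: cst_if_ge0.
rewrite -[leRHS]mule1; apply: lee_wpmul2l => //.
rewrite -ge0_integral_sum//.
apply: le_trans integral_tilt_le1; apply: ge0_le_integral => //.
- by move=> w _; apply: sume_ge0 => k _; exact: fT0.
- by apply: emeasurable_sum => k; exact: mfT.
- exact: measurable_tilt.
by move=> w _; apply: sum_first_gap_le1; exact: tilt_ge0.
Qed.

End first_gap.

(** * Almost sure events *)

Section small_sets.
Context (R : realType) (dd : measure_display) (Om : measurableType dd) (P : probability Om R).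
Local Notation mR := (measurableTypeR R).
Local Notation cst_if := (@cst_if R).

Lemma measure_cst_if (b : Om -> bool) : measurable_fun setT b ->
  (P [set x | b x] = \int[P]_x cst_if (b x))%E.
Proof.
move=> mb; have mB : measurable [set x | b x].
  by rewrite -[X in measurable X]setTI; exact: (mb measurableT [set true]).
transitivity (\int[P]_x (\1_[set x | b x] x)%:E)%E; first by rewrite integral_indic// setIT.
apply: eq_integral => x _; rewrite indicE; have [bx|bx] := boolP (b x); first by rewrite mem_set.
by rewrite memNset//; exact/negP.
Qed.

Lemma measurable_bool (b : Om -> bool) : measurable_fun setT b -> measurable [set x | b x].
Proof. by move=> mb; rewrite -[X in measurable X]setTI; exact: (mb measurableT [set true]). Qed.

Lemma negligible_of_small (B : set Om) :
  (forall r : nat, exists A, [/\ measurable A, B `<=` A & (P A <= (r.+1%:R^-1)%:E)%E]) ->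
  P.-negligible B.
Proof.
move=> /choice[A HA]; have mA r : measurable (A r) by have [] := HA r.
exists (\bigcap_r A r); split.
- exact: bigcapT_measurable.
- apply/eqP; rewrite eq_le measure_ge0 andbT; apply/lee_addgt0Pr => e e0; rewrite add0e.
  have [r re] : exists r : nat, (r.+1%:R^-1 : R) <= e.
    have /ltr_add_invr[r] := e0; rewrite add0r => h; exists r; exact: ltW.
  have [_ _ h] := HA r; apply: le_trans (le_trans h _); last by rewrite lee_fin.
  apply: le_measure; rewrite ?inE//; first exact: bigcapT_measurable.
  by move=> x; apply.
- by move=> x Bx r _; have [_ BA _] := HA r; exact: BA.
Qed.

Definition eventually_in (B : nat -> set Om) : set Om :=
  [set x | exists M, forall m, (M <= m)%N -> B m x].

Lemma eventually_inE B : eventually_in B = \bigcup_M \bigcap_(m in [set m | (M <= m)%N]) B m.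
Proof.
apply/seteqP; split => [x [M HM]|x [M _ HM]]; first by exists M => // m /= Mm; exact: HM.
by exists M => m Mm; exact: HM.
Qed.

Lemma measurable_tail_cap (B : nat -> set Om) M : (forall m, measurable (B m)) ->
  measurable (\bigcap_(m in [set m | (M <= m)%N]) B m).
Proof. by move=> mB; apply: bigcap_measurable => // ; exists M => /=. Qed.

Lemma measurable_eventually_in B : (forall m, measurable (B m)) -> measurable (eventually_in B).
Proof.
by move=> mB; rewrite eventually_inE; apply: bigcupT_measurable => M; exact: measurable_tail_cap.
Qed.

Lemma eventually_in_le B (K : \bar R) : (forall m, measurable (B m)) ->
  (forall M, exists2 m, (M <= m)%N & (P (B m) <= K)%E) -> (P (eventually_in B) <= K)%E.
Proof.
move=> mB BK; rewrite eventually_inE.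
pose E M := \bigcap_(m in [set m | (M <= m)%N]) B m.
have mE M : measurable (E M) by exact: measurable_tail_cap.
have nd : nondecreasing_seq E.
  by move=> M M' MM; apply/subsetPset => x Ex m /= Mm; apply: Ex; exact: leq_trans Mm.
have cv := nondecreasing_cvg_mu (mu := P) mE (bigcupT_measurable _ mE) nd.
rewrite -(cvg_lim _ cv)//; apply: lime_le; first by apply/cvg_ex; eexists; exact: cv.
apply: nearW => M; have [m Mm h] := BK M; apply: le_trans h.
by apply: le_measure; rewrite ?inE//; move=> x; apply.
Qed.

(** Continuity of the probability along the unions of the tails. *)
Lemma eventually_out_small (A : nat -> set Om) (e : R) : (forall j, measurable (A j)) ->
  {ae P, forall x, exists M, forall j, (M <= j)%N -> ~ A j x} -> 0 < e ->
  exists M, forall j, (M <= j)%N -> (P (A j) <= e%:E)%E.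
Proof.
move=> mA AE e0.
pose E M := \bigcup_(j in [set j | (M <= j)%N]) A j.
have mE M : measurable (E M) by apply: bigcup_measurable.
have ni : nonincreasing_seq E.
  move=> M M' MM; apply/subsetPset => x [j /= Mj Aj]; exists j => //=; exact: leq_trans Mj.
have fin0 : (P (E 0%N) < +oo)%E by rewrite ltey_eq fin_num_measure.
have cv := nonincreasing_cvg_mu (mu := P) fin0 mE (bigcapT_measurable mE) ni.
have E0 : P (\bigcap_M E M) = 0%E.
  apply: measure_negligible; first exact: bigcapT_measurable.
  apply: negligibleS AE => x Ex [M HM]; have [j /= Mj Aj] := Ex M I; exact: (HM j Mj).
have cv0 : P (E x) @[x --> \oo] --> (0 : \bar R)%E by rewrite -E0; exact: cv.
have /fine_cvgP[_ /cvgrPdist_le/(_ e e0)[M _ HM]] := cv0.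
exists M => j Mj; have := HM M (leqnn M); rewrite /= sub0r normrN => h.
apply: (@le_trans _ _ (P (E M))).
  by apply: le_measure; rewrite ?inE//; move=> x Ax; exists j.
rewrite -(fineK (fin_num_measure P _ (mE M))) lee_fin.
by apply: le_trans h; exact: ler_norm.
Qed.

End small_sets.

Section covering_ae.
Context (R : realType) (dd : measure_display) (Om : measurableType dd) (P : probability Om R).
Local Notation mR := (measurableTypeR R).
Local Notation lam := (@circle_lebesgue R).
Local Notation torus n := (torus_lebesgue R n).
Local Notation cst_if := (@cst_if R).
Variable l : nat -> R.
Hypothesis l01 : forall n, 0 < l n < 1.
Hypothesis lsum : (\sum_(0 <= n <oo) (l n)%:E = +oo)%E.
Variable omega : nat -> {RV P >-> R}.
Hypothesis indep : mutually_independent omega.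
Hypothesis unif : forall n, circle_uniform (omega n).

Lemma tail_prod_le (s r : nat) : exists2 m, (s <= m)%N & \prod_(j < m | (s <= j)%N) (1 - l j) <= r.+1%:R^-1.
Proof.
have l0 n : 0 <= l n by have /andP[/ltW] := l01 n.
have [m0 hm0] : exists m, s%:R + r%:R <= \sum_(k < m) l k.
  apply: contrapT => /forallNP H.
  have : (\sum_(0 <= n <oo) (l n)%:E <= (s%:R + r%:R)%:E)%E.
    apply: lime_le; first by apply: is_cvg_nneseries => k _ _; rewrite lee_fin.
    apply: nearW => n; rewrite sumEFin lee_fin big_mkord.
    by have /negP := H n; rewrite -ltNge => /ltW.
  by rewrite lsum.
pose m := maxn s m0; have sm : (s <= m)%N by exact: leq_maxl.
exists m => //.
have hm : s%:R + r%:R <= \sum_(k < m) l k.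
  have mm : (m0 <= m)%N by exact: leq_maxr.
  apply: le_trans hm0 _; rewrite -(subnKC mm) big_split_ord/= lerDl; exact: sumr_ge0.
have ht : r%:R <= \sum_(j < m | (s <= j)%N) l j.
  move: hm; rewrite big_mkcond/= -(subnKC sm) !big_split_ord/= [X in _ -> _ <= X + _]big1; last first.
    by move=> j; rewrite leqNgt ltn_ord.
  have : \sum_(k < s) l k <= s%:R.
    rewrite -[X in _ <= X%:R]card_ord -sumr_const; apply: ler_sum => k _.
    by have /andP[_ /ltW] := l01 k.
  move=> h1 h2; rewrite add0r (eq_bigl xpredT); last by move=> j; exact: leq_addr.
  by move: h1 h2; lra.
apply: (@le_trans _ _ (expR (- \sum_(j < m | (s <= j)%N) l j))).
  rewrite -sumrN expR_sum; apply: ler_prod => j _; have /andP[p0 p1] := l01 j.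
  by have := expR_ge1Dx (- l j); lra.
rewrite expRN lef_pV2 ?posrE ?expR_gt0 ?ltr0n//.
apply: le_trans (expR_ge1Dx _); rewrite -natr1; lra.
Qed.

Lemma integral_uncovered_le (m s : nat) (tau : m.-tuple mR -> mR) : measurable_fun setT tau ->
  (forall (j : 'I_m) w y, (s <= j)%N -> tau (upd w j y) = tau w) ->
  (\int[torus m]_w cst_if (all (fun j : 'I_m => ~~ (s <= j)%N || ~~ (0 < mod1 (tau w - tnth w j) < l j)%R) (enum 'I_m)) <=
   (\prod_(j < m | (s <= j)%N) (1 - l j))%:E)%E.
Proof.
move=> mt tj.
pose J := [seq j : 'I_m <- enum 'I_m | (s <= j)%N].
pose yes (t y : mR) := true.
pose g (j : 'I_m) (t y : mR) := cst_if (~~ (0 < mod1 (t - y) < l j)).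
pose h (j : 'I_m) (t y : mR) : \bar R := (1 - l j)%:E.
have mr : measurable_fun [set: mR * mR] (fun z => yes z.1 z.2) by exact: measurable_cst.
have uJ : uniq J by rewrite filter_uniq ?enum_uniq.
have mF : measurable_fun [set: m.-tuple mR] (fun=> 1%E : \bar R) by exact: measurable_cst.
have F0 (w : m.-tuple mR) : (0 <= (1 : \bar R))%E by [].
have iF (j : 'I_m) : j \in J -> inert yes tau (fun=> 1%E : \bar R) j by [].
have tJ (j : 'I_m) w y : j \in J -> tau (upd w j y) = tau w by rewrite mem_filter => /andP[sj _]; exact: tj.
have mg (j : 'I_m) : measurable_fun [set: mR * mR] (fun z => g j z.1 z.2).
  by apply: measurable_cst_if; apply: measurable_neg; exact: measurable_alive.
have g0 (j : 'I_m) (t y : mR) : (0 <= g j t y)%E by exact: cst_if_ge0.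
have mh (j : 'I_m) : measurable_fun [set: mR * mR] (fun z => h j z.1 z.2) by exact: measurable_cst.
have h0 (j : 'I_m) (t y : mR) : (0 <= h j t y)%E by rewrite lee_fin; have /andP[_ /ltW] := l01 j; rewrite subr_ge0.
have IG (j : 'I_m) (t : mR) : j \in J -> True ->
   (\int[lam]_y (cst_if (yes t y) * g j t y) <= \int[lam]_y (cst_if (yes t y) * h j t y))%E.
  move=> _ _; under eq_integral do rewrite mul1e; under [leRHS]eq_integral do rewrite mul1e.
  rewrite (integral_cst_probability lam) /g.
  have mB : measurable_fun setT (fun y : mR => 0 < mod1 (t - y) < l j).
    exact: (measurable_alive (l j) (f := cst t) (g := id)).
  have /andP[p0 p1] := l01 j.
  rewrite -(measure_cst_if lam (measurable_neg mB)).
  rewrite (_ : [set x | _] = ~` [set y | 0 < mod1 (t - y) < l j]); last first.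
    by apply/seteqP; split => y /=; [move=> /negP|move=> /negP].
  rewrite probability_setC; last exact: measurable_bool.
  rewrite [X in (1 - X <= _)%E](_ : _ = (l j - 0)%:E); last exact: (lam_sub_itv t (lexx 0) (ltW p0) (ltW p1)).
  by rewrite subr0.
have := integral_swap_factors mr mt uJ mF F0 iF (S := fun=> True) (fun _ _ => I) tJ mg g0 mh h0 _ IG.
move=> H.
apply: (@le_trans _ _ (\int[torus m]_w (1 * \prod_(j <- J) g j (tau w) (tnth w j)))%E).
  rewrite le_eqVlt; apply/orP; left; apply/eqP; apply: eq_integral => w _.
  rewrite mul1e /g prod_cst_if /J; congr (cst_if _); rewrite all_filter.
  by apply: eq_all => j /=; rewrite implybE.
apply: (le_trans (H _)) => //.
under eq_integral do rewrite mul1e /h prodEFin.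
by rewrite (integral_cst_probability (torus m)) /J big_filter big_enum_cond.
Qed.

Lemma measurable_comp_starts m d' (T : measurableType d') (g : m.-tuple mR -> T) :
  measurable_fun setT g -> measurable_fun setT (fun x => g (starts omega m x)).
Proof. by move=> mg; have := measurableT_comp mg (@measurable_starts _ _ _ P omega m). Qed.

(** The point f does not depend on the arcs of index at least s, so that each of them misses
    it with probability 1 - l j; the product of these vanishes since the lengths have an
    infinite sum. *)
Lemma ae_covered (s : nat) (tau : forall m, m.-tuple mR -> mR) (f : Om -> mR) :
  (forall m, measurable_fun setT (@tau m)) ->
  (forall m (j : 'I_m) w y, (s <= j)%N -> tau m (upd w j y) = tau m w) ->
  (forall m x, (s <= m)%N -> tau m (starts omega m x) = f x) ->
  {ae P, forall x, exists j, 0 < mod1 (f x - omega j x) < l j}.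
Proof.
move=> mt tj tf.
apply: (@negligibleS _ _ _ P [set x | forall j, ~~ (0 < mod1 (f x - omega j x) < l j)]).
  move=> x /= H j; apply/negP => h; apply: H; by exists j.
apply: negligible_of_small => r.
have [m sm hm] := tail_prod_le s r.
pose b (w : m.-tuple mR) := all (fun j : 'I_m => ~~ (s <= j)%N || ~~ (0 < mod1 (tau m w - tnth w j) < l j)) (enum 'I_m).
have mb : measurable_fun setT b.
  apply: measurable_all => j; apply: measurable_or => //; apply: measurable_neg.
  apply: measurable_alive; first exact: mt.
  exact: measurable_tnth.
have mbs : measurable_fun setT (fun x => b (starts omega m x)).
  exact: measurable_comp_starts.
exists [set x | b (starts omega m x)]; split.
- exact: measurable_bool.
- move=> x /= H; apply/allP => j _; rewrite tf//.
  by have := H j; rewrite /starts tnth_mktuple => ->; rewrite orbT.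
rewrite measure_cst_if// (integral_starts indep unif (F := fun w => cst_if (b w))).
- apply: le_trans (integral_uncovered_le (mt m) (tj m)) _.
  by rewrite lee_fin.
- exact: measurable_cst_if.
- by move=> w; exact: cst_if_ge0.
Qed.

Lemma measurable_nth_tuple m i : measurable_fun setT (fun w : m.-tuple mR => nth 0 w i : mR).
Proof.
have [im|mi] := ltnP i m.
  have -> : (fun w : m.-tuple mR => nth 0 w i : mR) = (fun w => tnth w (Ordinal im)).
    by apply/funext => w; rewrite (tnth_nth 0).
  exact: measurable_tnth.
have -> : (fun w : m.-tuple mR => nth 0 w i : mR) = cst 0.
  by apply/funext => w; rewrite nth_default// size_tuple.
exact: measurable_cst.
Qed.

Lemma nth_upd m (w : m.-tuple mR) (j : 'I_m) y i : (i < j)%N -> nth 0 (upd w j y) i = nth 0 w i.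
Proof.
move=> ij; have im : (i < m)%N by exact: ltn_trans ij (ltn_ord j).
have -> : nth 0 (upd w j y) i = tnth (upd w j y) (Ordinal im) by rewrite (tnth_nth 0).
by rewrite tnth_upd -val_eqE /= ltn_eqF// (tnth_nth 0).
Qed.

Lemma nth_starts m i x : (i < m)%N -> nth 0 (starts omega m x) i = omega i x.
Proof.
move=> im; have -> : nth 0 (starts omega m x) i = tnth (starts omega m x) (Ordinal im) by rewrite (tnth_nth 0).
by rewrite tnth_mktuple.
Qed.

Lemma ae_covered_point (a : R) : {ae P, forall x, exists j, 0 < mod1 (a - omega j x) < l j}.
Proof.
by apply: (@ae_covered 0 (fun m => cst a) (cst a)) => // m; exact: measurable_cst.
Qed.

Lemma ae_covered_starts :
  {ae P, forall x, forall i, exists j, 0 < mod1 (omega i x - omega j x) < l j}.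
Proof.
have H i : {ae P, forall x, exists j, 0 < mod1 (omega i x - omega j x) < l j}.
  apply: (@ae_covered i.+1 (fun m w => nth 0 w i) (fun x => omega i x)).
  - by move=> m; exact: measurable_nth_tuple.
  - by move=> m j w y; exact: nth_upd.
  - by move=> m x; exact: nth_starts.
by have := ae_foralln H.
Qed.

End covering_ae.

Section gap_exists.
Variable R : realType.
Local Notation mR := (measurableTypeR R).

(** An arc that contains s but not the later point u ends in between. *)
Lemma arc_exit (s u y lam_ : R) : 0 <= s -> s <= u -> u < 1 -> lam_ < 1 ->
  0 < mod1 (s - y) < lam_ -> ~~ (0 < mod1 (u - y) < lam_) -> s < mod1 (y + lam_) <= u.
Proof.
move=> s0 su u1 l1; move E : (mod1 (s - y)) => x /andP[x0 xl] nu.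
have Eu : mod1 (u - y) = mod1 ((u - s) + x) by rewrite -E mod1Dr; congr mod1; ring.
have h : lam_ <= (u - s) + x.
  rewrite leNgt; apply: contraNN nu => h; rewrite Eu mod1_id ?h ?andbT; lra.
have -> : mod1 (y + lam_) = mod1 ((s + lam_) - x).
  by rewrite -E mod1Br; congr mod1; ring.
by rewrite mod1_id; lra.
Qed.

Variables (l w : nat -> R).
Hypothesis l01 : forall n, 0 < l n < 1.

Definition prefix m : m.-tuple mR := [tuple w i | i < m].

Variables (a u : R).
Hypotheses (a0 : 0 <= a) (au : a <= u) (ua : u <= a + 1/8) (u1 : u < 1).
Hypothesis cov_a : exists j, 0 < mod1 (a - w j) < l j.
Hypothesis cov_w : forall i, exists j, 0 < mod1 (w i - w j) < l j.
Hypothesis uncov : forall j, ~~ (0 < mod1 (u - w j) < l j).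

(** Among the arcs whose end lies between a and u, at least one of which contains a, take one
    with the rightmost end.  This end is uncovered, since an arc containing it would end
    further right.  Hence some end in the window is uncovered, and the leftmost one is a gap.
    It stays away from the start of any of the first n arcs, because that start is covered by
    an arc that does not contain the gap. *)
Lemma gap_event_eventually n : exists q M, forall m, (M <= m)%N ->
  gap_event l n a (q.+4%:R^-1) (prefix m).
Proof.
have [j0 hj0] := cov_a; have [J HJ] := choice cov_w.
have [q hq] : exists q : nat, forall i : 'I_n, (q.+4%:R^-1 : R) <= mod1 (w i - w (J i)).
  elim: (n) => [|n' [q hq]]; first by exists 0%N => -[].
  have /andP[d0 _] := HJ n'.
  have /ltr_add_invr[r] := d0; rewrite add0r => hr.
  exists (maxn q r) => i; have [im|] := ltnP i n'.
    apply: le_trans (hq (Ordinal im)); rewrite lef_pV2 ?posrE ?ltr0n// ler_nat !ltnS; exact: leq_maxl.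
  move=> ni; have -> : (i : nat) = n' by apply/eqP; rewrite eqn_leq ni -ltnS ltn_ord.
  apply: le_trans (ltW hr); rewrite lef_pV2 ?posrE ?ltr0n// ler_nat !ltnS.
  by apply: (leq_trans (leq_maxr q r)); rewrite -addn3 leq_addr.
exists q, (maxn j0.+1 (\max_(i < n) (J i).+1)) => m; rewrite geq_max => /andP[mj0 mJ].
have mJi (i : 'I_n) : (J i < m)%N by apply: leq_trans mJ; exact: (leq_bigmax i).
set W := prefix m; have WE j : tnth W j = w j by rewrite tnth_mktuple.
pose c (j : 'I_m) := endpoint l j W.
have cE j : c j = mod1 (w j + l j) by rewrite /c /endpoint WE.
have uncovered s : ~~ covered l W s -> forall j : 'I_m, ~~ (0 < mod1 (s - w j) < l j).
  by rewrite /covered negbK => /allP h j; have := h j (mem_enum _ _); rewrite WE.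
have covers s : covered l W s -> exists j : 'I_m, 0 < mod1 (s - w j) < l j.
  by rewrite /covered => /allPn[j _]; rewrite negbK WE => h; exists j.
have exit s (j : 'I_m) : 0 <= s -> s <= u -> 0 < mod1 (s - w j) < l j -> s < c j <= u.
  move=> s0 su hs; rewrite cE; have /andP[_ p1] := l01 j.
  exact: (arc_exit s0 su u1 p1 hs (uncov j)).
pose T (j : 'I_m) := a <= c j <= u.
have T0 : T (Ordinal mj0).
  by have /andP[h1 h2] := exit a (Ordinal mj0) a0 au hj0; rewrite /T (ltW h1).
pose S (j : 'I_m) := (a <= c j <= a + 1/8) && ~~ covered l W (c j).
have [k1 Sk1] : exists k, S k.
  case: (@arg_maxP _ _ _ (Ordinal mj0) T c T0) => k /andP[ak ku] kmax.
  exists k; rewrite /S ak (le_trans ku ua) /=; apply/negP => /covers[i hi].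
  have /andP[h1 h2] := exit _ i (le_trans a0 ak) ku hi.
  have := kmax i; rewrite /T (le_trans ak (ltW h1)) h2 => /(_ isT).
  by rewrite /= leNgt h1.
case: (@arg_minP _ _ _ k1 S c Sk1) => k2 Sk2 k2min.
have S2 : S k2 && (c k2 == c k2) by rewrite Sk2 eqxx.
case: (@arg_minnP _ k2 (fun k => S k && (c k == c k2)) (fun k : 'I_m => k : nat) S2) => k /andP[Sk /eqP ck] kmin.
have /andP[/andP[ak kb] nk] := Sk.
apply/allPn; exists k; first exact: mem_enum.
rewrite negbK; apply/and5P; split => //; last (apply/andP; split).
- apply/allP => j _; rewrite -/(c j) -/(c k).
  have [/andP[h1 h2]|//] := boolP ((a <= c j) && (c j < c k)); rewrite /=.
  apply: contraT => ncov; have Sj : S j by rewrite /S h1 (le_trans (ltW h2) kb).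
  by have := k2min j Sj; rewrite -ck leNgt h2.
- apply/allP => j _; rewrite -/(c j) -/(c k).
  have [/eqP h|//] := boolP (c j == c k); rewrite ?orbT//= orbF -leqNgt.
  by apply: kmin; rewrite /S h ak kb nk ck eqxx.
apply/allP => j _; have [jn|//] := boolP (j < n)%N; rewrite /= WE -/(c k).
apply: le_trans (hq (Ordinal jn)) _ => /=.
have := uncovered _ nk (Ordinal (mJi (Ordinal jn))) => /=.
rewrite -/(c k) => nc; have := HJ j.
have -> : mod1 (w j - c k) = mod1 (mod1 (w j - w (J j)) - mod1 (c k - w (J j))).
  by rewrite mod1Br mod1Dl; congr mod1; ring.
move: nc; have := mod1_ge0 (c k - w (J j)); have := mod1_lt1 (c k - w (J j)).
have := mod1_lt1 (w j - w (J j)).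
move: (mod1 _) (mod1 _) => y x x1 y1 y0 ny /andP[x0 xl].
have [y00|yp] := eqVneq y 0; first by rewrite y00 subr0 mod1_id// (ltW x0).
have yp' : 0 < y by rewrite lt_neqAle eq_sym yp.
have ly : l (J j) <= y by rewrite leNgt; apply: contraNN ny => ->; rewrite yp'.
by rewrite mod1_shiftN1; lra.
Qed.

End gap_exists.

(** * Extinction of the mass *)

Lemma first_gap_eps (R : realType) (l : nat -> R) m n a (e e' : R) (k : 'I_m) w : e' <= e ->
  first_gap l n a e k w -> first_gap l n a e' k w.
Proof.
move=> ee; rewrite /first_gap => /and5P[-> -> -> -> /andP[-> /allP h]]; rewrite !andTb.
apply/allP => j jin; have := h j jin; case: (j < n)%N => //=; exact: le_trans.
Qed.

Lemma gap_event_eps (R : realType) (l : nat -> R) m n a (e e' : R) (w : m.-tuple (measurableTypeR R)) : e' <= e ->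
  gap_event l n a e w -> gap_event l n a e' w.
Proof.
move=> ee /allPn[k kin]; rewrite negbK => h; apply/allPn; exists k => //.
by rewrite negbK; exact: first_gap_eps h.
Qed.

Section limit_thresholds.
Context (R : realType) (dd : measure_display) (Om : measurableType dd) (P : probability Om R).

Lemma ae_limit (N : nat -> Om -> R) : (forall m, measurable_fun setT (N m)) ->
  {ae P, forall x, cvgn (N ^~ x)} ->
  exists2 X : Om -> R, measurable_fun setT X & {ae P, forall x, N ^~ x @ \oo --> X x}.
Proof.
move=> mN N_cvg; exists (fun x => fine (limn_esup (fun m => (N m x)%:E))).
  apply: (measurableT_comp (fine_measurable measurableT)); apply: measurable_fun_limn_esup => m.
  by apply/measurable_EFinP; exact: mN.
apply: filterS N_cvg => x cv.
have cE : (N m x)%:E @[m --> \oo] --> (limn (N ^~ x))%:E by apply: cvg_EFin => //; exact: nearW.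
by rewrite is_cvg_limn_esupE ?(cvg_lim _ cE)//; apply/cvg_ex; eexists; exact: cE.
Qed.

Lemma small_positive_limit (X : Om -> R) (d : R) : measurable_fun setT X -> 0 < d ->
  exists2 eta : R, 0 < eta & (P [set x | (0 < X x <= eta)%R] <= d%:E)%E.
Proof.
move=> mX d0.
have mj (j : nat) : measurable [set x | (0 < X x <= j.+1%:R^-1)%R].
  apply: measurable_bool; apply: measurable_and.
    exact: (measurable_fun_ltr (measurable_cst (0 : R)) mX).
  exact: (measurable_fun_ler mX (measurable_cst (j.+1%:R^-1 : R))).
have out : {ae P, forall x, exists M, forall j, (M <= j)%N -> ~ [set x | (0 < X x <= j.+1%:R^-1)%R] x}.
  apply: aeW => x; have [X0|X0] := leP (X x) 0.
    by exists 0%N => j _ /= /andP[h _]; rewrite ltNge X0 in h.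
  have /ltr_add_invr[s] := X0; rewrite add0r => hs.
  exists s => j sj /= /andP[_]; rewrite leNgt => /negP; apply; apply: le_lt_trans hs.
  by rewrite lef_pV2 ?posrE ?ltr0n// ler_nat.
have [M HM] := eventually_out_small mj out d0.
by exists (M.+1%:R^-1); [rewrite invr_gt0|exact: HM].
Qed.

Variables (N : nat -> Om -> R) (X : Om -> R).
Hypothesis mN : forall m, measurable_fun setT (N m).
Hypothesis mX : measurable_fun setT X.
Hypothesis cvX : {ae P, forall x, N ^~ x @ \oo --> X x}.

(** Here and in [small_mass_loss], the event excluded is a disagreement between N j and its
    limit X. *)
Lemma small_mass_revival (d th : R) : 0 < d -> 0 < th ->
  exists M, forall j, (M <= j)%N -> (P [set x | (X x <= 0)%R && (th <= N j x)%R] <= d%:E)%E.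
Proof.
move=> d0 th0; apply: eventually_out_small => //.
  move=> j; apply: measurable_bool; apply: measurable_and.
    exact: (measurable_fun_ler mX (measurable_cst (0 : R))).
  exact: (measurable_fun_ler (measurable_cst th) (mN j)).
apply: filterS cvX => x cv.
have [X0|X0] := leP (X x) 0; last by exists 0%N => j _ /= /andP[h _]; rewrite leNgt X0 in h.
have /cvgrPdist_lt/(_ _ th0)[M _ HM] := cv.
exists M => j Mj /= /andP[_ tN]; have := HM j Mj; rewrite /= ltr_norml; lra.
Qed.

Lemma small_mass_loss (eta d : R) : 0 < d ->
  exists M, forall j, (M <= j)%N -> (P [set x | (N j x < eta)%R && (eta < X x)%R] <= d%:E)%E.
Proof.
move=> d0; apply: eventually_out_small => //.
  move=> j; apply: measurable_bool; apply: measurable_and.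
    exact: (measurable_fun_ltr (mN j) (measurable_cst eta)).
  exact: (measurable_fun_ltr (measurable_cst eta) mX).
apply: filterS cvX => x cv.
have [X0|X0] := leP (X x) eta; first by exists 0%N => j _ /= /andP[_ h]; rewrite ltNge X0 in h.
have X1 : 0 < X x - eta by rewrite subr_gt0.
have /cvgrPdist_lt/(_ _ X1)[M _ HM] := cv.
exists M => j Mj /= /andP[tN _]; have := HM j Mj; rewrite /= ltr_norml; lra.
Qed.

End limit_thresholds.

Section extinction.
Context (R : realType) (dd : measure_display) (Om : measurableType dd) (P : probability Om R).
Local Notation mR := (measurableTypeR R).
Local Notation lam := (@circle_lebesgue R).
Local Notation torus n := (torus_lebesgue R n).
Local Notation cst_if := (@cst_if R).
Variable l : nat -> R.
Hypothesis l01 : forall n, 0 < l n < 1.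
Hypothesis lcvg0 : l @ \oo --> (0 : R).
Variable S2 : R.
Hypothesis lS2 : forall n, \sum_(k < n) l k ^+ 2 <= S2.
Variable omega : nat -> {RV P >-> R}.
Hypothesis indep : mutually_independent omega.
Hypothesis unif : forall n, circle_uniform (omega n).
Variable a : R.
Hypotheses (a0 : 0 <= a) (a1 : a + 1/8 <= 1).

Hypothesis N_cvg : {ae P, forall x, cvgn (fun m => mass l (starts omega m x))}.

Let hd n m (w : m.-tuple mR) : n.-tuple mR := [tuple nth 0 w i | i < n].

Let measurable_hd n m : measurable_fun setT (@hd n m).
Proof.
apply/measurable_fun_tnthP => i /=.
rewrite (_ : _ \o _ = fun w : m.-tuple mR => nth 0 w i : mR); first exact: measurable_nth_tuple.
by apply/funext => w /=; rewrite tnth_mktuple.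
Qed.

Let hd_starts n m x : (n <= m)%N -> hd n (starts omega m x) = starts omega n x.
Proof.
move=> nm; apply: eq_from_tnth => i; rewrite !tnth_mktuple nth_starts//.
exact: leq_trans nm.
Qed.

Let hd_upd n m (w : m.-tuple mR) (j : 'I_m) y : (n <= j)%N -> hd n (upd w j y) = hd n w.
Proof.
move=> nj; apply: eq_from_tnth => i; rewrite !tnth_mktuple nth_upd//.
exact: leq_trans nj.
Qed.

(** Let G be the event that N_n < eta.  For eta small, n large and then m large, G is close to
    extinction, and on G it is improbable that N_m exceeds a given level, so that
    [gap_event_bound] makes a gap improbable on G.  The parameter q of the gaps is
    eliminated last: gaps for q are gaps for every larger q. *)
Lemma gap_extinction_negligible :
  P.-negligible [set x | (forall n, exists q M, forall m, (M <= m)%N ->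
      gap_event l n a (q.+4%:R^-1) (starts omega m x)) /\
      mass l (starts omega m x) @[m --> \oo] --> (0 : R)].
Proof.
pose N0 m (x : Om) : R := mass l (starts omega m x).
have [N EN] : exists N, N = N0 by exists N0.
have NE m x : N m x = mass l (starts omega m x) by rewrite EN.
have mN m : measurable_fun setT (N m).
  by rewrite EN; apply: measurable_comp_starts; exact: measurable_mass.
have N_cvg' : {ae P, forall x, cvgn (N ^~ x)} by rewrite EN.
have [X mX cvX] := ae_limit mN N_cvg'.
apply: (@negligibleS _ _ _ P (~` [set x | N ^~ x @ \oo --> X x] `|` [set x | N ^~ x @ \oo --> X x /\
   (forall n, exists q M, forall m, (M <= m)%N ->
      gap_event l n a (q.+4%:R^-1) (starts omega m x)) /\ N ^~ x @ \oo --> (0 : R)])).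
  move=> x [h1 h2]; have [h3|h3] := pselect (N ^~ x @ \oo --> X x); last by left.
  by right; split => //; split => //; rewrite EN.
apply: negligibleU => //.
apply: negligible_of_small => r.
pose d : R := r.+1%:R^-1; have d0 : 0 < d by rewrite invr_gt0.
(* Three unlikely events enter with the factor 4 of [gap_event_bound], and c makes its error
   d / 4; with one more unlikely event the total is 13 d / 24 + d / 4. *)
pose d' := d / 24; have d'0 : 0 < d' by rewrite divr_gt0.
pose c := d / (32 * expR (8 * S2)).
have e0 : 0 < expR (8 * S2) := expR_gt0 _.
have c0 : 0 < c by rewrite divr_gt0// mulr_gt0.
have ce : 8 * c * expR (8 * S2) = d / 4 by rewrite /c; field; rewrite gt_eqF.
have [eta eta0 Heta] := small_positive_limit P mX d'0.
have small_out th : 0 < th ->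
    exists M, forall j, (M <= j)%N -> (P [set x | (X x <= 0)%R && (th <= N j x)%R] <= d'%:E)%E.
  move=> th0; exact: (small_mass_revival mN mX cvX d'0 th0).
have [n1 Hn1] := small_mass_loss mN mX cvX eta d'0.
have [n2 Hn2] := small_out eta eta0.
have [n0 Hn0] : exists M, forall j, (M <= j)%N -> l j <= 1/8.
  have h8 : (0 : R) < 1/8 by lra.
  have /cvgrPdist_lt/(_ _ h8)[M _ HM] := lcvg0.
  exists M => j Mj; have := HM j Mj; rewrite /= ltr_norml; lra.
(* The number of arcs that determine the event G, taken large enough for late arcs to be short
   and for G to be close to extinction. *)
pose n := maxn n0 (maxn n1 n2).
have nn0 : (n0 <= n)%N by exact: leq_maxl.
have nn1 : (n1 <= n)%N by apply: leq_trans (leq_maxr _ _); exact: leq_maxl.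
have nn2 : (n2 <= n)%N by apply: leq_trans (leq_maxr _ _); exact: leq_maxr.
have lsmall j : (n <= j)%N -> l j <= 1/8 by move=> nj; apply: Hn0; exact: leq_trans nj.
pose eps q : R := q.+4%:R^-1.
have eps0 q : 0 < eps q by rewrite invr_gt0.
have eps1 q : eps q <= 1/4 by rewrite div1r lef_pV2 ?posrE ?ltr0n// ler_nat.
pose B q m : set Om := [set x | (N n x < eta)%R && gap_event l n a (eps q) (starts omega m x)].
have mB q m : measurable (B q m).
  apply: measurable_bool; apply: measurable_and; first exact: measurable_fun_ltr.
  by apply: measurable_comp_starts; exact: measurable_gap_event.
have HB q : exists M, forall m, (M <= m)%N -> (P (B q m) <= (12 * d' + d / 4)%:E)%E.
  pose th := eps q / 4 * c; have th0 : 0 < th by rewrite mulr_gt0// divr_gt0.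
  have [M HM] := small_out th th0; exists (maxn n M) => m; rewrite geq_max => /andP[nm Mm].
  pose G (w : m.-tuple mR) : bool := mass l (hd n w) < eta.
  have mG : measurable_fun setT G.
    have mh : measurable_fun setT (fun w : m.-tuple mR => mass l (hd n w)).
      have := measurableT_comp (@measurable_mass _ _ l01 n) (@measurable_hd n m); exact.
    exact: (measurable_fun_ltr mh (measurable_cst eta)).
  have Gj (j : 'I_m) w y : (n <= j)%N -> G (upd w j y) = G w by move=> nj; rewrite /G hd_upd.
  have gb := gap_event_bound l01 lsmall a0 a1 (eps0 q) (eps1 q) lS2 mG Gj c0.
  have mGg : measurable_fun setT (fun w : m.-tuple mR => G w && gap_event l n a (eps q) w).
    by apply: measurable_and; [exact: mG|exact: measurable_gap_event].
  have BE : B q m = [set x | G (starts omega m x) && gap_event l n a (eps q) (starts omega m x)].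
    by rewrite /B; apply/seteqP; split => x /=; rewrite /G hd_starts// NE.
  have -> : P (B q m) = (\int[torus m]_w cst_if (G w && gap_event l n a (eps q) w))%E.
    rewrite -(integral_starts indep unif).
    - by rewrite -(measure_cst_if P (measurable_comp_starts omega mGg)) BE.
    - exact: measurable_cst_if.
    - by move=> w; exact: cst_if_ge0.
  apply: le_trans gb _; rewrite ce [leRHS]EFinD; apply: leeD => //.
  have mm : measurable_fun setT (fun w : m.-tuple mR => th <= mass l w).
    by apply: measurable_fun_ler; [exact: measurable_cst|exact: measurable_mass].
  have mGm : measurable_fun setT (fun w : m.-tuple mR => G w && (th <= mass l w)).
    by apply: measurable_and; [exact: mG|exact: mm].
  rewrite -(integral_starts indep unif (measurable_cst_if mGm) (fun w => cst_if_ge0 _ _)).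
  rewrite -(measure_cst_if P (measurable_comp_starts omega mGm)).
  pose A1 := [set x | (0 < X x <= eta)%R].
  pose A2 := [set x | (N n x < eta)%R && (eta < X x)%R].
  pose A3 := [set x | (X x <= 0)%R && (th <= N m x)%R].
  have mA1 : measurable A1.
    by apply: measurable_bool; apply: measurable_and; [exact: measurable_fun_ltr|exact: measurable_fun_ler].
  have mA2 : measurable A2 by apply: measurable_bool; apply: measurable_and; exact: measurable_fun_ltr.
  have mA3 : measurable A3 by apply: measurable_bool; apply: measurable_and; exact: measurable_fun_ler.
  have -> : (12 * d')%:E = (4%:E * (d'%:E + d'%:E + d'%:E))%E.
    by rewrite -!EFinD -EFinM; congr EFin; ring.
  apply: lee_wpmul2l => //.
  apply: (@le_trans _ _ (P (A1 `|` A2 `|` A3))).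
    apply: le_measure; rewrite ?inE//.
    - exact: (measurable_bool (measurable_comp_starts omega mGm)).
    - by apply: measurableU => //; exact: measurableU.
    move=> x /=; rewrite /G hd_starts// -!NE => /andP[h1 h2].
    have [h3|h3] := leP (X x) 0; first by right; rewrite /A3 /= h3.
    left; have [h4|h4] := leP (X x) eta; first by left; rewrite /A1 /= h3.
    by right; rewrite /A2 /= h1.
  have mA12 : measurable (A1 `|` A2) by exact: measurableU.
  apply: (le_trans (measureU2 P mA12 mA3)); apply: leeD; last exact: HM.
  by apply: (le_trans (measureU2 P mA1 mA2)); apply: leeD => //; exact: Hn1.
pose C := eventually_in (fun q => eventually_in (B q)).
have mE q : measurable (eventually_in (B q)) by exact: measurable_eventually_in.
have mC : measurable C by exact: measurable_eventually_in.
have PC : (P C <= (12 * d' + d / 4)%:E)%E.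
  apply: eventually_in_le => // q0; exists q0 => //; apply: eventually_in_le => // M.
  have [M' HM'] := HB q0; exists (maxn M M'); first exact: leq_maxl.
  by apply: HM'; exact: leq_maxr.
pose D := [set x | (X x <= 0)%R && (eta <= N n x)%R].
have mD : measurable D by apply: measurable_bool; apply: measurable_and; exact: measurable_fun_ler.
exists (D `|` C); split.
- exact: measurableU.
- move=> x [cv [H0 N00]].
  have X0 : X x = 0.
    by move: cv => /(cvg_unique _) /(_ N00); apply.
  have [hN|hN] := leP eta (N n x); first by left; rewrite /D /= X0 lexx hN.
  right; have [q [M HM]] := H0 n; exists q => q' qq; exists M => m Mm.
  rewrite /B /= hN /=; apply: gap_event_eps (HM m Mm).
  by rewrite /eps lef_pV2 ?posrE ?ltr0n// ler_nat !ltnS.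
apply: (le_trans (measureU2 P mD mC)).
apply: le_trans (leeD (Hn2 n nn2) PC) _.
by rewrite -EFinD lee_fin -/d /d'; lra.
Qed.

End extinction.

(** * The support of the measure *)

Section arcs.
Variable R : realType.
Local Notation mR := (measurableTypeR R).

(** Both sides say that s is at distance less than c / 2 from the centre of the arc. *)
Lemma arc_cosE (c s : R) : 0 < c < 1 ->
  (0 < mod1 s < c) = (cos (pi * c) < cos (2 * pi * s - pi * c)).
Proof.
move=> /andP[c0 c1]; have p0 : 0 < pi :> R by exact: pi_gt0.
have per : periodic1 (fun t : R => cos (2 * pi * t - pi * c)).
  move=> t; have := @cos_lin_periodic R (pi * c) 1 t; rewrite !mulr1; exact.
rewrite -(periodicE per s); have := mod1_ge0 s; have := mod1_lt1 s.
move: (mod1 s) => x x1 x0.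
have pc0 : 0 < pi * c by rewrite mulr_gt0.
have pcp : pi * c < pi by rewrite gtr_pMr.
have ic : pi * c \in `[0, pi]%R by rewrite in_itv/= !ltW.
have px0 : 0 <= pi * x by rewrite mulr_ge0// ltW.
have pxp : pi * x < pi by rewrite gtr_pMr.
have pxc : (pi * x < pi * c) = (x < c) by rewrite ltr_pM2l.
have pxc' : (0 < pi * x) = (0 < x) by rewrite pmulr_rgt0.
rewrite -pxc -pxc' -[2 * pi * x]mulrA; move: (pi * x) (pi * c) px0 pxp pc0 pcp ic pxc pxc' => X C X0 X1 C0 C1 ic _ _.
have cosC Z : 0 <= Z <= pi -> (cos C < cos Z) = (Z < C).
  by move=> hZ; rewrite ltr_cos// in_itv.
have [Y0|Y0] := leP 0 (2 * X - C).
  have [Yp|Yp] := leP (2 * X - C) pi; first by rewrite cosC ?Y0//; apply/idP/idP; lra.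
  rewrite -(cosN (2 * X - C)) -(cosD2pi (- (2 * X - C))) cosC; last lra.
  by apply/idP/idP; lra.
by rewrite -(cosN (2 * X - C)) cosC; [apply/idP/idP; lra|lra].
Qed.

Variables l w : nat -> R.
Hypothesis l01 : forall n, 0 < l n < 1.

Lemma random_arcE n t : random_arc l w n t <-> (0 <= t < 1) /\ (0 < mod1 (t - w n) < l n).
Proof.
have /andP[p0 p1] := l01 n; split.
  move=> [s /=]; rewrite in_itv/= => /andP[s0 s1] <-; rewrite mod1_ge0 mod1_lt1; split => //.
  by rewrite mod1Dl mod1_id; lra.
move=> [t01 h]; exists (w n + mod1 (t - w n)); first by rewrite /= in_itv/=; lra.
by rewrite mod1Dr addrC subrK mod1_id.
Qed.

Lemma noncoveredE t : noncovered l w t <->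
  (0 <= t < 1) /\ (forall n, ~~ (0 < mod1 (t - w n) < l n)).
Proof.
rewrite /noncovered /circle; split.
  move=> [/= t01 nt]; rewrite in_itv/= in t01; split => // n; apply/negP => h.
  by apply: nt; exists n => //; apply/random_arcE.
move=> [t01 nt]; split; first by rewrite /= in_itv.
by move=> [n _ /random_arcE[_ h]]; have := nt n; rewrite h.
Qed.

Lemma continuous_arc_cos n : continuous (fun t : R => cos (2 * pi * t - (2 * pi * w n + pi * l n))).
Proof. exact: continuous_cos_lin. Qed.

Lemma in_arcE n t : (0 < mod1 (t - w n) < l n) =
  (cos (pi * l n) < cos (2 * pi * t - (2 * pi * w n + pi * l n))).
Proof. by rewrite arc_cosE//; congr (_ < cos _); ring. Qed.

(** By [in_arcE] the condition of being uncovered is closed for each arc. *)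
Lemma noncovered_closed : circle_closed (noncovered l w).
Proof.
split; first by move=> t [].
have -> : [set t | noncovered l w (mod1 t)] =
    \bigcap_n ((fun t => cos (2 * pi * t - (2 * pi * w n + pi * l n))) @^-1` [set x | x <= cos (pi * l n)]).
  apply/seteqP; split => t.
    move=> /noncoveredE[_ h] n _ /=; have := h n; rewrite mod1Dl in_arcE -leNgt; exact.
  move=> h; apply/noncoveredE; rewrite mod1_ge0 mod1_lt1; split => // n.
  by rewrite mod1Dl in_arcE -leNgt; exact: h.
apply: closed_bigI => n _; apply: preimage_closed; last exact: closed_le.
by move=> t _; exact: continuous_arc_cos.
Qed.

Variable mu : {finite_measure set mR -> \bar R}.
Hypothesis mu_dvo : is_dvoretzky_measure l w mu.

(** The test function is continuous and positive exactly on the arc.  Its integrals against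
    the densities vanish as soon as the arc is one of the factors. *)
Lemma arc_negligible n : mu.-negligible [set t | 0 < mod1 (t - w n) < l n].
Proof.
pose g (t : R) := cos (2 * pi * t - (2 * pi * w n + pi * l n)) - cos (pi * l n).
pose f (t : R) := Num.max 0 (g t).
have cg : continuous g.
  by move=> t; apply: cvgB; [exact: continuous_arc_cos|exact: cvg_cst].
have cf : continuous f.
  by move=> t; apply: (@continuous_max _ _ (cst 0) g); [exact: cst_continuous|exact: cg].
have pf t : f (t + 1) = f t.
  rewrite /f /g; have := @cos_lin_periodic R (2 * pi * w n + pi * l n) 1 t.
  by rewrite !mulr1 => ->.
have fE t : (0 < f t) = (0 < mod1 (t - w n) < l n).
  by rewrite /f lt_max ltxx/= subr_gt0 in_arcE.
have f0 t : 0 <= f t by rewrite le_max lexx.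
have f2 t : f t <= 2.
  rewrite /f ge_max ler0n /= /g.
  have := cos_le1 (2 * pi * t - (2 * pi * w n + pi * l n)); have := cos_geN1 (pi * l n); lra.
have mf : measurable_fun [set: mR] f by exact: continuous_measurable_fun.
have [_ H] := mu_dvo; have Hf := H f cf pf.
have I0 : \int[mu]_t f t = 0.
  have : \int[@circle_lebesgue R]_t (f t * dvoretzky_density l w m t) @[m --> \oo] --> (0 : R).
    apply: cvg_near_cst; exists n.+1 => // m /= nm.
    rewrite (_ : (fun t => _) = cst 0) ?Rintegral_cst ?mul0r//.
    apply/funext => t /=; rewrite /dvoretzky_density (bigD1 (Ordinal nm))//= dvoretzky_factorE -fE.
    have [_|] := ltP 0 (f t); first by rewrite !mul0r mulr0.
    by move=> h; have -> : f t = 0 by [apply/eqP; rewrite eq_le h f0]; rewrite mul0r.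
  exact: (cvg_unique _ Hf).
have EI : (\int[mu]_t (f t)%:E = 0)%E.
  rewrite -(fineK (x := (\int[mu]_t (f t)%:E)%E)); first by rewrite -[fine _]/(\int[mu]_t f t) I0.
  rewrite ge0_fin_numE; last by apply: integral_ge0 => t _; rewrite lee_fin.
  apply: (@le_lt_trans _ _ (\int[mu]_t (2%:E))%E).
    by apply: ge0_le_integral => //; [move=> t _; rewrite lee_fin|exact/measurable_EFinP|move=> t _; rewrite lee_fin].
  by rewrite integral_cst// lte_mul_pinfty// ltey_eq fin_num_measure.
have : ae_eq mu setT (fun t => (f t)%:E) (cst 0%E).
  apply/(ae_eq_integral_abs mu measurableT); first exact/measurable_EFinP.
  by under eq_integral do rewrite gee0_abs ?lee_fin//.
apply: negligibleS => t /=; rewrite -fE => ft h.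
by have [] := h I => ft0; move: ft; rewrite ft0 ltxx.
Qed.

Lemma noncovered_carries : mu.-negligible (~` noncovered l w).
Proof.
have [mu0 _] := mu_dvo.
apply: (@negligibleS _ _ _ mu (~` @circle R `|` \bigcup_n [set t | 0 < mod1 (t - w n) < l n])).
  move=> t nt; have [ct|ct] := pselect (circle t); last by left.
  right; apply: contrapT => h; apply: nt; apply/noncoveredE; split; first by rewrite /circle /= in_itv in ct.
  by move=> n; apply/negP => hn; apply: h; exists n.
apply: negligibleU; last by apply: negligible_bigcup => n; exact: arc_negligible.
by exists (~` @circle R); split; [exact: (measurableC (@measurable_circle R))|exact: mu0|].
Qed.

End arcs.

Section survival.
Context (R : realType) (dd : measure_display) (Om : measurableType dd) (P : probability Om R).
Local Notation mR := (measurableTypeR R).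
Variable l : nat -> R.
Hypothesis l01 : forall n, 0 < l n < 1.
Hypothesis lcvg0 : l @ \oo --> (0 : R).
Hypothesis lsum : (\sum_(0 <= n <oo) (l n)%:E = +oo)%E.
Variable S2 : R.
Hypothesis lS2 : forall n, \sum_(k < n) l k ^+ 2 <= S2.
Variable omega : nat -> {RV P >-> R}.
Hypothesis indep : mutually_independent omega.
Hypothesis unif : forall n, circle_uniform (omega n).
Variable muD : Om -> {finite_measure set mR -> \bar R}.
Hypothesis muD_limit : {ae P, forall x, is_dvoretzky_measure l (omega^~ x) (muD x)}.

Lemma mass_cvg x : is_dvoretzky_measure l (omega^~ x) (muD x) ->
  mass l (starts omega m x) @[m --> \oo] --> fine (muD x setT).
Proof.
move=> [_ H]; have c1 : continuous (cst 1 : R -> R) by move=> t; exact: cvg_cst.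
have := H _ c1 (fun=> erefl).
rewrite Rintegral_cst// mul1r; apply: cvg_trans; apply: near_eq_cvg; apply: nearW => m.
rewrite /mass; apply: eq_Rintegral => t _; rewrite mul1r /density /dvoretzky_density.
apply: eq_bigr => k _; rewrite !dvoretzky_factorE /wseq nth_starts//.
Qed.

Lemma ae_window_alive (a : R) : 0 <= a -> a + 1/8 <= 1 ->
  {ae P, forall x u, noncovered l (omega^~ x) u -> a <= u <= a + 1/8 -> muD x setT != 0%E}.
Proof.
move=> a0 a1.
have cv : {ae P, forall x, cvgn (fun m => mass l (starts omega m x))}.
  by apply: filterS muD_limit => x /mass_cvg h; apply/cvg_ex; eexists; exact: h.
have dead : {ae P, forall x, ~ ((forall n, exists q M, forall m, (M <= m)%N ->
      gap_event l n a (q.+4%:R^-1) (starts omega m x)) /\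
      mass l (starts omega m x) @[m --> \oo] --> (0 : R))}.
  apply: negligibleS (gap_extinction_negligible l01 lcvg0 lS2 indep unif a0 a1 cv) => x /=.
  by move=> /contrapT.
have ca := ae_covered_point l01 lsum indep unif a.
have cw := ae_covered_starts l01 lsum indep unif.
apply: filterS3 (filterI dead ca) cw muD_limit => x [dx cax] cwx mx u /(noncoveredE _ l01)[u01 nu] au.
have /andP[u0 u1] := u01; have /andP[au1 au2] := au.
apply: contra_notN dx => /eqP mu0; split.
  move=> n; exact: (gap_event_eventually l01 a0 au1 au2 u1 cax cwx nu n).
by have := mass_cvg mx; rewrite mu0.
Qed.

(** The circle is covered by eight windows. *)
Lemma ae_mass_alive :
  {ae P, forall x, noncovered l (omega^~ x) !=set0 -> muD x setT != 0%E}.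
Proof.
have H i : {ae P, forall x, (i < 8)%N -> forall u, noncovered l (omega^~ x) u ->
    i%:R / 8 <= u <= i%:R / 8 + 1/8 -> muD x setT != 0%E}.
  have [i8|i8] := ltnP i 8; last by apply: aeW.
  have i7 : (i%:R : R) <= 7 by rewrite (ler_nat _ _ 7).
  have i0 : 0 <= (i%:R : R) by rewrite ler0n.
  by apply: filterS (@ae_window_alive (i%:R / 8) _ _) => [x h _| |]; [exact: h|lra|lra].
apply: filterS (ae_foralln H) => x hx [u hu].
have /(noncoveredE _ l01)[/andP[u0 u1] _] := hu.
have u8 : 0 <= 8 * u by lra.
have /andP[t1 t2] := truncn_itv u8.
apply: (hx (Num.truncn (8 * u)) _ u hu).
  by rewrite -(ltr_nat R); apply: le_lt_trans t1 _; lra.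
have t3 : (Num.truncn (8 * u))%:R + 1 = (Num.truncn (8 * u)).+1%:R :> R by exact: natr1.
by rewrite -t3 in t2; lra.
Qed.

End survival.

Theorem corollary1p2 (R : realType) (disp : measure_display)
    (Om : measurableType disp) (P : probability Om R)
    (l : nat -> R) (omega : nat -> {RV P >-> R})
    (muD : Om -> {finite_measure set (measurableTypeR R) -> \bar R})
    (l_in01 : forall n, 0 < l n < 1)
    (l_decreasing : {homo l : m n / (m <= n)%N >-> n <= m})
    (l_cvg0 : l @ \oo --> (0 : R))
    (l_sum : (\sum_(0 <= n <oo) (l n)%:E = +oo)%E)
    (l_shepp : (\sum_(0 <= n <oo)
       ((l n - l n.+1) * expR (\sum_(k < n.+1) l k))%:E < +oo)%E)
    (omega_indep : mutually_independent omega)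
    (omega_unif : forall n, circle_uniform (omega n))
    (muD_limit :
       {ae P, forall x, is_dvoretzky_measure l (omega^~ x) (muD x)})
    (K_int : exists2 d : nat, (1 <= d)%N &
       (\int[torus_lebesgue R d]_t
          ((\prod_(i < d) covering_kernel l (tnth t i)) *
           covering_kernel l (- \sum_(i < d) tnth t i)%R) < +oo)%E) :
  {ae P, forall x,
     rajchman (muD x) /\
     (noncovered l (omega^~ x) !=set0 -> M0_set (noncovered l (omega^~ x)))}.
Proof.
have [S2 lS2] := square_sum_bounded l_in01 l_decreasing l_cvg0 l_shepp.
have [d d1 Kd] := K_int.
have raj := ae_rajchman l_in01 l_decreasing lS2 omega_indep omega_unif d1 Kd muD_limit.
have alive := ae_mass_alive l_in01 l_cvg0 l_sum lS2 omega_indep omega_unif muD_limit.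
apply: filterS3 raj alive muD_limit => x rx ax mx; split => // ne; split.
  exact: noncovered_closed.
by exists (muD x); split => //; [exact: ax|exact: noncovered_carries].
Qed.
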